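(* Let $\kappa>0$ be a constant independent of $N$. For each $N$, let $M=M_N\ge 1$, let $X=(X_1,\dots,X_M)$ be a random vector, and let $H_N=\Phi(X)$ with $\Phi=\Phi_N:\mathbb{R}^M\to\mathscr{S}_N$ deterministic. Assume: (I) $X_1,\dots,X_M$ are independent and real-valued. (M) $\Phi$ is Lipschitz (with respect to the norm $\|\cdot\|_{\widetilde F}$ on $\mathscr{S}_N$), and $\Phi^{-1}(A)$ is convex for any convex set $A$. (E) There is a sequence of probability measures $(\mu_N)$ on $\mathbb{R}$ such that $d_{\mathrm{BL}}(\mathbb{E}\hat\mu_{\Phi(X)},\mu_N)\le N^{-\kappa}$; the $\mu_N$'s are supported in a common compact set; and each $\mu_N$ has a density $\mu_N(\cdot)$ in the neighborhood $(-\kappa,\kappa)$ of $0$ which satisfies $\mu_N(x)<\kappa^{-1}|x|^{-1+\kappa}$ for all $|x|<\kappa$ and all $N$. (C) Writing $(\lambda_i)_{i=1}^N$ for the eigenvalues of $\Phi(X)$, for every $\epsilon>0$, $$\lim_{N\to\infty}\frac1N\log\mathbb{E}\Big[\prod_{i=1}^N\big(1+|\lambda_i|\mathbf{1}_{|\lambda_i|>e^{N^\epsilon}}\big)\Big]=0,\qquad \lim_{N\to\infty}\mathbb{P}\big(\Phi(X)\text{ has no eigenvalues in }[-e^{-N^\epsilon},e^{-N^\epsilon}]\big)=1;$$ and there exists $\delta>0$ such that $$\limsup_{N\to\infty}\frac{1}{N\log N}\log\mathbb{E}\big[|\det(H_N)|^{1+\delta}\big]<\infty.$$ (S) With $(X_{\mathrm{cut}})_i=X_i\mathbf{1}_{|X_i|<N^{-\kappa}/\|\Phi\|_{\mathrm{Lip}}}$,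 $$\lim_{N\to\infty}\frac{1}{N\log N}\log\mathbb{P}\big(d_{\mathrm{KS}}(\hat\mu_{\Phi(X)},\hat\mu_{\Phi(X_{\mathrm{cut}})})>N^{-\kappa}\big)=-\infty.$$ Then $$\lim_{N\to\infty}\left(\frac1N\log\mathbb{E}[|\det(H_N)|]-\int_{\mathbb{R}}\log|\lambda|\,\mu_N(d\lambda)\right)=0.$$
   Context: $\mathscr{S}_N$ is the space of $N\times N$ real symmetric matrices with norm $\|T\|_{\widetilde F}^2=\sum_{1\le i\le j\le N}T_{ij}^2$. For $f:\mathbb{R}^m\to\mathbb{R}^n$, $\|f\|_{\mathrm{Lip}}=\sup_{x\ne y}|f(x)-f(y)|/|x-y|$ with Euclidean norms; $\|\Phi\|_{\mathrm{Lip}}$ uses the Euclidean norm on $\mathbb{R}^M$ and $\|\cdot\|_{\widetilde F}$ on $\mathscr{S}_N$. For a symmetric $N\times N$ matrix $T$ with eigenvalues $\lambda_i(T)$, $\hat\mu_T=\frac1N\sum_{i=1}^N\delta_{\lambda_i(T)}$; $\mathbb{E}\hat\mu_T$ is the averaged measure when $T$ is random. For probability measures $\mu,\nu$ on $\mathbb{R}$: $d_{\mathrm{BL}}(\mu,\nu)=\sup\{|\int f\,d(\mu-\nu)|:\|f\|_{\mathrm{Lip}}+\|f\|_{L^\infty}\le1\}$ and $d_{\mathrm{KS}}(\mu,\nu)=\sup_{x\in\mathbb{R}}|\mu((-\infty,x])-\nu((-\infty,x])|$. *)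

(* Defs.v *)
From mathcomp Require Import all_boot all_order all_algebra.
From mathcomp Require Import all_classical all_reals all_analysis.
From mathcomp Require Import polyrcf.

Set Implicit Arguments.
Unset Strict Implicit.
Unset Printing Implicit Defensive.

Import Order.TTheory GRing.Theory Num.Theory.
Import numFieldNormedType.Exports.

Local Open Scope classical_set_scope.
Local Open Scope ring_scope.

Section norms.
Context {R : realType}.

(* The library norm on matrices is the sup norm, hence these two. *)
Definition l2norm (m : nat) (x : 'rV[R]_m) : R :=
  Num.sqrt (\sum_(i < m) x 0 i ^+ 2).

Definition Ftilde_norm (N : nat) (T : 'M[R]_N) : R :=
  Num.sqrt (\sum_(i < N) \sum_(j < N | (i <= j)%N) T i j ^+ 2).

Definition Lip_norm (V W : zmodType) (nV : V -> R) (nW : W -> R) (f : V -> W)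
    : \bar R :=
  ereal_sup [set r | exists x y : V,
    x != y /\ r = (nW (f x - f y) / nV (x - y))%:E].

End norms.

Section spectrum.
Context {R : realType}.

(* In increasing order and repeated according to their multiplicity as roots
   of the characteristic polynomial; there are N of them when T is symmetric. *)
Definition eigenvalues (N : nat) (T : 'M[R]_N) : seq R :=
  flatten [seq nseq (mup x (char_poly T)) x | x <- rootsR (char_poly T)].

Definition esd (N : nat) (T : 'M[R]_N) : {measure set R -> \bar R} :=
  mscale (N%:R^-1 : R)%:nng
    (msum (fun i : nat => \d_(nth 0 (eigenvalues T) i)
                          : {measure set R -> \bar R}) N).

(* A bare set function: that it is a measure depends on the measurability of
   w |-> esd (H w) A. This is why the two distances below are defined on set
   functions. *)
Definition mean_esd d (Omega : measurableType d) (P : probability Omega R)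
    (N : nat) (H : Omega -> 'M[R]_N) : set R -> \bar R :=
  fun A => (\int[P]_w esd (H w) A)%E.

End spectrum.

Section distances.
Context {R : realType}.
Local Open Scope ereal_scope.

Definition dBL (mu nu : set R -> \bar R) : \bar R :=
  ereal_sup [set r | exists f : R -> R,
    Lip_norm (fun x : R => `|x|%R) (fun x : R => `|x|%R) f
      + 'N[lebesgue_measure]_+oo [EFin \o f] <= 1 /\
    r = `| \int[mu]_x (f x)%:E - \int[nu]_x (f x)%:E |].

Definition dKS (mu nu : set R -> \bar R) : \bar R :=
  ereal_sup [set r | exists x : R,
    r = `| mu `]-oo, x]%classic - nu `]-oo, x]%classic |].

End distances.

Section probability.
Context {R : realType} d {Omega : measurableType d} {P : probability Omega R}.

Definition mutually_independent (m : nat) (X : 'I_m -> {RV P >-> R}) : Prop :=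
  forall (J : {set 'I_m}) (A : 'I_m -> set R),
    (forall i, measurable (A i)) ->
    P (\bigcap_(i in [set` J]) X i @^-1` A i)
      = (\prod_(i in J) P (X i @^-1` A i))%E.

Definition random_vector (m : nat) (X : 'I_m -> {RV P >-> R}) (w : Omega)
    : 'rV[R]_m :=
  \row_i X i w.

Definition cut_vector (m : nat) (c : R) (X : 'I_m -> {RV P >-> R}) (w : Omega)
    : 'rV[R]_m :=
  \row_i (X i w * (`|X i w| < c)%R%:R).

End probability.

Definition has_density_on {R : realType} (mu : probability R R) (D : set R)
    (rho : R -> R) : Prop :=
  [/\ measurable_fun D rho,
      (forall x, D x -> 0 <= rho x) &
      forall A : set R, measurable A -> A `<=` D ->
        mu A = (\int[lebesgue_measure]_(x in A) (rho x)%:E)%E].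

(* Main.v *)
(* All quantities are approximated by linear statistics of the truncated logarithm
   [log (clamp e b |x|)] with [e = N^(-kappa/2)] and [b = exp (N^eps)]. It is a
   difference of convex [1/e]-Lipschitz functions of the eigenvalue, and the trace
   of a convex function is convex on symmetric matrices; so, by the assumption on
   preimages of convex sets, each of the two traces is a Lipschitz quasi-convex
   function of the independent entries. Talagrand's convex distance inequality for
   the cut entries, transferred to the original ones by the Kolmogorov-Smirnov
   assumption, concentrates the statistic around its mean, and the bounded
   Lipschitz assumption identifies the mean with the integral against [mu N].

   The truncation is harmless: the density bound gives mass [O(r^a)] to [|x| < r],
   so the singularity of the logarithm contributes [O(e^a)] to the integral; few
   eigenvalues lie in [|x| < e], and with positive probability none is below
   [exp (- N^eps)], which gives the lower bound; for the upper bound, large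
   eigenvalues are controlled by the first part of (C), and the exceptional event
   by splitting [|det| <= s + s^(-delta) |det|^(1 + delta)]. *)
Require Import Defs.
From mathcomp Require Import all_boot all_order all_algebra.
From mathcomp Require Import all_classical all_reals all_analysis.
From HB Require Import structures.
From mathcomp Require Import measurable_realfun ess_sup_inf.
From mathcomp Require Import polyrcf complex spectral ring lra.
Import Order.TTheory GRing.Theory Num.Theory.
Import numFieldNormedType.Exports.
Local Open Scope classical_set_scope.
Local Open Scope ring_scope.

Set Implicit Arguments.
Unset Strict Implicit.

(** * Eigenvalues of real symmetric matrices *)

(** The map from entries to matrices need not be linear, so the trace of a convex function is only
    quasi-convex in the entries. The convex distance inequality then bounds products P(F <= r) P(F
    >= r + 3t), which concentrates F around a median; the two convex parts of the logarithm are
    recombined at that stage, and only afterwards is the centre moved to the mean. The scale e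
    answers two demands. Cutting the entries at beta / Lip, with beta = N^(-kappa), and testing with
    slope 1/e gives a Gaussian exponent of order N (e / beta)^2, which is N^(1 + kappa) for e =
    N^(-kappa/2). It has to beat every N^(-L N), because on the exceptional event only the bound
    N^(C N) on the moment of order 1 + delta is available. At the same time beta / e has to vanish,
    being the error made by testing a 1/e-Lipschitz function in the bounded Lipschitz distance. The
    convex distance inequality is proved for product laws on finite grids, where expectations are
    finite sums and every set is measurable. It reaches real entries by rounding, whose cost the
    Lipschitz constant controls. *)

Lemma jensen_sum {R : realFieldType} {I : finType} (f : R -> R) (W x : I -> R) :
  (forall x y t : R, 0 <= t <= 1 ->
     f (t * x + (1 - t) * y) <= t * f x + (1 - t) * f y) ->
  (forall i, 0 <= W i) -> \sum_i W i = 1 ->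
  f (\sum_i W i * x i) <= \sum_i W i * f (x i).
Proof.
move=> cf W0.
(* Partial weights do not add up to one, so the induction runs on the normalised inequality over
   lists of positive total weight. *)
suff gen (r : seq I) : 0 < \sum_(i <- r) W i ->
    f ((\sum_(i <- r) W i * x i) / \sum_(i <- r) W i)
      <= (\sum_(i <- r) W i * f (x i)) / \sum_(i <- r) W i.
  by move=> W1; have := gen (index_enum I); rewrite W1 !divr1; apply; exact: ltr01.
elim: r => [|i r IH]; first by rewrite big_nil ltxx.
rewrite !big_cons; set s := \sum_(j <- r) W j.
have s0 : 0 <= s by exact: sumr_ge0.
have [/eqP sz|sp] := boolP (s == 0).
  have Wz j : j \in r -> W j = 0.
    by move=> jr; move: sz => /eqP; rewrite psumr_eq0 // => /allP/(_ _ jr)/eqP.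
  rewrite sz !addr0 => Wi.
  rewrite !big1_seq ?addr0; last first.
  - by move=> j /andP[_ /Wz ->]; rewrite mul0r.
  - by move=> j /andP[_ /Wz ->]; rewrite mul0r.
  by rewrite ![W i * _]mulrC !mulfK // gt_eqF.
have {}s0 : 0 < s by rewrite lt_def sp.
move=> Ws; have {IH}IH := IH s0; set a := W i; set A := \sum_(j <- r) W j * x j.
set B := \sum_(j <- r) W j * f (x j) in IH *.
have ea : (a * x i + A) / (a + s) = a / (a + s) * x i + (1 - a / (a + s)) * (A / s).
  by field; rewrite !gt_eqF.
have eB : (a * f (x i) + B) / (a + s)
    = a / (a + s) * f (x i) + (1 - a / (a + s)) * (B / s).
  by field; rewrite !gt_eqF.
have t01 : 0 <= a / (a + s) <= 1.
  by rewrite divr_ge0 ?W0 ?(ltW Ws) //= ler_pdivrMr // mul1r lerDl ltW.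
rewrite ea eB; apply: (le_trans (cf _ _ _ t01)); rewrite lerD2l ler_wpM2l //.
by rewrite subr_ge0; case/andP: t01.
Qed.

Section Spectral.
Context {R : realType}.

Lemma mup_prod_XsubC (s : seq R) (x : R) :
  mup x (\prod_(a <- s) ('X - a%:P)) = count_mem x s.
Proof.
elim: s => [|a s IH]; first by rewrite big_nil mupNroot // root1.
rewrite big_cons mupM ?polyXsubC_eq0 //; last first.
  by rewrite monic_neq0 // monic_prod_XsubC.
by rewrite IH /= -['X - a%:P]expr1 mup_XsubCX eq_sym; case: eqP.
Qed.

Lemma sorted_flatten_nseq (n : R -> nat) (s : seq R) :
  sorted <%R s -> sorted <=%R (flatten [seq nseq (n x) x | x <- s]).
Proof.
rewrite !sorted_pairwise //; [|exact: le_trans|exact: lt_trans].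
elim: s => [|x s IH] //= /andP[/allP xs ps].
rewrite pairwise_cat IH // andbT; apply/andP; split.
  apply/allrelP => a b; rewrite mem_nseq => /andP[_ /eqP ->].
  move=> /flatten_mapP[y ys]; rewrite mem_nseq => /andP[_ /eqP ->].
  exact: ltW (xs _ ys).
elim: (n x) => //= k ->; rewrite andbT; apply/allP => y.
by rewrite mem_nseq => /andP[_ /eqP ->].
Qed.

Lemma eigenvalues_sorted (N : nat) (T : 'M[R]_N) : sorted <=%R (eigenvalues T).
Proof. exact/sorted_flatten_nseq/sorted_roots. Qed.

(** Both lists repeat a number as often as its multiplicity in the characteristic polynomial, so any
    factorisation into linear factors gives the eigenvalues up to order. *)
Lemma perm_eigenvalues (N : nat) (T : 'M[R]_N) (s : seq R) :
  char_poly T = \prod_(a <- s) ('X - a%:P) -> perm_eq (eigenvalues T) s.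
Proof.
move=> Ts; apply/allP => x _ /=; apply/eqP.
have T0 : char_poly T != 0 by rewrite monic_neq0 // char_poly_monic.
have ur : uniq (rootsR (char_poly T)).
  by apply: (@sorted_uniq _ <%R); [exact: lt_trans|exact: ltxx|exact: sorted_roots].
have xr : (x \in rootsR (char_poly T)) = root (char_poly T) x.
  by have /roots_onP/(_ x) := roots_on_rootsR T0; rewrite in_itv /= => ->.
transitivity (mup x (char_poly T)); last by rewrite Ts mup_prod_XsubC.
rewrite /eigenvalues count_flatten -map_comp sumnE big_map.
have [rx|nrx] := boolP (root (char_poly T) x).
  rewrite (bigD1_seq x) ?xr //= count_nseq /= eqxx mul1n big1 ?addn0 // => y yx.
  by rewrite count_nseq /= (negPf yx).
rewrite mupNroot //; apply: big1_seq => y /andP[_ yr] /=; rewrite count_nseq /=.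
by case: eqP => // yx; move: nrx; rewrite -xr -yx yr.
Qed.

Local Notation C := R[i].
Local Notation toC := (map_mx (real_complex R)).
Local Notation "M ^t*" := (map_mx Num.conj (trmx M)) (at level 30).

(** The spectral theorem is applied to the complexification. For symmetric [T] the diagonal is real,
    so taking real parts loses nothing. *)
Definition spectrum_of {N : nat} (T : 'M[R]_N) (i : 'I_N) : R :=
  complex.Re (spectral_diag (toC T) 0 i).

(** The quadratic form of [T] on the [i]-th row of [U], a Rayleigh quotient for unitary [U]. Unlike
    an eigenvalue, it is linear in [T] once [U] is fixed. *)
Definition diag_entry {N : nat} (U : 'M[C]_N) (T : 'M[R]_N) (i : 'I_N) : R :=
  complex.Re ((U *m toC T *m U ^t*) i i).

Definition frame {N : nat} (T : 'M[R]_N) : 'M[C]_N := spectralmx (toC T).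

Lemma conj_real_complex (x : R) : Num.conj (real_complex R x) = real_complex R x.
Proof. by apply/CrealP/complex_realP; exists x. Qed.

Lemma symC_herm {N : nat} {T : 'M[R]_N} : T \is symmetricmx -> toC T \is hermsymmx.
Proof.
move=> /is_hermitianmxP; rewrite expr0 scale1r => ET; apply/is_hermitianmxP.
rewrite expr0 scale1r; apply/matrixP => i j; rewrite !mxE conj_real_complex.
by rewrite [in LHS]ET !mxE.
Qed.

Lemma frame_unitary {N : nat} (T : 'M[R]_N) : frame T \is unitarymx.
Proof. exact: spectral_unitarymx. Qed.

Lemma symC_spectral {N : nat} {T : 'M[R]_N} : T \is symmetricmx ->
  toC T = (frame T) ^t* *m diag_mx (\row_i real_complex R (spectrum_of T i)) *m frame T.
Proof.
move=> /symC_herm hT; have /hermitian_normalmx/orthomx_spectralP E := hT.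
have iE : invmx (spectralmx (toC T)) = (frame T) ^t* := invmx_unitary (frame_unitary T).
have -> : \row_i real_complex R (spectrum_of T i) = spectral_diag (toC T).
  have /mxOverP hr := hermitian_spectral_diag_real hT.
  by apply/rowP => i; rewrite mxE /spectrum_of RRe_real.
by rewrite -iE.
Qed.

Lemma char_poly_conj (F : comNzRingType) (N : nat) (P Q A : 'M[F]_N) :
  Q *m P = 1%:M -> char_poly (P *m A *m Q) = char_poly A.
Proof.
move=> QP; have PQ := mulmx1C QP; rewrite /char_poly.
have -> : char_poly_mx (P *m A *m Q)
    = map_mx polyC P *m char_poly_mx A *m map_mx polyC Q.
  rewrite /char_poly_mx mulmxBr mulmxBl -!map_mxM; congr (_ - _).
  by rewrite scalar_mxC -mulmxA -map_mxM PQ map_mx1 mulmx1.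
rewrite !det_mulmx mulrAC -det_mulmx -map_mxM PQ map_mx1 det1 mul1r.
by [].
Qed.

Lemma char_poly_sym {N : nat} {T : 'M[R]_N} : T \is symmetricmx ->
  char_poly T = \prod_(a <- [seq spectrum_of T i | i <- enum 'I_N]) ('X - a%:P).
Proof.
move=> sT; apply: (map_poly_inj (real_complex R)).
have /unitarymxP U1 := frame_unitary T.
rewrite map_char_poly (symC_spectral sT) char_poly_conj //.
rewrite char_poly_trig ?diag_mx_is_trig // rmorph_prod big_map big_enum /=.
by apply: eq_bigr => i _; rewrite !mxE eqxx mulr1n rmorphB /= map_polyX map_polyC.
Qed.

Lemma eigenvalues_spectrum {N : nat} {T : 'M[R]_N} : T \is symmetricmx ->
  perm_eq (eigenvalues T) [seq spectrum_of T i | i <- enum 'I_N].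
Proof. by move=> sT; apply/perm_eigenvalues/char_poly_sym. Qed.

Lemma size_eigenvalues {N : nat} {T : 'M[R]_N} : T \is symmetricmx ->
  size (eigenvalues T) = N.
Proof. by move=> /eigenvalues_spectrum/perm_size->; rewrite size_map size_enum_ord. Qed.

Lemma det_eigenvalues {N : nat} {T : 'M[R]_N} : T \is symmetricmx ->
  \det T = \prod_(l <- eigenvalues T) l.
Proof.
move=> sT; have /(congr1 (fun p => p.[0])) := char_poly_sym sT.
rewrite horner_coef0 char_poly_det horner_prod -(perm_big _ (eigenvalues_spectrum sT)) /=.
rewrite (eq_bigr (fun l => - l)) => [|l _]; last by rewrite !hornerE ?sub0r.
have -> : \prod_(l <- eigenvalues T) - l
    = (-1) ^+ N * \prod_(l <- eigenvalues T) l.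
  have := size_eigenvalues sT; move: (eigenvalues T) => e <-.
  elim: e => [|l s IH] /=.
    by rewrite !big_nil mulr1.
  by rewrite !big_cons IH exprS; ring.
by apply: mulfI; rewrite expf_neq0 // oppr_eq0 oner_neq0.
Qed.

Lemma diag_entry_frame {N : nat} {T : 'M[R]_N} (i : 'I_N) : T \is symmetricmx ->
  diag_entry (frame T) T i = spectrum_of T i.
Proof.
move=> sT; have /unitarymxP U1 := frame_unitary T.
rewrite /diag_entry (symC_spectral sT) !mulmxA U1 mul1mx -mulmxA U1 mulmx1.
by rewrite !mxE eqxx mulr1n.
Qed.

Lemma diag_entry_comb {N : nat} (U : 'M[C]_N) (a b : R) (S T : 'M[R]_N) (i : 'I_N) :
  diag_entry U (a *: S + b *: T) i = a * diag_entry U S i + b * diag_entry U T i.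
Proof.
rewrite /diag_entry map_mxD !map_mxZ mulmxDr mulmxDl -!scalemxAr -!scalemxAl.
move: (U *m toC S *m U ^t*) (U *m toC T *m U ^t*) => A B.
by rewrite !mxE; case: (A i i) (B i i) => [x y] [z t] /=; ring.
Qed.

Lemma sumr_norm_unitary {N : nat} (U : 'M[C]_N) (i : 'I_N) : U \is unitarymx ->
  \sum_j `|U i j| ^+ 2 = 1.
Proof.
move=> /unitarymxP/matrixP/(_ i i); rewrite !mxE eqxx /= => E1.
by rewrite -[RHS]E1; apply: eq_bigr => j _; rewrite !mxE normCK.
Qed.

(** Unitary conjugation preserves the Frobenius norm, of which the diagonal carries only a part. *)
Lemma sum_diag_entry_sqr {N : nat} (U : 'M[C]_N) (T : 'M[R]_N) : U \is unitarymx ->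
  \sum_i diag_entry U T i ^+ 2 <= \sum_i \sum_j T i j ^+ 2.
Proof.
move=> uU; have /unitarymxP U1 := uU; have U2 := mulmx1C U1.
rewrite -lecR !rmorph_sum /=.
set B := U *m toC T *m U ^t*.
have BB : \sum_i \sum_j `|B i j| ^+ 2 = \tr (B *m B ^t*).
  rewrite /mxtrace; apply: eq_bigr => i _; rewrite mxE; apply: eq_bigr => j _.
  by rewrite !mxE normCK.
have TT : \sum_i \sum_j real_complex R (T i j ^+ 2) = \tr (toC T *m (toC T) ^t*).
  rewrite /mxtrace; apply: eq_bigr => i _; rewrite mxE; apply: eq_bigr => j _.
  by rewrite !mxE conj_real_complex rmorphXn.
have E : \tr (B *m B ^t*) = \tr (toC T *m (toC T) ^t*).
  rewrite /B !trmx_mul !map_mxM /= -map_trmx trmxK -map_mx_comp (map_mx_id (@conjCK _)).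
  rewrite !map_trmx !mulmxA -(mulmxA (U *m toC T)) U2 mulmx1.
  by rewrite mxtrace_mulC !mulmxA U2 mul1mx.
rewrite (eq_bigr _ (fun i _ => rmorph_sum _ _ _ _)) /= TT -E -BB; apply: ler_sum => i _.
rewrite (bigD1 i) //= -[leLHS]addr0; apply: lerD; last first.
  by apply: sumr_ge0 => j _; rewrite exprn_ge0.
rewrite rmorphXn /= -[leLHS]real_normK; last by apply/complex_realP; eexists.
apply: lerXn2r; rewrite ?nnegrE //; apply: le_trans (normc_ge_Re _).
by rewrite normc_def /= expr0n addr0 sqrtr_sqr.
Qed.

Lemma unitary_diag_entry {N : nat} (Q : 'M[C]_N) (c : 'rV[C]_N) (i : 'I_N) :
  (Q *m diag_mx c *m Q ^t*) i i = \sum_j `|Q i j| ^+ 2 * c 0 j.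
Proof.
rewrite mxE; apply: eq_bigr => j _.
by rewrite mul_mx_diag !mxE normCK mulrAC.
Qed.

(** Peierls' inequality. The weights [|Q i j| ^ 2] between [U] and an eigenframe are doubly
    stochastic: row sums equal to one allow Jensen's inequality, column sums equal to one give back
    the full trace. With equality in the eigenframe, the trace of [f] is a maximum over frames of
    convex functions of [T]. *)
Lemma sum_convex_diag_entry {N : nat} (f : R -> R) (U : 'M[C]_N) (T : 'M[R]_N) :
  (forall x y t : R, 0 <= t <= 1 ->
     f (t * x + (1 - t) * y) <= t * f x + (1 - t) * f y) ->
  U \is unitarymx -> T \is symmetricmx ->
  \sum_i f (diag_entry U T i) <= \sum_(l <- eigenvalues T) f l.
Proof.
move=> cf uU sT; rewrite (perm_big _ (eigenvalues_spectrum sT)) big_map big_enum /=.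
pose V := frame T; have uV : V \is unitarymx by exact: frame_unitary.
have [Q QE] : exists Q, Q = U *m V ^t* by eexists.
have uVt : V ^t* \is unitarymx by rewrite trmxC_unitary.
have uQ : Q \is unitarymx by rewrite QE; exact: (mul_unitarymx uU uVt).
pose W i j := complex.Re (`|Q i j| ^+ 2).
have WE i j : real_complex R (W i j) = `|Q i j| ^+ 2.
  by rewrite RRe_real //; apply: ger0_real; rewrite exprn_ge0 // normr_ge0.
have W0 i j : 0 <= W i j by rewrite -ler0c WE exprn_ge0.
have Wr i : \sum_j W i j = 1.
  apply: (@complexI R); rewrite rmorph_sum /= -[RHS](sumr_norm_unitary i uQ).
  by apply: eq_bigr => j _; rewrite WE.
have Wc j : \sum_i W i j = 1.
  have uQt : Q ^T \is unitarymx by rewrite trmx_unitary.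
  apply: (@complexI R); rewrite rmorph_sum /= -[RHS](sumr_norm_unitary j uQt).
  by apply: eq_bigr => i _; rewrite WE mxE.
have dE i : diag_entry U T i = \sum_j W i j * spectrum_of T j.
  apply: (@complexI R); rewrite rmorph_sum /= /diag_entry.
  have -> : U *m toC T *m U ^t* =
      Q *m diag_mx (\row_i real_complex R (spectrum_of T i)) *m Q ^t*.
    rewrite {1}(symC_spectral sT) QE trmx_mul map_mxM -map_trmx trmxK.
    by rewrite -map_mx_comp (map_mx_id (@conjCK _)) !mulmxA.
  rewrite unitary_diag_entry.
  rewrite (eq_bigr (fun j => real_complex R (W i j * spectrum_of T j))).
    by rewrite -rmorph_sum.
  move=> j _; by rewrite mxE rmorphM /= WE.
have jensen i : f (diag_entry U T i) <= \sum_j W i j * f (spectrum_of T j).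
  rewrite dE; exact: jensen_sum.
apply: (le_trans (ler_sum _ (fun i _ => jensen i))).
by rewrite exchange_big /=; under eq_bigr do rewrite -mulr_suml Wc mul1r.
Qed.
End Spectral.

(** * Traces of convex functions of a symmetric matrix *)

Section TraceFunctional.
Context {R : realType}.

Definition trace_fun {N : nat} (f : R -> R) (T : 'M[R]_N) : R :=
  \sum_(l <- eigenvalues T) f l.

Definition convex_fun (f : R -> R) : Prop := forall x y t : R, 0 <= t <= 1 ->
  f (t * x + (1 - t) * y) <= t * f x + (1 - t) * f y.

Definition lipschitz_fun (L : R) (f : R -> R) : Prop :=
  forall x y : R, `|f x - f y| <= L * `|x - y|.

(** Cauchy-Schwarz, by expanding the nonnegative double sum of [(|x i| - |x j|) ^ 2]. *)
Lemma sum_le_sqrt {I : finType} (x : I -> R) :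
  \sum_i `|x i| <= Num.sqrt #|I|%:R * Num.sqrt (\sum_i x i ^+ 2).
Proof.
rewrite -sqrtrM ?ler0n // -[leLHS]ger0_norm ?sumr_ge0 // -sqrtr_sqr ler_wsqrtr //.
have key : 0 <= \sum_i \sum_j (`|x i| - `|x j|) ^+ 2.
  by apply: sumr_ge0 => i _; apply: sumr_ge0 => j _; rewrite sqr_ge0.
have E : \sum_i \sum_j (`|x i| - `|x j|) ^+ 2
    = 2 * (#|I|%:R * \sum_i x i ^+ 2 - (\sum_i `|x i|) ^+ 2).
  have -> : \sum_i \sum_j (`|x i| - `|x j|) ^+ 2
    = \sum_i (#|I|%:R * x i ^+ 2 + \sum_j x j ^+ 2 - 2 * (`|x i| * \sum_j `|x j|)).
    apply: eq_bigr => i _; rewrite !mulr_sumr mulr_natl -sumr_const -big_split -sumrB /=.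
    by apply: eq_bigr => j _; rewrite sqrrB !real_normK ?num_real // mulr_natl addrAC.
  rewrite sumrB big_split /= sumr_const -mulr_sumr -mulr_natl -mulr_sumr -mulr_suml.
  by ring.
by move: key; rewrite E pmulr_rge0 // subr_ge0.
Qed.

(** Symmetry makes each off-diagonal entry occur twice, whence the factor 2. *)
Lemma Frobenius_le_Ftilde {N : nat} (D : 'M[R]_N) : D^T = D ->
  \sum_i \sum_j D i j ^+ 2 <= 2 * Ftilde_norm D ^+ 2.
Proof.
move=> DT; rewrite /Ftilde_norm sqr_sqrtr; last first.
  by rewrite sumr_ge0 // => i _; rewrite sumr_ge0 // => j _; rewrite sqr_ge0.
have -> : \sum_i \sum_j D i j ^+ 2 = \sum_(i < N) \sum_(j < N | (i <= j)%N) D i j ^+ 2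
    + \sum_(i < N) \sum_(j < N | (j < i)%N) D i j ^+ 2.
  rewrite -big_split; apply: eq_bigr => i _ /=.
  by rewrite (bigID (fun j : 'I_N => (i <= j)%N)) /=; under [in X in _ + X]eq_bigl do rewrite -ltnNge.
rewrite mulr2n mulrDl mul1r lerD2l.
under eq_bigr do rewrite big_mkcond.
rewrite exchange_big /=; apply: ler_sum => i _; rewrite [leRHS]big_mkcond /=.
apply: ler_sum => j _; case: ltnP => [ij|]; last by case: ifP => // _ _; rewrite sqr_ge0.
by rewrite ltnW // -{1}DT mxE.
Qed.

Lemma symmetricB {N : nat} (S T : 'M[R]_N) : S \is symmetricmx -> T \is symmetricmx ->
  (S - T)^T = S - T.
Proof.
move=> /is_hermitianmxP; rewrite expr0 scale1r map_mx_id // => SS.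
move=> /is_hermitianmxP; rewrite expr0 scale1r map_mx_id // => TT.
by rewrite linearB /= -SS -TT.
Qed.

Lemma symmetric_comb {N : nat} (a b : R) (S T : 'M[R]_N) :
  S \is symmetricmx -> T \is symmetricmx -> a *: S + b *: T \is symmetricmx.
Proof.
move=> /is_hermitianmxP; rewrite expr0 scale1r map_mx_id // => SS.
move=> /is_hermitianmxP; rewrite expr0 scale1r map_mx_id // => TT.
apply/is_hermitianmxP; rewrite expr0 scale1r map_mx_id // linearD !linearZ /=.
by rewrite -SS -TT.
Qed.

Lemma trace_fun_frame {N : nat} (f : R -> R) (T : 'M[R]_N) : T \is symmetricmx ->
  trace_fun f T = \sum_i f (diag_entry (frame T) T i).
Proof.
move=> sT; rewrite /trace_fun (perm_big _ (eigenvalues_spectrum sT)) big_map big_enum /=.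
by apply: eq_bigr => i _; rewrite diag_entry_frame.
Qed.

(** In the eigenframe of the combination its trace is exact and the diagonal entries are linear in
    the matrix; Peierls' inequality then bounds the sums for [S] and [T] in this foreign frame. *)
Lemma trace_fun_convex {N : nat} (f : R -> R) (S T : 'M[R]_N) (t : R) :
  convex_fun f -> S \is symmetricmx -> T \is symmetricmx -> 0 <= t <= 1 ->
  trace_fun f (t *: S + (1 - t) *: T) <= t * trace_fun f S + (1 - t) * trace_fun f T.
Proof.
move=> cf sS sT t01; have sR := symmetric_comb t (1 - t) sS sT.
rewrite trace_fun_frame //; set U := frame _.
have uU : U \is unitarymx by exact: frame_unitary.
have /andP[t0 t1] := t01.
apply: (@le_trans _ _ (t * (\sum_i f (diag_entry U S i))
    + (1 - t) * (\sum_i f (diag_entry U T i)))).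
  rewrite !mulr_sumr -big_split; apply: ler_sum => i _ /=.
  by rewrite diag_entry_comb; exact: cf.
by rewrite lerD // ler_wpM2l ?subr_ge0 // sum_convex_diag_entry.
Qed.

(** Both traces are compared in the eigenframe of one matrix, which is exact for it and a lower
    bound for the other. [sqrt N] comes from Cauchy-Schwarz along the diagonal, [sqrt 2] from the
    passage to the Frobenius norm. *)
Lemma trace_fun_lipschitz {N : nat} (f : R -> R) (L : R) (S T : 'M[R]_N) :
  convex_fun f -> lipschitz_fun L f -> 0 <= L ->
  S \is symmetricmx -> T \is symmetricmx ->
  `|trace_fun f S - trace_fun f T| <= L * Num.sqrt (2 * N%:R) * Ftilde_norm (S - T).
Proof.
move=> cf lf L0; suff half (A B : 'M[R]_N) : A \is symmetricmx -> B \is symmetricmx ->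
    trace_fun f A - trace_fun f B <= L * Num.sqrt (2 * N%:R) * Ftilde_norm (A - B).
  move=> sS sT; rewrite ler_norml half // andbT lerNl opprB.
  have -> : Ftilde_norm (S - T) = Ftilde_norm (T - S).
    rewrite /Ftilde_norm; congr Num.sqrt; apply: eq_bigr => i _.
    by apply: eq_bigr => j _; rewrite !mxE -sqrrN opprB.
  exact: half.
move=> sA sB; rewrite (trace_fun_frame _ sA); set U := frame A.
have uU : U \is unitarymx by exact: frame_unitary.
have DE i : diag_entry U A i = diag_entry U B i + diag_entry U (A - B) i.
  have -> : A = 1 *: B + 1 *: (A - B) by rewrite !scale1r addrC subrK.
  by rewrite diag_entry_comb !mul1r !scale1r addrAC subrr add0r.
have le1 : \sum_i f (diag_entry U A i) <= \sum_i f (diag_entry U B i)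
    + L * \sum_i `|diag_entry U (A - B) i|.
  rewrite mulr_sumr -big_split; apply: ler_sum => i _ /=.
  rewrite -lerBlDl; apply: (le_trans (ler_norm _)); apply: (le_trans (lf _ _)).
  by rewrite DE addrAC subrr add0r.
rewrite lerBlDr; apply: (le_trans le1); rewrite addrC lerD ?sum_convex_diag_entry //.
rewrite -mulrA ler_wpM2l //; apply: (le_trans (sum_le_sqrt _)).
rewrite card_ord mulrC [2 * _]mulrC sqrtrM ?ler0n // -mulrA [leLHS]mulrC.
rewrite ler_wpM2l ?sqrtr_ge0 //.
have F0 : 0 <= Ftilde_norm (A - B) by exact: sqrtr_ge0.
rewrite -[X in _ * X](ger0_norm F0) -sqrtr_sqr -sqrtrM ?ler0n // ler_wsqrtr //.
apply: (le_trans (sum_diag_entry_sqr _ uU)).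
exact/Frobenius_le_Ftilde/symmetricB.
Qed.
End TraceFunctional.

(** * Talagrand's convex distance inequality *)

Section ConvexDistance.
Context {R : realType}.

Lemma ler_mul_inf (S : set R) (y t : R) : S !=set0 -> 0 <= t ->
  (forall a, S a -> y <= t * a) -> y <= t * inf S.
Proof.
move=> S0; rewrite le_eqVlt => /orP[/eqP<- h|t0 h].
  by case: S0 => a Sa; move: (h _ Sa); rewrite !mul0r.
rewrite mulrC -ler_pdivrMr //; apply: lb_le_inf => // a Sa.
by rewrite ler_pdivrMr // mulrC; exact: h.
Qed.

Lemma expR_le_inv (y : R) : y < 1 -> expR y <= (1 - y)^-1.
Proof.
move=> y1; have := expR_ge1Dx (- y); rewrite expRN => h.
by rewrite -[leLHS]invrK lef_pV2 ?posrE ?invr_gt0 ?expR_gt0 ?subr_gt0.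
Qed.

(* The exponent is minimised at [s = 4 L], cut off at [s = 1]. *)
Lemma talagrand_optimization (L : R) : 0 <= L ->
  exists2 s : R, 0 <= s <= 1 & expR ((1 - s) * L + s ^+ 2 / 8) <= 2 - expR (- L).
Proof.
move=> L0; have [L1|L1] := lerP 1 (4 * L).
  exists 1; first by rewrite ler01 lexx.
  rewrite subrr mul0r add0r expr1n.
  have h1 : expR (1 / 8 : R) <= 8 / 7.
    have -> : 8 / 7 = (1 - 1 / 8)^-1 :> R by field.
    by apply: expR_le_inv; lra.
  have h2 : expR (- L) <= 4 / 5.
    have := @expR_le_inv (- L); rewrite opprK => /(_ _)/le_trans; apply; first lra.
    by rewrite -div1r ler_pdivrMr; lra.
  lra.
exists (4 * L); first by apply/andP; split; lra.
have -> : (1 - 4 * L) * L + (4 * L) ^+ 2 / 8 = L - 2 * L ^+ 2 by field.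
have h2 : expR (- L) <= (1 + L)^-1.
  by have := @expR_le_inv (- L); rewrite opprK; apply; lra.
have L2 : 0 <= L ^+ 2 by exact: sqr_ge0.
have L3 : 0 <= L ^+ 3 by exact: exprn_ge0.
apply: le_trans (expR_le_inv _) _; first by nra.
apply: le_trans (lerB (lexx _) h2).
have -> : 2 - (1 + L)^-1 = (1 + 2 * L) / (1 + L) by field; lra.
rewrite ler_pdivlMr; last lra.
by rewrite mulrC ler_pdivrMr; nra.
Qed.

(* Points of [R^n] are sequences of which only the first [n] entries matter, so
   that the induction on [n] needs no casts between dimensions. *)
Definition convex_in_coords (C : set (nat -> R)) : Prop := forall x y (t : R),
  0 <= t <= 1 -> C x -> C y -> C (fun i => t * x i + (1 - t) * y i).

Definition set_coord (n : nat) (a : R) (x : nat -> R) : nat -> R :=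
  fun i => if i == n then a else x i.

(** The infimum over an empty set is 0 by default, not infinity; hence the nonemptiness hypotheses
    of the bounds below. *)
Definition sq_dist (n : nat) (C : set (nat -> R)) (x : nat -> R) : R :=
  inf [set \sum_(i < n) (x i - c i) ^+ 2 | c in C].

Lemma sq_dist_le n C (x c : nat -> R) : C c -> sq_dist n C x <= \sum_(i < n) (x i - c i) ^+ 2.
Proof.
move=> Cc; apply: ge_inf; last by exists c.
by exists 0 => _ [y _ <-]; apply: sumr_ge0 => i _; rewrite sqr_ge0.
Qed.

Lemma sum_set_coord n a (x z : nat -> R) : \sum_(i < n.+1) (set_coord n a x i - z i) ^+ 2
  = \sum_(i < n) (x i - z i) ^+ 2 + (a - z n) ^+ 2.
Proof.
rewrite big_ord_recr /= /set_coord eqxx; congr (_ + _); apply: eq_bigr => i _.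
by rewrite ltn_eqF.
Qed.

Definition slice n (a : R) (C : set (nat -> R)) : set (nat -> R) :=
  [set x | C (set_coord n a x)].

Definition shadow n (C : set (nat -> R)) : set (nat -> R) :=
  [set x | exists a, C (set_coord n a x)].

Lemma convex_slice n a C : convex_in_coords C -> convex_in_coords (slice n a C).
Proof.
move=> cC x y t t01 /= Cx Cy; rewrite /slice /=.
have := cC _ _ t t01 Cx Cy; congr (C _); apply/funext => i; rewrite /set_coord.
by case: eqP => // _; ring.
Qed.

Lemma convex_shadow n C : convex_in_coords C -> convex_in_coords (shadow n C).
Proof.
move=> cC x y t t01 /= [a Cx] [b Cy]; exists (t * a + (1 - t) * b).
have := cC _ _ t t01 Cx Cy; congr (C _); apply/funext => i; rewrite /set_coord.
by case: eqP.
Qed.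

Definition within_box n (a b : R) (C : set (nat -> R)) : Prop :=
  forall c, C c -> forall i, (i < n)%N -> a <= c i <= b.

Lemma box_slice n v a b C : within_box n.+1 a b C -> within_box n a b (slice n v C).
Proof.
move=> bC c /bC h i ni; have := h i (ltnW ni).
by rewrite /set_coord (ltn_eqF ni).
Qed.

Lemma box_shadow n a b C : within_box n.+1 a b C -> within_box n a b (shadow n C).
Proof.
move=> bC c [v /bC h] i ni; have := h i (ltnW ni).
by rewrite /set_coord (ltn_eqF ni).
Qed.

(** A point of the shadow lifts to [C], and within the box the last coordinate adds at most
    [(b - a) ^ 2]. *)
Lemma sq_dist_shadow n a b C v x : a <= v <= b -> within_box n.+1 a b C ->
  shadow n C !=set0 ->
  sq_dist n.+1 C (set_coord n v x) <= sq_dist n (shadow n C) x + (b - a) ^+ 2.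
Proof.
move=> vab bC [w0 sw0]; rewrite -lerBlDr -[leRHS]mul1r.
apply: ler_mul_inf => //; first by eexists; exists w0.
move=> _ [w [u Cu] <-]; rewrite mul1r lerBlDr.
apply: le_trans (sq_dist_le _ _ Cu) _; rewrite sum_set_coord lerD //.
  apply: ler_sum => i _; rewrite /set_coord ltn_eqF //.
have := bC _ Cu n (ltnSn n); rewrite /set_coord eqxx.
move: vab; nra.
Qed.

(** A point of the slice is averaged with a lifted point of the shadow, and convexity keeps the
    average in [C]. Its last coordinate misses [v] by [1 - t] times a distance within the box; that
    this enters squared is what the induction exploits. *)
Lemma sq_dist_slice_shadow n a b C v x t : a <= v <= b -> within_box n.+1 a b C ->
  convex_in_coords C -> slice n v C !=set0 -> 0 <= t <= 1 ->
  sq_dist n.+1 C (set_coord n v x) <= t * sq_dist n (slice n v C) x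
    + (1 - t) * sq_dist n (shadow n C) x + (1 - t) ^+ 2 * (b - a) ^+ 2.
Proof.
move=> vab bC cC [w0 sw0] t01; have /andP[t0 t1] := t01.
rewrite -lerBlDr -lerBlDr; apply: ler_mul_inf => //; first by eexists; exists w0.
move=> _ [u Cu <-]; rewrite lerBlDr -lerBlDl.
apply: ler_mul_inf; rewrite ?subr_ge0 //; first by eexists; exists w0 => //; exists v.
move=> _ [w [s Cw] <-].
pose z i := t * set_coord n v u i + (1 - t) * set_coord n s w i.
have Cz : C z by exact: cC _ _ t t01 Cu Cw.
rewrite !lerBlDr; apply: le_trans (sq_dist_le _ _ Cz) _; rewrite sum_set_coord.
rewrite lerD //.
  rewrite addrC !mulr_sumr -big_split; apply: ler_sum => i _ /=.
  rewrite /z /set_coord ltn_eqF //; set A := x i - u i; set B := x i - w i.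
  have -> : x i - (t * u i + (1 - t) * w i) = t * A + (1 - t) * B.
    by rewrite /A /B; ring.
  have : 0 <= t * (1 - t) * (A - B) ^+ 2.
    by apply: mulr_ge0; [apply: mulr_ge0 => //; rewrite subr_ge0|exact: sqr_ge0].
  by nra.
rewrite /z /set_coord eqxx.
have -> : v - (t * v + (1 - t) * s) = (1 - t) * (v - s) by ring.
rewrite exprMn ler_wpM2l ?sqr_ge0 //.
have := bC _ Cw n (ltnSn n); rewrite /set_coord eqxx.
by move: vab; nra.
Qed.
End ConvexDistance.

(** * Product laws on a finite grid *)

Section GridExpectation.
Context {R : realType} {I : finType} (v : I -> R) (p : nat -> I -> R).

(** Expectation under the product law in which coordinate [i] takes the value [v k] with weight
    [p i k]; coordinates from [n] on are 0. The last coordinate is summed outermost, so that fixing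
    it leaves an expectation of the same kind. *)
Fixpoint grid_expect (n : nat) (phi : (nat -> R) -> R) : R :=
  if n is n'.+1 then
    \sum_k p n' k * grid_expect n' (fun x => phi (set_coord n' (v k) x))
  else phi (fun=> 0).

Hypothesis p0 : forall i k, 0 <= p i k.

Lemma grid_expect_mono n phi psi : (forall x, phi x <= psi x) ->
  grid_expect n phi <= grid_expect n psi.
Proof.
elim: n phi psi => [|n IH] phi psi h //=; apply: ler_sum => k _.
by rewrite ler_wpM2l // IH.
Qed.

Lemma grid_expect_comb n a b phi psi :
  grid_expect n (fun x => a * phi x + b * psi x)
    = a * grid_expect n phi + b * grid_expect n psi.
Proof.
elim: n phi psi => [|n IH] phi psi //=; rewrite !mulr_sumr -big_split.
by apply: eq_bigr => k _ /=; rewrite IH; ring.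
Qed.

Lemma grid_expect_ge0 n phi : (forall x, 0 <= phi x) -> 0 <= grid_expect n phi.
Proof.
elim: n phi => [|n IH] phi h //=; apply: sumr_ge0 => k _.
by rewrite mulr_ge0 // IH.
Qed.

Definition grid_prob n (C : set (nat -> R)) : R := grid_expect n (fun x => \1_C x).

Lemma grid_prob_mono n A B : A `<=` B -> grid_prob n A <= grid_prob n B.
Proof.
move=> AB; apply: grid_expect_mono => x; rewrite !indicE.
case: (boolP (x \in A)) => [/set_mem/AB/mem_set -> //|_]; by rewrite ler0n.
Qed.

Lemma grid_prob_ge0 n A : 0 <= grid_prob n A.
Proof. by apply: grid_expect_ge0 => x; rewrite indicE ler0n. Qed.

Lemma grid_prob_set0 n : grid_prob n set0 = 0.
Proof.
rewrite /grid_prob.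
have -> : (fun x : nat -> R => \1_set0 x : R) = (fun x => 0 * 0 + 0 * 0).
  by apply/funext => x; rewrite indicE in_set0 /=; ring.
by rewrite grid_expect_comb !mul0r addr0.
Qed.

Lemma grid_probS n C :
  grid_prob n.+1 C = \sum_k p n k * grid_prob n (slice n (v k) C).
Proof. by []. Qed.

(** Hoelder's inequality with exponents [1 / t] and [1 / (1 - t)], from the convexity of the
    exponential once both factors are normalised by [q1] and [q2]. *)
Lemma grid_expect_expR n (phi psi : (nat -> R) -> R) (t q1 q2 : R) :
  0 <= t <= 1 -> 0 < q1 -> 0 < q2 ->
  q1 * grid_expect n (fun x => expR (phi x)) <= 1 ->
  q2 * grid_expect n (fun x => expR (psi x)) <= 1 ->
  grid_expect n (fun x => expR (t * phi x + (1 - t) * psi x))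
    <= expR (- (t * ln q1 + (1 - t) * ln q2)).
Proof.
move=> t01 q10 q20 h1 h2; have /andP[t0 t1] := t01.
set c := expR _.
apply: (@le_trans _ _ (grid_expect n (fun x =>
    c * t * q1 * expR (phi x) + c * (1 - t) * q2 * expR (psi x)))).
  apply: grid_expect_mono => x.
  have -> : t * phi x + (1 - t) * psi x = - (t * ln q1 + (1 - t) * ln q2)
     + (t * (phi x + ln q1) + (1 - t) * (psi x + ln q2)) by ring.
  rewrite expRD -/c -!mulrA -mulrDr ler_wpM2l ?expR_ge0 //.
  have tI : 0 <= t <= 1 by [].
  have := convex_expR (Itv01 t0 t1) (phi x + ln q1) (psi x + ln q2).
  rewrite !convRE /= => /le_trans; apply.
  rewrite (_ : unstable.onem t = 1 - t) // !expRD !lnK ?posrE //.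
  by rewrite [_ * q1]mulrC [_ * q2]mulrC.
rewrite grid_expect_comb.
have -> : c * t * q1 * grid_expect n (fun x : nat -> R => expR (phi x)) +
   c * (1 - t) * q2 * grid_expect n (fun x : nat -> R => expR (psi x)) =
  c * (t * (q1 * grid_expect n (fun x : nat -> R => expR (phi x))) +
   (1 - t) * (q2 * grid_expect n (fun x : nat -> R => expR (psi x)))) by ring.
rewrite -[leRHS]mulr1 ler_wpM2l ?expR_ge0 //.
by nra.
Qed.

(** Induction on the dimension, conditioning on the last coordinate. The constant 8, twice the
    classical one, is that of [talagrand_optimization]. *)
Lemma talagrand_convex n (a b : R) C : a < b ->
  (forall k, a <= v k <= b) -> (forall i, (i < n)%N -> \sum_k p i k = 1) ->
  convex_in_coords C -> within_box n a b C ->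
  grid_prob n C
    * grid_expect n (fun x => expR (sq_dist n C x / (8 * (b - a) ^+ 2))) <= 1.
Proof.
move=> ab vab; set D := (b - a) ^+ 2.
have D0 : 0 < D by rewrite exprn_gt0 // subr_gt0.
have D8 : 0 < 8 * D by rewrite pmulr_rgt0.
elim: n C => [|n IH] C p1 cC bC.
  rewrite /grid_prob /= /sq_dist indicE; case: (boolP (_ \in C)) => [/set_mem C0|_].
    rewrite mul1r (_ : [set _ | _ in _] = [set 0]) ?inf1 ?mul0r ?expR0 //.
    apply/seteqP; split => [_ [c _ <-]|_ ->] /=; first by rewrite big_ord0.
    by exists (fun=> 0) => //; rewrite big_ord0.
  by rewrite mul0r ler01.
have p1n i : (i < n)%N -> \sum_k p i k = 1 by move=> ni; apply: p1; exact: leqW.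
set E := grid_expect n.+1 _.
set Q := grid_prob n (shadow n C).
pose q k := grid_prob n (slice n (v k) C).
have qQ k : q k <= Q.
  by apply: grid_prob_mono => x Cx; exists (v k).
have q0 k : 0 <= q k by exact: grid_prob_ge0.
have PE : grid_prob n.+1 C = \sum_k p n k * q k by exact: grid_probS.
have [Q0|Qn0] := lerP Q 0.
  rewrite PE big1 ?mul0r ?ler01 // => k _.
  by have -> : q k = 0; [apply/eqP; rewrite eq_le q0 (le_trans (qQ k) Q0)|rewrite mulr0].
have shn : shadow n C !=set0.
  apply/set0P/negP => /eqP s0; by move: Qn0; rewrite /Q s0 grid_prob_set0 ltxx.
have IHs := IH _ p1n (convex_shadow cC) (box_shadow bC).
(* [q k / Q] is the ratio of the slice to the shadow; interpolating between the
   two induction hypotheses with the optimal weight bounds the [k]th section. *)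
pose Ek k := grid_expect n
  (fun x => expR (sq_dist n.+1 C (set_coord n (v k) x) / (8 * D))).
have EkE k : Ek k <= (2 - q k / Q) / Q.
  (* A null slice may be empty, so only the shadow serves here, at the price of one squared width,
     that is of a factor [expR (1 / 8) <= 2]. *)
  have [qk0|qkp] := eqVneq (q k) 0.
    rewrite qk0 mul0r subr0.
    apply: (@le_trans _ _ (grid_expect n (fun x => expR (1 / 8)
       * expR (sq_dist n (shadow n C) x / (8 * D)) + 0 * 0))).
      apply: grid_expect_mono => x; rewrite mul0r addr0 -expRD ler_expR.
      rewrite ler_pdivrMr // mulrDl divfK ?(gt_eqF D8) //.
      rewrite addrC; have -> : 1 / 8 * (8 * D) = D by field.
      exact: (sq_dist_shadow x (vab k) bC shn).
    rewrite grid_expect_comb mul0r addr0 ler_pdivlMr // -mulrA.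
    have e8 : expR (1 / 8 : R) <= 2.
      apply: le_trans (expR_le_inv _) _; first lra.
      by rewrite -div1r ler_pdivrMr; lra.
    rewrite -[leRHS]mulr1 ler_pM ?expR_ge0 //; last by rewrite mulrC.
    by rewrite mulr_ge0 ?(ltW Qn0) // grid_expect_ge0 // => x; exact: expR_ge0.
  have {}qkp : 0 < q k by rewrite lt_def qkp q0.
  have sln : slice n (v k) C !=set0.
    apply/set0P/negP => /eqP s0; by move: qkp; rewrite /q s0 grid_prob_set0 ltxx.
  have IHk := IH _ p1n (@convex_slice _ n (v k) _ cC) (box_slice bC).
  pose L := ln Q - ln (q k).
  have L0 : 0 <= L by rewrite subr_ge0 ler_ln ?posrE.
  have [s /andP[s0 s1] hs] := talagrand_optimization L0.
  have t01 : 0 <= 1 - s <= 1 by apply/andP; split; lra.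
  have rE : expR (- L) = q k / Q.
    by rewrite opprB expRD expRN !lnK ?posrE.
  rewrite rE in hs; rewrite ler_pdivlMr //.
  apply: le_trans hs.
  apply: (@le_trans _ _ (grid_expect n (fun x => expR (s ^+ 2 / 8)
     * expR ((1 - s) * (sq_dist n (slice n (v k) C) x / (8 * D))
        + (1 - (1 - s)) * (sq_dist n (shadow n C) x / (8 * D))) + 0 * 0) * Q)).
    rewrite ler_wpM2r ?(ltW Qn0) //; apply: grid_expect_mono => x.
    rewrite mul0r addr0 -expRD ler_expR ler_pdivrMr //.
    apply: le_trans (sq_dist_slice_shadow x (vab k) bC cC sln t01) _.
    rewrite le_eqVlt; apply/orP; left; apply/eqP; rewrite -/D; field.
    by rewrite gt_eqF.
  rewrite grid_expect_comb mul0r addr0.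
  rewrite [(1 - s) * L + _]addrC [leRHS]expRD -mulrA ler_wpM2l ?expR_ge0 //.
  apply: le_trans (ler_wpM2r (ltW Qn0) (grid_expect_expR t01 qkp Qn0 IHk IHs)) _.
  rewrite -{2}(@lnK _ Q) ?posrE // -expRD ler_expR /L; lra.
set P := grid_prob n.+1 C.
have Pn0 : 0 <= P by exact: grid_prob_ge0.
have EE : E <= (2 - P / Q) / Q.
  apply: (@le_trans _ _ (\sum_k p n k * ((2 - q k / Q) / Q))).
    by apply: ler_sum => k _; rewrite ler_wpM2l //; exact: EkE.
  rewrite le_eqVlt; apply/orP; left; apply/eqP.
  rewrite /P PE.
  have -> : \sum_k p n k * ((2 - q k / Q) / Q)
     = \sum_k (2 / Q * p n k - Q^-1 ^+ 2 * (p n k * q k)).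
    by apply: eq_bigr => k _; field; rewrite gt_eqF.
  by rewrite sumrB -!mulr_sumr p1 //; field; rewrite gt_eqF.
apply: le_trans (ler_wpM2l Pn0 EE) _.
(* The induction closes by [x (2 - x) <= 1] at [x = P / Q]. *)
have -> : P * ((2 - P / Q) / Q) = 1 - (P / Q - 1) ^+ 2 by field; rewrite gt_eqF.
by rewrite lerBlDr lerDl sqr_ge0.
Qed.

End GridExpectation.

(** * Measurability of Lipschitz functions of a random vector *)

Section LipschitzMeasurable.
Context {R : realType}.

Lemma l2norm_le_sum (m : nat) (x : 'rV[R]_m) : l2norm x <= \sum_i `|x 0 i|.
Proof.
rewrite /l2norm -[leRHS]ger0_norm ?sumr_ge0 // -sqrtr_sqr ler_wsqrtr //.
suff : forall s : seq 'I_m, \sum_(i <- s) x 0 i ^+ 2 <= (\sum_(i <- s) `|x 0 i|) ^+ 2.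
  exact.
elim=> [|i s IH]; first by rewrite !big_nil expr0n.
rewrite !big_cons sqrrD real_normK ?num_real // lerD // lerDl.
by rewrite mulrn_wge0 // mulr_ge0 // sumr_ge0.
Qed.

Lemma cvg_of_dist_le (u : nat -> R) (l C : R) :
  (forall k, `|u k - l| <= C / k.+1%:R) -> u @ \oo --> l.
Proof.
move=> h; apply/cvgrPdist_le => e e0.
have : (fun k => C * @harmonic R k) @ \oo --> C * 0.
  by apply: cvgM; [exact: cvg_cst|exact: cvg_harmonic].
rewrite mulr0 => /cvgrPdist_le/(_ _ e0); apply: filterS => k /=.
rewrite sub0r normrN => he; rewrite distrC; apply: le_trans (h k) _.
exact: le_trans (ler_norm _) he.
Qed.

(** Rounding the coordinates down to multiples of [1 / (k + 1)] leaves countably many values, each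
    taken on a finite intersection of preimages of intervals; the Lipschitz bound makes the rounded
    functions converge. *)
Lemma measurable_lipschitz_comp d (T : measurableType d) (m : nat)
    (X : 'I_m -> T -> R) (F : 'rV[R]_m -> R) (L : R) :
  (forall i, measurable_fun setT (X i)) ->
  (forall x y, `|F x - F y| <= L * l2norm (x - y)) -> 0 <= L ->
  measurable_fun setT (fun w => F (\row_i X i w)).
Proof.
move=> mX lF L0.
pose r k (x : R) : R := (Num.floor (x * k.+1%:R))%:~R / k.+1%:R.
have rE k x : `|r k x - x| <= k.+1%:R^-1.
  have k0 : 0 < k.+1%:R :> R by [].
  rewrite /r -[X in _ - X](mulfK (lt0r_neq0 k0)) -mulrBl normrM normfV (gtr0_norm k0).
  rewrite ler_pdivrMr // mulVf ?gt_eqF // distrC ger0_norm ?subr_ge0 ?ge_floor //.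
  by rewrite lerBlDl ltW // -[X in _ + X]/(1%:~R) -intrD floorD1_gt.
apply: (@measurable_fun_cvg _ _ _ _ (fun k w => F (\row_i r k (X i w)))); last first.
  move=> w _; apply: (@cvg_of_dist_le _ _ (L * m%:R)) => k.
  apply: le_trans (lF _ _) _; rewrite -mulrA ler_wpM2l //.
  apply: le_trans (l2norm_le_sum _) _.
  apply: (@le_trans _ _ (\sum_(i < m) k.+1%:R^-1)).
    by apply: ler_sum => i _; rewrite !mxE rE.
  by rewrite sumr_const card_ord mulr_natl.
move=> k _ A mA; rewrite setTI.
rewrite (_ : _ @^-1` A = \bigcup_(z : {ffun 'I_m -> int})
   [set w | A (F (\row_i ((z i)%:~R / k.+1%:R))) /\
     forall i, Num.floor (X i w * k.+1%:R) = z i]); last first.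
  apply/seteqP; split => [w /= Aw|w [z _ [Az /= zE]]].
    exists [ffun i => Num.floor (X i w * k.+1%:R)] => //=; split.
      by under eq_mx do rewrite ffunE.
    by move=> i; rewrite ffunE.
  by under eq_mx do rewrite /r zE.
apply: countable_bigcupT_measurable => //.
move=> z.
have [Az|nAz] := pselect (A (F (\row_i ((z i)%:~R / k.+1%:R)))); last first.
  rewrite (_ : [set _ | _] = set0); first exact: measurable0.
  by apply/seteqP; split => // w [].
rewrite (_ : [set _ | _] =
    \bigcap_(i in [set: 'I_m]) (X i @^-1` `[(z i)%:~R / k.+1%:R, (z i + 1)%:~R / k.+1%:R[)).
  apply: fin_bigcap_measurable => [|i _]; first exact: finite_finset.
  by rewrite -[X in measurable X]setTI; apply: mX => //; exact: measurable_itv.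
have E i w : (Num.floor (X i w * k.+1%:R) = z i) <->
    X i w \in `[(z i)%:~R / k.+1%:R, (z i + 1)%:~R / k.+1%:R[.
  rewrite in_itv /= ler_pdivrMr // ltr_pdivlMr //; split=> [<-|/floor_def //].
  by rewrite ge_floor // floorD1_gt.
apply/seteqP; split => [w [_ h] i _ /=|w h /=]; first exact/E.
by split => // i; apply/E/h.
Qed.
End LipschitzMeasurable.

(** * The law of rounded independent variables *)

Section GridProbability.
Context {R : realType} {I : finType} (v : I -> R).

(** The padding by 0 matches the base case of [grid_expect]. *)
Definition grid_point {n : nat} (f : 'I_n -> I) : nat -> R :=
  fun i => if insub i is Some j then v (f j) else 0.

(** The iterated sum unfolds along the bijection between functions on [n + 1] points and pairs of a
    last value and a function on the first [n] points. *)
Lemma grid_expect_sum (p : nat -> I -> R) n phi : grid_expect v p n phi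
  = \sum_(f : {ffun 'I_n -> I}) (\prod_(i < n) p i (f i)) * phi (grid_point f).
Proof.
elim: n phi => [|n IH] phi /=.
  have f0 : 'I_0 -> I by case.
  rewrite (bigD1 (finfun f0)) //= [X in _ + X]big1 ?addr0 => [|f]; last first.
    by rewrite (_ : f = finfun f0) ?eqxx //; apply/ffunP; case.
  rewrite big_ord0 mul1r; congr phi; apply/funext => i.
  by rewrite /grid_point; case: insubP => // -[].
under eq_bigr do rewrite IH mulr_sumr.
rewrite pair_big /=.
pose h (kg : I * {ffun 'I_n -> I}) : {ffun 'I_n.+1 -> I} :=
  [ffun i => if unlift ord_max i is Some j then kg.2 j else kg.1].
pose h' (f : {ffun 'I_n.+1 -> I}) : I * {ffun 'I_n -> I} :=
  (f ord_max, [ffun j => f (lift ord_max j)]).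
rewrite [RHS](reindex h); last first.
  exists h' => [[k g] _|f _]; rewrite /h /h' /=.
    rewrite ffunE unlift_none; congr pair; apply/ffunP => j.
    by rewrite !ffunE liftK.
  by apply/ffunP => i; rewrite ffunE; case: unliftP => [j ->|->] //=; rewrite ffunE.
apply: eq_bigr => -[k g] _ /=; rewrite big_ord_recr /= /h ffunE unlift_none /=.
rewrite mulrCA mulrA; congr (_ * _ * _).
  apply: eq_bigr => i _.
  have -> : widen_ord (leqnSn n) i = lift ord_max i.
    by apply/val_inj; rewrite /= /bump leqNgt ltn_ord.
  by rewrite ffunE liftK.
congr phi; apply/funext => i; rewrite /set_coord /grid_point.
case: eqP => [->|/eqP ni].
  case: insubP => [j _ jn|]; last by rewrite ltnSn.
  by rewrite ffunE (_ : j = ord_max) ?unlift_none //; exact/val_inj.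
case: (@insubP _ _ 'I_n i) => [j jn ji|nin].
  case: insubP => [l _ li|]; last by rewrite ltnS (ltnW jn).
  rewrite ffunE (_ : l = lift ord_max j) ?liftK //; apply/val_inj.
  by rewrite /= li /bump leqNgt ltn_ord.
by rewrite insubN // ltnS -ltnNge ltn_neqAle eq_sym ni leqNgt.
Qed.

Context {d} {Omega : measurableType d} {P : probability Omega R}.

(** Only finitely many grid points occur, so [S] may be arbitrary. *)
Lemma measurable_grid_event (m : nat) (X : 'I_m -> {RV P >-> R}) (z : R -> I)
    (S : set (nat -> R)) : (forall k, measurable (z @^-1` [set k])) ->
  measurable [set w | S (grid_point (fun j => z (X j w)))].
Proof.
move=> mz.
rewrite (_ : [set w | _] = \bigcup_(f in [set f : {ffun 'I_m -> I} | S (grid_point f)])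
    \bigcap_(i in [set: 'I_m]) (X i @^-1` (z @^-1` [set f i]))).
  apply: fin_bigcup_measurable => [|f _]; first exact: finite_finset.
  apply: fin_bigcap_measurable => [|i _]; first exact: finite_finset.
  by rewrite -[X in measurable X]setTI; apply: measurable_funP.
have ptE w (f : {ffun 'I_m -> I}) : (forall i, z (X i w) = f i) ->
    grid_point (fun j => z (X j w)) = grid_point f.
  by move=> h; apply/funext => i; rewrite /grid_point; case: insubP => // j _ _; rewrite h.
apply/seteqP; split => [w /= Sw|w [f /= Sf h]].
  have E w' : forall i, z (X i w') = [ffun j => z (X j w')] i by move=> i; rewrite ffunE.
  exists [ffun j => z (X j w)]; first by rewrite /= -(ptE _ _ (E w)).
  by move=> i _ /=; rewrite ffunE.
by rewrite (ptE _ f) // => i; exact: h.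
Qed.

Lemma grid_prob_event (m : nat) (X : 'I_m -> {RV P >-> R}) (z : R -> I)
    (S : set (nat -> R)) :
  mutually_independent X -> (forall k, measurable (z @^-1` [set k])) ->
  let p i k := if insub i is Some j then fine (P (X j @^-1` (z @^-1` [set k]))) else 0 in
  P [set w | S (grid_point (fun j => z (X j w)))] = (grid_prob v p m S)%:E.
Proof.
move=> iX mz p.
pose B (f : {ffun 'I_m -> I}) := \bigcap_(i in [set: 'I_m]) (X i @^-1` (z @^-1` [set f i])).
set A := [set w | _].
have mX i k : measurable (X i @^-1` (z @^-1` [set k])).
  by rewrite -[X in measurable X]setTI; apply: measurable_funP.
have mB f : measurable (B f).
  by apply: fin_bigcap_measurable => [|i _]; [exact: finite_finset|exact: mX].
have ptB f w : B f w -> grid_point (fun j => z (X j w)) = grid_point f.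
  by move=> Bw; apply/funext => i; rewrite /grid_point; case: insubP => // j _ _; rewrite (Bw j Logic.I).
pose C (f : {ffun 'I_m -> I}) : set Omega := if `[< S (grid_point f) >] then B f else set0.
have AE : A = \bigcup_(f in [set: {ffun 'I_m -> I}]) C f.
  apply/seteqP; split => [w /= Aw|w [f _]].
    have Bw : B [ffun j => z (X j w)] w by move=> i _ /=; rewrite ffunE.
    by exists [ffun j => z (X j w)] => //; rewrite /C asboolT // -(ptB _ _ Bw).
  by rewrite /C; case: asboolP => // Sf Bw; rewrite /A /= (ptB _ _ Bw).
have PB f : P (B f) = (\prod_(i < m) p i (f i))%:E.
  have := iX [set: 'I_m]%SET (fun i => z @^-1` [set f i]) (fun i => mz (f i)).
  rewrite (_ : [set` [set: 'I_m]%SET] = [set: 'I_m]); last first.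
    by apply/seteqP; split => // i _ /=; rewrite inE.
  rewrite -/(B f) => ->; rewrite -prodEFin; apply: eq_big => [i|i _]; first by rewrite inE.
  rewrite /p valK fineK //.
  exact: fin_num_measure.
rewrite AE measure_fin_bigcup; last first.
- by move=> f _; rewrite /C; case: asboolP.
- apply/trivIsetP => f g _ _ fg; apply/seteqP; split => // w [].
  rewrite /C; case: asboolP => // _; case: asboolP => // _ Bf Bg.
  by move/eqP: fg; apply; apply/ffunP => i; rewrite -(Bf i Logic.I) -(Bg i Logic.I).
- exact: finite_finset.
rewrite (_ : [set: {ffun 'I_m -> I}] = [set` enum {ffun 'I_m -> I}]); last first.
  by apply/seteqP; split => // f _ /=; rewrite mem_enum.
rewrite -fsbig_seq ?enum_uniq // big_enum /=.
rewrite /grid_prob grid_expect_sum -sumEFin; apply: eq_bigr => f _.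
rewrite /C indicE; case: asboolP => Sf; first by rewrite PB mem_set // mulr1.
by rewrite measure0 memNset // mulr0.
Qed.
End GridProbability.

(** * Concentration of quasi-convex Lipschitz functions *)

Section Concentration.
Context {R : realType} {d} {Omega : measurableType d} {P : probability Omega R}.

Definition cut (c x : R) : R := x * (`|x| < c)%R%:R.

Lemma cut_itv c x : 0 < c -> - c <= cut c x <= c.
Proof.
move=> c0; rewrite /cut; case: (ltrP `|x| c) => xc.
  by rewrite mulr1 -ler_norml ltW.
by rewrite mulr0 oppr_le0 ltW.
Qed.

Lemma measurable_cut c : measurable_fun setT (cut c).
Proof.
apply: measurable_funM => //.
rewrite (_ : (fun x => _) = \1_(`]- c, c[ : set R)).
  by apply: measurable_indic; exact: measurable_itv.
apply/funext => x; rewrite indicE mem_setE in_itv /= -ltr_norml.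
by [].
Qed.

(** The cut value is rounded down on a grid of mesh [e] starting at [- c], so the representative
    stays in the box in which the convex distance inequality applies. *)
Lemma quantization (c e : R) : 0 < c -> 0 < e ->
  exists (K : nat) (v : 'I_K.+1 -> R) (z : R -> 'I_K.+1),
    [/\ forall k, - c <= v k <= c,
        forall x, `|cut c x - v (z x)| <= e &
        forall k, measurable (z @^-1` [set k])].
Proof.
move=> c0 e0; pose K := Num.truncn (2 * c / e).
pose n x := Num.truncn ((cut c x + c) / e).
have nK x : (n x < K.+1)%N.
  rewrite ltnS; apply: le_truncn; rewrite ler_pM2r ?invr_gt0 //.
  by have /andP[_ ?] := cut_itv x c0; lra.
exists K, (fun k => - c + k%:R * e), (fun x => inord (n x)).
have y0 x : 0 <= (cut c x + c) / e.
  by rewrite divr_ge0 ?(ltW e0) //; have /andP[? _] := cut_itv x c0; lra.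
split.
- move=> k; rewrite lerDl mulr_ge0 ?(ltW e0) //=.
  have kK : k%:R <= 2 * c / e.
    have : (k <= K)%N by rewrite -ltnS ltn_ord.
    by rewrite /K -truncn_ge_nat // divr_ge0 ?(ltW e0) // mulr_ge0 ?(ltW c0).
  by move: kK; rewrite ler_pdivlMr //; lra.
- move=> x; rewrite inordK //.
  have /andP[h1 h2] := truncn_itv (y0 x).
  move: h1 h2; rewrite ler_pdivlMr // ltr_pdivrMr // -/(n x) -natr1 => h1 h2.
  by rewrite ler_norml; apply/andP; split; lra.
- move=> k.
  rewrite (_ : _ @^-1` _ = cut c @^-1` (`[- c + k%:R * e, - c + k.+1%:R * e[ : set R)).
    rewrite -[X in measurable X]setTI; apply: measurable_cut => //; exact: measurable_itv.
  apply/seteqP; split => x /=; rewrite in_itv /=.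
    move=> <-; rewrite inordK //.
    have /andP[h1 h2] := truncn_itv (y0 x).
    move: h1 h2; rewrite ler_pdivlMr // ltr_pdivrMr // -/(n x) => h1 h2.
    by apply/andP; split; lra.
  move=> /andP[h1 h2]; apply/val_inj; rewrite /= inordK //; apply: truncn_def.
  by rewrite ler_pdivlMr // ltr_pdivrMr //; apply/andP; split; lra.
Qed.

(** The convex distance inequality is applied to the rounded vector. Of the gap [3 * t], rounding
    takes one [t] on each side, and the remaining [t] separates the two sets by [t / L]. The
    constant 32 is [8 * 2 ^ 2], the box having width [2 * c]. *)
Lemma quasiconvex_concentration (m : nat) (X : 'I_m -> {RV P >-> R})
    (F : 'rV[R]_m -> R) (c L r t : R) :
  mutually_independent X -> 0 < c -> 0 < L -> 0 < t ->
  (forall x y, `|F x - F y| <= L * l2norm (x - y)) ->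
  (forall x y a s, 0 <= a <= 1 -> F x <= s -> F y <= s ->
     F (a *: x + (1 - a) *: y) <= s) ->
  (P [set w | (F (cut_vector c X w) <= r)%R]
     * P [set w | (r + 3 * t <= F (cut_vector c X w))%R]
   <= (expR (- (t ^+ 2 / (32 * (c * L) ^+ 2))))%:E)%E.
Proof.
move=> iX c0 L0 t0 lF qF.
(* With this mesh, rounding [m] coordinates moves [F] by at most [t]; the successor avoids a
   division by zero when [m = 0]. *)
have e0 : 0 < t / (L * m.+1%:R) by rewrite divr_gt0 // mulr_gt0.
have [K [v [z [vc zc mz]]]] := quantization c0 e0.
pose row (x : nat -> R) : 'rV[R]_m := \row_j x j.
pose Q w := grid_point v (fun j => z (X j w)).
have QE w : row (Q w) = \row_j v (z (X j w)).
  by apply/rowP => j; rewrite !mxE /Q /grid_point valK.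
have FQ w : `|F (cut_vector c X w) - F (row (Q w))| <= t.
  apply: le_trans (lF _ _) _; rewrite QE mulrC -ler_pdivlMr //.
  apply: le_trans (l2norm_le_sum _) _.
  apply: (@le_trans _ _ (\sum_(j < m) t / (L * m.+1%:R))).
    by apply: ler_sum => j _; rewrite !mxE; exact: zc.
  rewrite sumr_const card_ord -[leLHS]mulr_natr.
  have -> : t / (L * m.+1%:R) * m%:R = t / L * (m%:R / m.+1%:R).
    by field; rewrite (gt_eqF L0) addrC natr1 pnatr_eq0.
  rewrite -[leRHS]mulr1 ler_wpM2l ?divr_ge0 ?(ltW t0) ?(ltW L0) //.
  by rewrite ler_pdivrMr // mul1r ler_nat.
pose p i k := if insub i is Some j then fine (P (X j @^-1` (z @^-1` [set k]))) else 0.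
have p0 i k : 0 <= p i k.
  by rewrite /p; case: insub => // j; apply: fine_ge0; exact: measure_ge0.
have p1 i : (i < m)%N -> \sum_k p i k = 1.
  move=> im; rewrite /p insubT /=.
  set j := Ordinal im.
  have mXj k : measurable (X j @^-1` (z @^-1` [set k])).
    by rewrite -[X in measurable X]setTI; apply: measurable_funP.
  apply: EFin_inj; rewrite -sumEFin.
  under eq_bigr do rewrite fineK ?fin_num_measure //.
  rewrite -(@probability_setT _ _ _ P).
  have -> : [set: Omega] = \bigcup_(k in [set` enum 'I_K.+1]) (X j @^-1` (z @^-1` [set k])).
    apply/seteqP; split => // w _; exists (z (X j w)) => //=; by rewrite mem_enum.
  rewrite measure_fin_bigcup //.
  - by rewrite -fsbig_seq ?enum_uniq // big_enum.
  - apply/trivIsetP => k l _ _ kl; apply/seteqP; split => // w [/= zk zl].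
    by move/eqP: kl; apply; rewrite -zk -zl.
(* [S1] is convex because [F] is quasi-convex, and it lies at distance at least
   [t / L] from [S2]. *)
pose S1 := [set x : nat -> R | F (row x) <= r + t /\
   forall i, (i < m)%N -> - c <= x i <= c].
pose S2 := [set x : nat -> R | r + 2 * t <= F (row x)].
have mF : measurable_fun setT (fun w => F (cut_vector c X w)).
  apply: (@measurable_lipschitz_comp _ _ _ _ (fun i w => cut c (X i w)) F L) => //.
    by move=> i; apply: measurableT_comp => //; exact: measurable_cut.
  exact: ltW.
have le1 : (P [set w | (F (cut_vector c X w) <= r)%R] <= (grid_prob v p m S1)%:E)%E.
  rewrite -(grid_prob_event v S1 iX mz); apply: le_measure; rewrite ?inE.
  - rewrite (_ : [set w | _] = (fun w => F (cut_vector c X w)) @^-1` `]-oo, r]).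
      by rewrite -[X in measurable X]setTI; apply: mF => //; exact: measurable_itv.
    by apply/seteqP; split => w /=; rewrite in_itv.
  - exact: measurable_grid_event.
  - move=> w /= Fw; split.
      by have := FQ w; rewrite ler_norml => /andP[? ?]; rewrite -/(Q w); lra.
    by move=> i im; rewrite /grid_point insubT /=; exact: vc.
have le2 : (P [set w | (r + 3 * t <= F (cut_vector c X w))%R] <= (grid_prob v p m S2)%:E)%E.
  rewrite -(grid_prob_event v S2 iX mz); apply: le_measure; rewrite ?inE.
  - rewrite (_ : [set w | _] = (fun w => F (cut_vector c X w)) @^-1` `[r + 3 * t, +oo[).
      by rewrite -[X in measurable X]setTI; apply: mF => //; exact: measurable_itv.
    by apply/seteqP; split => w /=; rewrite in_itv /= andbT.
  - exact: measurable_grid_event.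
  - move=> w /= Fw; rewrite /S2 /=.
    by have := FQ w; rewrite ler_norml => /andP[? ?]; rewrite -/(Q w); lra.
apply: (le_trans (lee_pmul (measure_ge0 _ _) (measure_ge0 _ _) le1 le2)).
rewrite -EFinM lee_fin.
have rowc a x y : row (fun i => a * x i + (1 - a) * y i)
    = a *: row x + (1 - a) *: row y by apply/rowP => j; rewrite !mxE.
have cS1 : convex_in_coords S1.
  move=> x y a a01 [Fx bx] [Fy b_y]; split; first by rewrite rowc; exact: qF.
  by move=> i im; have := bx i im; have := b_y i im; move: a01; nra.
have bS1 : within_box m (- c) c S1 by move=> x [].
have cc : - c < c by lra.
have T := talagrand_convex p0 cc vc p1 cS1 bS1.
have [S10|/set0P/negP/negPn/eqP S1n] := pselect (S1 !=set0); last first.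
  by rewrite S1n grid_prob_set0 mul0r expR_ge0.
rewrite expRN -div1r ler_pdivlMr ?expR_gt0 //.
apply: le_trans T; rewrite -mulrA ler_wpM2l ?grid_prob_ge0 //.
set E0 := expR _.
apply: (@le_trans _ _ (grid_expect v p m (fun x => E0 * \1_S2 x + 0 * 0))).
  by rewrite grid_expect_comb mul0r addr0 mulrC.
apply: (grid_expect_mono v p0) => x; rewrite mul0r addr0 indicE.
case: (boolP (x \in S2)) => [/set_mem S2x|_]; last by rewrite mulr0 expR_ge0.
rewrite mulr1 ler_expR.
have -> : t ^+ 2 / (32 * (c * L) ^+ 2) = (t / L) ^+ 2 / (8 * (c - - c) ^+ 2).
  by field; rewrite (gt_eqF L0) (gt_eqF c0) /=; lra.
have D0 : 0 <= (8 * (c - - c) ^+ 2)^-1 by rewrite invr_ge0 pmulr_rge0 ?sqr_ge0.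
rewrite ler_wpM2r // /sq_dist; apply: lb_le_inf; first by case: S10 => y S1y; eexists; exists y.
move=> _ [y [Fy by_] <-].
have : t <= L * l2norm (row x - row y).
  apply: le_trans (lF _ _); apply: le_trans (ler_norm _).
  by move: S2x; rewrite /S2 /=; lra.
rewrite mulrC -ler_pdivrMr // => h.
have h0 : 0 <= \sum_(i < m) (x i - y i) ^+ 2 by apply: sumr_ge0 => i _; rewrite sqr_ge0.
rewrite -[leRHS]sqr_sqrtr // lerXn2r ?nnegrE ?divr_ge0 ?(ltW t0) ?(ltW L0) ?sqrtr_ge0 //.
by apply: le_trans h _; rewrite /l2norm; under eq_bigr do rewrite !mxE.
Qed.

End Concentration.

(** * The truncated logarithm *)

Section TruncatedLog.
Context {R : realType}.

(** Supporting lines express convexity on the half-line; their slopes must be nonnegative because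
    [|x|] is convex but not affine. *)
Lemma convex_fun_norm (H : R -> R) :
  (forall y0, 0 <= y0 -> exists2 a, 0 <= a &
     forall y, 0 <= y -> H y0 + a * (y - y0) <= H y) ->
  convex_fun (fun x => H `|x|).
Proof.
move=> tH x y t /andP[t0 t1].
have [a a0 Ha] := tH `|t * x + (1 - t) * y| (normr_ge0 _).
have hx := Ha `|x| (normr_ge0 _); have hy := Ha `|y| (normr_ge0 _).
have : `|t * x + (1 - t) * y| <= t * `|x| + (1 - t) * `|y|.
  apply: (le_trans (ler_normD _ _)).
  by rewrite !normrM (ger0_norm t0) (@ger0_norm _ (1 - t)) // subr_ge0.
set z := `|t * x + _| in hx hy *; move=> hz.
have h1 : t * (H z + a * (`|x| - z)) <= t * H `|x| by rewrite ler_wpM2l.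
have h2 : (1 - t) * (H z + a * (`|y| - z)) <= (1 - t) * H `|y|.
  by rewrite ler_wpM2l // subr_ge0.
have h3 : 0 <= a * (t * `|x| + (1 - t) * `|y| - z) by rewrite mulr_ge0 // subr_ge0.
lra.
Qed.

Lemma ln_sub_le (x y : R) : 0 < x -> 0 < y -> ln x - ln y <= x / y - 1.
Proof.
move=> x0 y0; rewrite -ln_div ?posrE //.
have := @le_ln1Dx _ (x / y - 1); rewrite [1 + _]addrC subrK; apply.
by rewrite ltrBrDr addrC subrr divr_gt0.
Qed.

Definition clamp (a b y : R) : R := Num.max a (Num.min y b).

Definition trunc_log (a b x : R) : R := ln (clamp a b `|x|).

(* [trunc_log] is the difference of the convex functions [hinge] and
   [hinge - trunc_log], all of them [1 / a]-Lipschitz. *)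
Definition hinge (a x : R) : R := Num.max 0 (`|x| - a) / a.

Context (a b : R) (a0 : 0 < a) (ab : a <= b).

Let b0 : 0 < b. Proof. exact: lt_le_trans ab. Qed.

Lemma clamp_gt0 y : 0 < clamp a b y.
Proof. by rewrite /clamp lt_max a0. Qed.

Lemma clamp_le y : clamp a b y <= b.
Proof. by rewrite /clamp ge_max ab ge_min lexx orbT. Qed.

Lemma clamp_ge y : a <= clamp a b y.
Proof. by rewrite /clamp le_max lexx. Qed.

Lemma clamp_sub_le y z : y <= z ->
  0 <= clamp a b z - clamp a b y <= Num.max 0 (z - a) - Num.max 0 (y - a).
Proof.
move=> yz; rewrite /clamp; have := ab.
by case: (leP z b); case: (leP y b); case: (leP 0 (z - a)); case: (leP 0 (y - a));
  case: (leP a z); case: (leP a y); case: (leP a b) => //; move: yz; lra.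
Qed.

Lemma trunc_log_ge x : ln a <= trunc_log a b x.
Proof. by rewrite ler_ln ?posrE ?clamp_gt0 ?clamp_ge. Qed.

Lemma trunc_log_le x : trunc_log a b x <= ln b.
Proof. by rewrite ler_ln ?posrE ?clamp_gt0 ?clamp_le. Qed.

(** Beyond [a] the logarithm has slope at most [1 / a], which is the slope of the hinge. The two
    inequalities together make the hinge minus the logarithm nondecreasing in [|x|], with increments
    at most those of the hinge. *)
Lemma ln_clamp_sub y z : y <= z ->
  0 <= ln (clamp a b z) - ln (clamp a b y)
    <= Num.max 0 (z - a) / a - Num.max 0 (y - a) / a.
Proof.
move=> yz; have /andP[h1 h2] := clamp_sub_le yz.
rewrite subr_ge0 ler_ln ?posrE ?clamp_gt0 //; rewrite -[X in X && _]subr_ge0 h1 /=.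
apply: le_trans (ln_sub_le (clamp_gt0 _) (clamp_gt0 _)) _.
rewrite -mulrBl ler_pdivlMr //.
have -> : clamp a b z / clamp a b y - 1 = (clamp a b z - clamp a b y) / clamp a b y.
  by rewrite mulrBl divff // gt_eqF // clamp_gt0.
rewrite mulrAC ler_pdivrMr ?clamp_gt0 //.
by apply: ler_pM => //; [exact: ltW|exact: clamp_ge].
Qed.

Lemma trunc_log_lipschitz : lipschitz_fun a^-1 (trunc_log a b).
Proof.
have key x y : `|x| <= `|y| -> `|trunc_log a b x - trunc_log a b y| <= a^-1 * `|x - y|.
  move=> xy; have /andP[h1 h2] := ln_clamp_sub xy.
  rewrite distrC ger0_norm //; apply: (le_trans h2).
  rewrite -mulrBl mulrC ler_wpM2l ?invr_ge0 ?(ltW a0) //.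
  have := lerB_dist y x; rewrite distrC.
  have : 0 <= `|x - y| by [].
  by move: xy; case: (leP 0 (`|y| - a)); case: (leP 0 (`|x| - a)); lra.
move=> x y; have [/key//|/ltW/key] := leP `|x| `|y|.
by rewrite distrC [`|y - x|]distrC.
Qed.

Lemma hinge_lipschitz : lipschitz_fun a^-1 (hinge a).
Proof.
move=> x y; rewrite /hinge -mulrBl normrM mulrC normfV (gtr0_norm a0).
rewrite ler_wpM2l ?invr_ge0 ?(ltW a0) //.
have := lerB_dist y x; have := lerB_dist x y; rewrite [`|y - x|]distrC.
have : 0 <= `|x - y| by [].
by case: (leP 0 (`|y| - a)); case: (leP 0 (`|x| - a)); rewrite ler_norml; lra.
Qed.

Lemma hinge_convex : convex_fun (hinge a).
Proof.
apply: (@convex_fun_norm (fun y => Num.max 0 (y - a) / a)) => y0 y00.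
have [ya|ya] := leP (y0 - a) 0.
  exists 0 => // y y_0; rewrite !mul0r addr0.
  by rewrite divr_ge0 ?(ltW a0) // le_max lexx.
exists a^-1; first by rewrite invr_ge0 ltW.
move=> y y_0; rewrite [a^-1 * _]mulrC -mulrDl ler_wpM2r ?invr_ge0 ?(ltW a0) //.
by case: (leP 0 (y - a)); lra.
Qed.

Lemma hinge_sub_log_lipschitz : lipschitz_fun a^-1 (fun x => hinge a x - trunc_log a b x).
Proof.
have key x y : `|x| <= `|y| ->
    `|hinge a x - trunc_log a b x - (hinge a y - trunc_log a b y)| <= a^-1 * `|x - y|.
  move=> xy; have /andP[h1 h2] := ln_clamp_sub xy.
  rewrite -/(hinge a x) -/(hinge a y) -/(trunc_log a b x) -/(trunc_log a b y) in h1 h2 *.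
  have := hinge_lipschitz x y; rewrite !ler_norml => /andP[h3 h4].
  by apply/andP; split; lra.
move=> x y; have [/key//|/ltW/key] := leP `|x| `|y|.
by rewrite distrC [`|y - x|]distrC.
Qed.

(** As a function of [y = |x|] the slope is 0 up to [a], then [1/a - 1/y] up to [b], then [1/a]: at
    [a] the kinks of the hinge and of the clamp cancel, and at [b] the slope jumps up. The three
    cases use these slopes for the supporting lines. *)
Lemma hinge_sub_log_convex : convex_fun (fun x => hinge a x - trunc_log a b x).
Proof.
apply: (@convex_fun_norm (fun y => Num.max 0 (y - a) / a - ln (clamp a b y))) => y0 y00.
have hy y : y / a - 1 <= Num.max 0 (y - a) / a.
  have -> : y / a - 1 = (y - a) / a by rewrite mulrBl divff // gt_eqF.
  by rewrite ler_wpM2r ?invr_ge0 ?(ltW a0) // le_max lexx orbT.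
have cb y : ln (clamp a b y) <= ln b by rewrite ler_ln ?posrE ?clamp_gt0 ?clamp_le.
have [ya|ya] := leP y0 a.
  exists 0 => // y y_0; rewrite mul0r addr0.
  have ca : clamp a b y0 = a.
    by rewrite /clamp; apply/max_idPl; rewrite ge_min ya.
  rewrite ca; have -> : Num.max 0 (y0 - a) = 0 by apply/max_idPl; rewrite subr_le0.
  rewrite mul0r; have [ay|ay] := leP a y.
    have /andP[_] := ln_clamp_sub ay; rewrite subrr maxxx mul0r.
    have -> : clamp a b a = a by rewrite /clamp; apply/max_idPl; rewrite ge_min lexx.
    lra.
  have -> : clamp a b y = a by rewrite /clamp; apply/max_idPl; rewrite ge_min (ltW ay).
  have -> : Num.max 0 (y - a) = 0 by apply/max_idPl; rewrite subr_le0 ltW.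
  lra.
have m0 : Num.max 0 (y0 - a) = y0 - a by apply/max_idPr; rewrite subr_ge0 ltW.
have [yb|yb] := leP y0 b; last first.
  exists a^-1; first by rewrite invr_ge0 ltW.
  move=> y y_0; have -> : clamp a b y0 = b.
    by rewrite /clamp; rewrite (min_idPr (ltW yb)); apply/max_idPr.
  have := hy y; have := cb y; rewrite m0.
  have -> : (y0 - a) / a - ln b + a^-1 * (y - y0) = y / a - 1 - ln b.
    by field; rewrite gt_eqF.
  lra.
have y0p : 0 < y0 by exact: lt_trans ya.
have c0 : clamp a b y0 = y0 by rewrite /clamp (min_idPl yb); apply/max_idPr/ltW.
exists (a^-1 - y0^-1); first by rewrite subr_ge0 lef_pV2 ?posrE // ltW.
move=> y y_0; rewrite m0 c0.
have -> : (y0 - a) / a - ln y0 + (a^-1 - y0^-1) * (y - y0) = y / a - y / y0 - ln y0.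
  by field; rewrite !gt_eqF.
have [ay|ay] := leP a y.
  have yp : 0 < y by exact: lt_le_trans ay.
  have : ln (clamp a b y) <= ln y.
    by rewrite ler_ln ?posrE ?clamp_gt0 // /clamp ge_max ay ge_min lexx.
  have := hy y; have := ln_sub_le yp y0p; lra.
have -> : clamp a b y = a by rewrite /clamp; apply/max_idPl; rewrite ge_min (ltW ay).
have -> : Num.max 0 (y - a) = 0 by apply/max_idPl; rewrite subr_le0 ltW.
have := ln_sub_le a0 y0p.
have : y * (a^-1 - y0^-1) <= a * (a^-1 - y0^-1).
  by rewrite ler_wpM2r ?(ltW ay) // subr_ge0 lef_pV2 ?posrE // ltW.
rewrite mulrBr [a * _]mulrBr divff ?gt_eqF //; lra.
Qed.
End TruncatedLog.

(** * Measurability of the eigenvalues *)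

Section SpectralMeasurability.
Context {R : realType}.

Definition eig {N : nat} (T : 'M[R]_N) (i : nat) : R := nth 0 (eigenvalues T) i.

Lemma big_eigenvalues {A : Type} {idx : A} {op : A -> A -> A} {N : nat} (T : 'M[R]_N)
    (f : R -> A) : T \is symmetricmx ->
  \big[op/idx]_(l <- eigenvalues T) f l = \big[op/idx]_(i < N) f (eig T i).
Proof.
move=> sT; rewrite (big_nth 0) (size_eigenvalues sT) big_mkord.
by [].
Qed.

Lemma trace_fun_eig {N : nat} (f : R -> R) (T : 'M[R]_N) : T \is symmetricmx ->
  trace_fun f T = \sum_(i < N) f (eig T i).
Proof. exact: big_eigenvalues. Qed.

(* Difference quotients of these convex functions tend to the indicator functions
   of half-lines, so that measurability of the traces of convex functions gives
   measurability of the eigenvalue counts, hence of the ordered eigenvalues. *)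
Definition pos_part (b x : R) : R := Num.max 0 (b - x).

Lemma pos_part_convex b : convex_fun (pos_part b).
Proof.
move=> x y t /andP[t0 t1]; rewrite /pos_part.
have h1 : 0 <= t * Num.max 0 (b - x) by rewrite mulr_ge0 // le_max lexx.
have h2 : 0 <= (1 - t) * Num.max 0 (b - y) by rewrite mulr_ge0 ?subr_ge0 // le_max lexx.
rewrite ge_max addr_ge0 //=.
have h3 : t * (b - x) <= t * Num.max 0 (b - x) by rewrite ler_wpM2l // le_max lexx orbT.
have h4 : (1 - t) * (b - y) <= (1 - t) * Num.max 0 (b - y).
  by rewrite ler_wpM2l ?subr_ge0 // le_max lexx orbT.
lra.
Qed.

Lemma pos_part_lipschitz b : lipschitz_fun 1 (pos_part b).
Proof.
move=> x y; rewrite mul1r /pos_part.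
have := ler_norm (x - y); have := ler_norm (y - x); rewrite [`|y - x|]distrC.
by case: (leP 0 (b - x)); case: (leP 0 (b - y)); rewrite ler_norml; lra.
Qed.

Context {d} {Omega : measurableType d} {N : nat} (H : Omega -> 'M[R]_N).

(** The one property of a random matrix on which the measurability of its spectral quantities rests.
    Convex Lipschitz functions are singled out because their traces are Lipschitz in the matrix. *)
Definition trace_measurable : Prop :=
  (forall w, H w \is symmetricmx) /\
  forall (f : R -> R) (L : R), convex_fun f -> lipschitz_fun L f -> 0 <= L ->
    measurable_fun setT (fun w => trace_fun f (H w)).

Hypothesis mH : trace_measurable.

(** When no element lies strictly between [a] and [a + 1 / (k + 1)], the difference quotient equals
    the indicator exactly, not only in the limit. *)
Lemma count_indic (a : R) (s : seq R) (k : nat) :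
  (forall l, l \in s -> l <= a \/ a + k.+1%:R^-1 <= l) ->
  (count (<= a) s)%:R = \sum_(l <- s) k.+1%:R * (pos_part (a + k.+1%:R^-1) l - pos_part a l).
Proof.
have k0 : 0 < k.+1%:R^-1 :> R by rewrite invr_gt0.
elim: s => [|l s IH] h; first by rewrite big_nil.
rewrite big_cons /= natrD IH => [|l' l's]; last by apply: h; rewrite inE l's orbT.
congr (_ + _); rewrite /pos_part.
have [la|la] := h l (mem_head _ _).
  rewrite la (max_idPr _) ?(max_idPr _) ?subr_ge0 //; last by apply: le_trans la _; rewrite lerDl ltW.
  move: k0; set e := k.+1%:R => k0; rewrite /=; field.
  by rewrite gt_eqF // -invr_gt0.
have -> : (l <= a) = false by apply/negbTE; rewrite -ltNge (lt_le_trans _ la) // ltrDl.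
have -> : Num.max 0 (a + k.+1%:R^-1 - l) = 0 by apply/max_idPl; rewrite subr_le0.
have -> : Num.max 0 (a - l) = 0 by apply/max_idPl; rewrite subr_le0 (le_trans _ la) // lerDl ltW.
by rewrite subrr mulr0.
Qed.

Lemma eventually_gap (a : R) (s : seq R) :
  \forall k \near \oo, forall l, l \in s -> l <= a \/ a + k.+1%:R^-1 <= l.
Proof.
elim: s => [|x s IH]; first by apply: nearW => k l.
have [xa|ax] := leP x a.
  apply: filterS IH => k h l; rewrite inE => /orP[/eqP ->|/h //]; by left.
have xa0 : 0 < x - a by rewrite subr_gt0.
apply: filterS (filterI IH (near_infty_natSinv_lt (PosNum xa0))) => k [h /= hk] l.
rewrite inE => /orP[/eqP ->|/h //]; right; rewrite -lerBrDl ltW //.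
Qed.

Lemma measurable_eig_count (a : R) :
  measurable_fun setT (fun w => (count (<= a) (eigenvalues (H w)))%:R : R).
Proof.
have [sH tH] := mH.
pose g k w : R := k.+1%:R * (trace_fun (pos_part (a + k.+1%:R^-1)) (H w)
   - trace_fun (pos_part a) (H w)).
apply: (@measurable_realfun.measurable_fun_cvg _ _ _ _ g); last first.
  move=> w _; apply/cvgrPdist_le => e e0.
  apply: filterS (eventually_gap a (eigenvalues (H w))) => k /count_indic ->.
  by rewrite /g /trace_fun -sumrB mulr_sumr subrr normr0 ltW.
move=> k; apply: measurable_funM => //; apply: measurable_funB;
  apply: (tH _ 1) => //; [exact: pos_part_convex|exact: pos_part_lipschitz|
    exact: pos_part_convex|exact: pos_part_lipschitz].
Qed.

Lemma eig_le_count {n : nat} (T : 'M[R]_n) (i : nat) (a : R) : T \is symmetricmx -> (i < n)%N ->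
  (eig T i <= a) = (i < count (<= a)%R (eigenvalues T))%N.
Proof.
move=> sT iN; apply/idP/idP; last first.
  by move=> h; apply: nth_count_le => //; exact: eigenvalues_sorted.
apply: contraLR; rewrite -leqNgt -ltNge => h; apply: nth_count_gt.
  exact: eigenvalues_sorted.
by rewrite h size_eigenvalues.
Qed.

Lemma measurable_eig (i : nat) : measurable_fun setT (fun w => eig (H w) i).
Proof.
have [sH tH] := mH; have [iN|Ni] := ltnP i N; last first.
  rewrite (_ : (fun w => _) = cst 0); first exact: measurable_cst.
  by apply/funext => w; rewrite /eig nth_default // size_eigenvalues.
apply: (measurability (@RGenOInfty.G R)).
  exact: RGenOInfty.measurableE.
move=> _ [_ [a ->] <-]; rewrite setTI.
rewrite (_ : _ @^-1` _ =
  (fun w => (count (<= a) (eigenvalues (H w)))%:R : R) @^-1` `]-oo, i%:R]).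
  rewrite -[X in measurable X]setTI; apply: measurable_eig_count => //.
apply/seteqP; split => w /=; rewrite !in_itv /= andbT ltNge eig_le_count // -leqNgt ler_nat //.
Qed.

Lemma measurable_trace_fun (f : R -> R) : measurable_fun setT f ->
  measurable_fun setT (fun w => trace_fun f (H w)).
Proof.
have [sH _] := mH => mf.
rewrite (_ : (fun w => _) = (fun w => \sum_(i < N) f (eig (H w) i))); last first.
  by apply/funext => w; rewrite trace_fun_eig.
apply: measurable_sum => i; apply: measurableT_comp => //; exact: measurable_eig.
Qed.

Lemma measurable_prod_eigenvalues (f : R -> R) : measurable_fun setT f ->
  measurable_fun setT (fun w => \prod_(l <- eigenvalues (H w)) f l).
Proof.
have [sH _] := mH => mf.
rewrite (_ : (fun w => _) = (fun w => \prod_(i < N) f (eig (H w) i))); last first.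
  by apply/funext => w; rewrite big_eigenvalues.
apply: measurable_prod => i _; apply: measurableT_comp => //; exact: measurable_eig.
Qed.

End SpectralMeasurability.

(** * Lipschitz matrix models *)

Section LipschitzModel.
Context {R : realType} {N m : nat} (Phi : 'rV[R]_m -> 'M[R]_N).

(** A positive dimension provides two distinct points; otherwise the supremum would be over the
    empty set, hence minus infinity. *)
Lemma Lip_normP : (0 < m)%N ->
  (Lip_norm (@l2norm R m) (@Ftilde_norm R N) Phi < +oo)%E ->
  0 <= fine (Lip_norm (@l2norm R m) (@Ftilde_norm R N) Phi) /\
  forall x y, Ftilde_norm (Phi x - Phi y)
    <= fine (Lip_norm (@l2norm R m) (@Ftilde_norm R N) Phi) * l2norm (x - y).
Proof.
move=> m0; set l := Lip_norm _ _ _ => loo.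
have norm0 (x : 'rV[R]_m) : x != 0 -> 0 < l2norm x.
  apply: contraNT; rewrite /l2norm -leNgt => x0.
  have : \sum_i x 0 i ^+ 2 == 0.
    rewrite eq_le; apply/andP; split; last by apply: sumr_ge0 => i _; rewrite sqr_ge0.
    by rewrite -sqrtr_eq0 eq_le x0 sqrtr_ge0.
  rewrite psumr_eq0 => [/allP h|i _]; last by rewrite sqr_ge0.
  apply/eqP/rowP => i; rewrite mxE; apply/eqP.
  by have := h i (mem_index_enum _); rewrite sqrf_eq0.
have ub x y : x != y -> ((Ftilde_norm (Phi x - Phi y) / l2norm (x - y))%:E <= l)%E.
  by move=> xy; apply: ereal_sup_ubound; exists x, y.
have l0 : (0 <= l)%E.
  have : const_mx 1 != 0 :> 'rV[R]_m.
    apply/eqP => /rowP/(_ (Ordinal m0)); rewrite !mxE; apply/eqP; exact: oner_neq0.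
  move=> /ub; apply: le_trans; rewrite lee_fin; apply: divr_ge0; exact: sqrtr_ge0.
have lf : l \is a fin_num by rewrite ge0_fin_numE.
split; first exact: fine_ge0.
move=> x y; have [->|xy] := eqVneq x y.
  rewrite !subrr /l2norm /Ftilde_norm.
  rewrite [X in Num.sqrt X]big1 ?sqrtr0 => [|i _].
    by rewrite mulr_ge0 ?fine_ge0 // sqrtr_ge0.
  by rewrite big1 // => j _; rewrite mxE expr0n.
rewrite -ler_pdivrMr ?norm0 ?subr_eq0 // -lee_fin fineK //; exact: ub.
Qed.

Lemma trace_fun_model_lipschitz (f : R -> R) (L l : R) :
  convex_fun f -> lipschitz_fun L f -> 0 <= L ->
  (forall x, Phi x \is symmetricmx) ->
  (forall x y, Ftilde_norm (Phi x - Phi y) <= l * l2norm (x - y)) ->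
  forall x y, `|trace_fun f (Phi x) - trace_fun f (Phi y)|
    <= L * Num.sqrt (2 * N%:R) * l * l2norm (x - y).
Proof.
move=> cf lf L0 sP lP x y.
apply: le_trans (trace_fun_lipschitz cf lf L0 (sP x) (sP y)) _.
by rewrite -[leRHS]mulrA ler_wpM2l // mulr_ge0 // sqrtr_ge0.
Qed.

Lemma trace_measurable_model d (Omega : measurableType d) (Y : 'I_m -> Omega -> R) (l : R) :
  (forall i, measurable_fun setT (Y i)) -> 0 <= l ->
  (forall x, Phi x \is symmetricmx) ->
  (forall x y, Ftilde_norm (Phi x - Phi y) <= l * l2norm (x - y)) ->
  trace_measurable (fun w => Phi (\row_i Y i w)).
Proof.
move=> mY l0 sP lP; split=> [w //|f L cf lf L0].
apply: (@measurable_lipschitz_comp _ _ _ _ Y (fun x => trace_fun f (Phi x))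
  (L * Num.sqrt (2 * N%:R) * l)) => //.
  exact: trace_fun_model_lipschitz.
by rewrite !mulr_ge0 // sqrtr_ge0.
Qed.
End LipschitzModel.

(** * Kolmogorov-Smirnov and bounded Lipschitz distances *)

Section KolmogorovSmirnov.
Context {R : realType}.

Definition eig_count {N : nat} (T : 'M[R]_N) (x : R) : R :=
  (count (<= x) (eigenvalues T))%:R.

Lemma eig_countE {N : nat} (T : 'M[R]_N) (x : R) :
  eig_count T x = trace_fun (fun l => (l <= x)%R%:R) T.
Proof.
rewrite /eig_count /trace_fun -sum1_count natr_sum big_mkcond /=.
by apply: eq_bigr => l _; case: ifP.
Qed.

Lemma esd_ray {N : nat} (T : 'M[R]_N) (x : R) : T \is symmetricmx ->
  esd T `]-oo, x]%classic = (N%:R^-1 * eig_count T x)%:E.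
Proof.
move=> sT; rewrite /esd /= /mscale /= /msum /= EFinM; congr (_ * _)%E.
rewrite eig_countE trace_fun_eig // -sumEFin; apply: eq_bigr => i _.
by rewrite diracE mem_setE in_itv.
Qed.

Lemma abse_esd_ray {N : nat} (T T' : 'M[R]_N) (x : R) :
  T \is symmetricmx -> T' \is symmetricmx ->
  `|esd T `]-oo, x]%classic - esd T' `]-oo, x]%classic|%E
    = (`|eig_count T x - eig_count T' x| / N%:R)%:E.
Proof.
move=> sT sT'.
transitivity (`|N%:R^-1 * eig_count T x - N%:R^-1 * eig_count T' x|%:E).
  exact: (congr2 (fun u v => `|u - v|%E) (esd_ray x sT) (esd_ray x sT')).
congr EFin; rewrite -mulrBr normrM mulrC.
by congr (_ * _); rewrite ger0_norm // invr_ge0.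
Qed.

(** Counting functions are right-continuous step functions, so a large gap is already seen at a
    rational point; the event thus becomes a countable union. *)
Lemma dKS_gtP {N : nat} (T T' : 'M[R]_N) (c : R) : (0 < N)%N ->
  T \is symmetricmx -> T' \is symmetricmx ->
  (c%:E < dKS (esd T) (esd T'))%E <->
  exists q : rat, c * N%:R < `|eig_count T (ratr q) - eig_count T' (ratr q)|.
Proof.
move=> N0 sT sT'; have N0' : 0 < N%:R :> R by rewrite ltr0n.
have E (x : R) : `|esd T `]-oo, x]%classic - esd T' `]-oo, x]%classic|%E
    = (`|eig_count T x - eig_count T' x| / N%:R)%:E.
  exact: abse_esd_ray.
split=> [|[q h]]; last first.
  apply: (@lt_le_trans _ _ `|esd T `]-oo, ratr q]%classic - esd T' `]-oo, ratr q]%classic|%E).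
    by rewrite E lte_fin ltr_pdivlMr.
  by apply: ereal_sup_ubound; exists (ratr q).
move=> /ereal_sup_gt[_ [x ->]]; rewrite E lte_fin ltr_pdivlMr // => h.
have [k [/= h1 h2]] := @filter_ex _ _ _ _
  (filterI (eventually_gap x (eigenvalues T)) (eventually_gap x (eigenvalues T'))).
have k0 : x < x + k.+1%:R^-1 by rewrite ltrDl invr_gt0.
have [q] := rat_in_itvoo k0; rewrite in_itv /= => /andP[xq qk].
have cE (s : seq R) : (forall l, l \in s -> l <= x \/ x + k.+1%:R^-1 <= l) ->
    count (<= ratr q) s = count (<= x) s.
  move=> hs; apply: eq_in_count => l /hs [lx|lk] /=.
    by rewrite lx (le_trans lx (ltW xq)).
  by rewrite !leNgt (lt_le_trans qk lk) (lt_le_trans k0 lk).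
by exists q; rewrite /eig_count !cE.
Qed.

Lemma dKS_le_count {N : nat} (T T' : 'M[R]_N) (c : R) : (0 < N)%N ->
  T \is symmetricmx -> T' \is symmetricmx ->
  (dKS (esd T) (esd T') <= c%:E)%E ->
  forall x, `|eig_count T x - eig_count T' x| <= c * N%:R.
Proof.
move=> N0 sT sT' h x; have N0' : 0 < N%:R :> R by rewrite ltr0n.
rewrite -ler_pdivrMr // -lee_fin; apply: le_trans h.
apply: ereal_sup_ubound; exists x.
by rewrite abse_esd_ray.
Qed.

Lemma measurable_dKS_gt d (Omega : measurableType d) (N : nat)
    (H H' : Omega -> 'M[R]_N) (c : R) : (0 < N)%N ->
  trace_measurable H -> trace_measurable H' ->
  measurable [set w | (c%:E < dKS (esd (H w)) (esd (H' w)))%E].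
Proof.
move=> N0 mH mH'.
rewrite (_ : [set w | _] = \bigcup_(q : rat)
   ((fun w => `|eig_count (H w) (ratr q) - eig_count (H' w) (ratr q)|)
      @^-1` `]c * N%:R, +oo[)).
  apply: bigcupT_measurable_rat => q; rewrite -[X in measurable X]setTI.
  have : measurable_fun setT
      (fun w => `|eig_count (H w) (ratr q) - eig_count (H' w) (ratr q)|).
    by apply: measurableT_comp => //; apply: measurable_funB;
      apply: measurable_eig_count.
  by apply => //; exact: measurable_itv.
have [sH _] := mH; have [sH' _] := mH'.
apply/seteqP; split => [w /= /dKS_gtP[] // q h|w [q _ /=]].
  by exists q => //=; rewrite in_itv /= andbT.
by rewrite in_itv /= andbT => h; apply/dKS_gtP => //; exists q.
Qed.

(** The shift leaves at most [k] terms of each sum unmatched, and each pair of them costs at most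
    [b - a]. *)
Lemma sum_shift_le (n k : nat) (u v : nat -> R) (a b : R) : a <= b ->
  (forall i, a <= v i) -> (forall i, u i <= b) ->
  (forall i, (i + k < n)%N -> u i <= v (i + k)%N) ->
  \sum_(i < n) u i <= \sum_(i < n) v i + k%:R * (b - a).
Proof.
move=> ab va ub uv.
rewrite -!(big_mkord xpredT).
have [kn|nk] := leqP k n; last first.
  have h1 : \sum_(0 <= i < n) u i <= \sum_(0 <= i < n) b by apply: ler_sum.
  have h2 : \sum_(0 <= i < n) a <= \sum_(0 <= i < n) v i by apply: ler_sum.
  rewrite sumr_const_nat subn0 -[b *+ _]mulr_natl in h1.
  rewrite sumr_const_nat subn0 -[a *+ _]mulr_natl in h2.
  have h3 : n%:R * (b - a) <= k%:R * (b - a).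
    by rewrite ler_wpM2r ?subr_ge0 // ler_nat ltnW.
  lra.
rewrite (@big_cat_nat _ _ _ (n - k)%N) ?leq_subr //=.
rewrite (@big_cat_nat _ _ _ k 0 n) //=.
have h2 : \sum_(0 <= i < k) a <= \sum_(0 <= i < k) v i by apply: ler_sum.
have h1 : \sum_(n - k <= i < n) u i <= \sum_(n - k <= i < n) b by apply: ler_sum.
rewrite sumr_const_nat subKn // -[b *+ _]mulr_natl in h1.
rewrite sumr_const_nat subn0 -[a *+ _]mulr_natl in h2.
have h3 : \sum_(0 <= i < n - k) u i <= \sum_(k <= i < n) v i.
  have -> : \sum_(k <= i < n) v i = \sum_(0 <= i < n - k) v (i + k)%N.
    by rewrite -{1}[k]add0n big_addn.
  by apply: ler_sum_nat => i /andP[_ i1]; apply: uv; rewrite addnC -ltn_subRL.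
lra.
Qed.

(** Counting functions within [c * N] of each other shift the ordered eigenvalues by at most the
    integer part [k] of [c * N]: the [i]-th one of [T] is at most the [(i + k)]-th one of [T']. *)
Lemma monotone_trace_fun_KS {N : nat} (T T' : 'M[R]_N) (f : R -> R) (a b c : R) :
  (0 < N)%N -> T \is symmetricmx -> T' \is symmetricmx -> 0 <= c ->
  (forall x, `|eig_count T x - eig_count T' x| <= c * N%:R) ->
  {homo f : x y / x <= y} -> (forall x, a <= f x <= b) ->
  trace_fun f T <= trace_fun f T' + c * N%:R * (b - a).
Proof.
move=> N0 sT sT' c0 hc hf fab.
have ab : a <= b by have /andP[h1 h2] := fab 0; exact: le_trans h2.
have cN0 : 0 <= c * N%:R by rewrite mulr_ge0.
pose k := Num.truncn (c * N%:R).
rewrite !trace_fun_eig //.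
apply: (@le_trans _ _ (\sum_(i < N) f (eig T' i) + k%:R * (b - a))); last first.
  by rewrite lerD2l ler_wpM2r ?subr_ge0 // truncn_le.
apply: (@sum_shift_le N k (fun i => f (eig T i)) (fun i => f (eig T' i))) => //.
- by move=> i; case/andP: (fab (eig T' i)).
- by move=> i; case/andP: (fab (eig T i)).
move=> i ikN; apply: hf.
have iN : (i < N)%N by apply: leq_ltn_trans ikN; exact: leq_addr.
rewrite eig_le_count //; set x := eig T' _.
have : (eig T' (i + k)%N <= x) by [].
rewrite eig_le_count // => h.
(* The counts at [x] differ by less than [k + 1], whereas [T'] has at least [i + k + 1] eigenvalues
   up to [x] and [T] is supposed to have at most [i]. *)
rewrite ltnNge; apply/negP => h'.
have := hc x; rewrite distrC ler_norml => /andP[_].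
rewrite /eig_count; apply/negP; rewrite -ltNge.
have /andP[_ kc] := truncn_itv cN0; apply: lt_le_trans kc _.
rewrite -/k lerBrDr -natrD ler_nat.
by apply: leq_trans h; rewrite -addnS addnC leq_add2r.
Qed.

(** The truncated logarithm is not monotone; it is split at 0 into a nondecreasing and a
    nonincreasing function, whence the factor 2. *)
Lemma trunc_log_KS {N : nat} (T T' : 'M[R]_N) (a b c : R) :
  (0 < N)%N -> T \is symmetricmx -> T' \is symmetricmx -> 0 <= c ->
  (forall x, `|eig_count T x - eig_count T' x| <= c * N%:R) -> 0 < a -> a <= b ->
  trace_fun (trunc_log a b) T
    <= trace_fun (trunc_log a b) T' + 2 * c * N%:R * (ln b - ln a).
Proof.
move=> N0 sT sT' c0 hc a0 ab.
pose f1 x := ln (clamp a b (Num.max 0 x)).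
pose f2 x := ln (clamp a b (Num.max 0 (- x))).
have fE x : trunc_log a b x = f1 x + f2 x - ln a.
  rewrite /trunc_log /f1 /f2.
  have c0a : clamp a b 0 = a by rewrite /clamp; apply/max_idPl; rewrite ge_min ltW.
  have [x0|x0] := leP 0 x.
    rewrite (max_idPl _) ?oppr_le0 // c0a addrK ger0_norm //.
  rewrite (max_idPr _) ?oppr_ge0 ?ltW // c0a addrC addKr ltr0_norm //.
have TE (S : 'M[R]_N) : S \is symmetricmx -> trace_fun (trunc_log a b) S
   = trace_fun f1 S + trace_fun f2 S - N%:R * ln a.
  move=> sS; rewrite !trace_fun_eig // -big_split /= mulr_natl -[X in _ *+ X](card_ord N).
  rewrite -sumr_const -sumrB; apply: eq_bigr => i _; exact: fE.
have fb x : ln a <= ln (clamp a b x) <= ln b.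
  by rewrite !ler_ln ?posrE ?clamp_gt0 ?clamp_ge ?clamp_le // (lt_le_trans a0).
have mono x y : x <= y -> ln (clamp a b x) <= ln (clamp a b y).
  by move=> /(ln_clamp_sub a0 ab)/andP[]; rewrite subr_ge0.
have h1 : trace_fun f1 T <= trace_fun f1 T' + c * N%:R * (ln b - ln a).
  apply: monotone_trace_fun_KS => //; last by move=> x; exact: fb.
  by move=> x y xy; apply: mono; rewrite ge_max !le_max lexx xy orbT.
have h2 : trace_fun (fun x => - f2 x) T'
    <= trace_fun (fun x => - f2 x) T + c * N%:R * (- ln a - - ln b).
  apply: monotone_trace_fun_KS => //.
  - by move=> x; rewrite distrC.
  - by move=> x y xy; rewrite lerN2; apply: mono; rewrite ge_max !le_max lexx lerN2 xy orbT.
  - by move=> x; rewrite !lerN2 andbC; exact: fb.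
have NE (S : 'M[R]_N) : trace_fun (fun x => - f2 x) S = - trace_fun f2 S.
  by rewrite /trace_fun sumrN.
rewrite !NE in h2; rewrite !TE //.
have -> : 2 * c * N%:R * (ln b - ln a)
  = c * N%:R * (ln b - ln a) + c * N%:R * (- ln a - - ln b) by ring.
lra.
Qed.

Lemma trunc_log_KS_dist {N : nat} (T T' : 'M[R]_N) (a b c : R) :
  (0 < N)%N -> T \is symmetricmx -> T' \is symmetricmx -> 0 <= c ->
  (dKS (esd T) (esd T') <= c%:E)%E -> 0 < a -> a <= b ->
  `|trace_fun (trunc_log a b) T - trace_fun (trunc_log a b) T'|
    <= 2 * c * N%:R * (ln b - ln a).
Proof.
move=> N0 sT sT' c0 /(dKS_le_count N0 sT sT') hc a0 ab.
have hc' x : `|eig_count T' x - eig_count T x| <= c * N%:R by rewrite distrC.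
have := trunc_log_KS N0 sT sT' c0 hc a0 ab.
have := trunc_log_KS N0 sT' sT c0 hc' a0 ab.
by rewrite ler_distl; lra.
Qed.
End KolmogorovSmirnov.

(** * The mean spectral measure and bounded Lipschitz test functions *)

Section MeanSpectralMeasure.
Context {R : realType}.
Local Open Scope ereal_scope.

Import HBNNSimple.

(** The integral is built from simple functions and sees the set function only on measurable sets.
    This moves integrals against the bare set function [mean_esd] to a genuine measure. *)
Lemma eq_set_function_integral d (T : measurableType d) (m1 m2 : set T -> \bar R)
    (f : T -> \bar R) :
  (forall A, measurable A -> m1 A = m2 A) -> \int[m1]_x f x = \int[m2]_x f x.
Proof.
move=> m12; have E (h : {nnsfun T >-> R}) : sintegral m1 h = sintegral m2 h.
  rewrite /sintegral; apply: eq_fsbigr => r _; congr (_ * _); apply: m12.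
  by rewrite -[X in measurable X]setTI; apply: measurable_funP.
rewrite /integral; congr (ereal_sup _ - ereal_sup _);
  by apply/seteqP; split => _ [h hf <-]; exists h.
Qed.

Lemma bounded_integrable d (T : measurableType d) (P : {finite_measure set T -> \bar R})
    (f : T -> R) (S : R) :
  measurable_fun setT f -> (forall x, (`|f x| <= S)%R) -> P.-integrable setT (EFin \o f).
Proof.
move=> mf fS; apply: measurable_bounded_integrable => //.
  by rewrite ltey_eq fin_num_measure.
exists S; split; first exact: num_real.
by move=> M SM x _ /=; apply: le_trans (fS x) (ltW SM).
Qed.

Lemma integral_cst_probability d (T : measurableType d) (P : probability T R) (r : R) :
  \int[P]_x r%:E = r%:E.
Proof.
rewrite integral_cst // -[RHS]mule1; congr (_ * _); exact: probability_setT.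
Qed.

Context {d} {Omega : measurableType d} {P : probability Omega R}.
Context {N : nat} (H : Omega -> 'M[R]_N) (mH : trace_measurable H) (N0 : (0 < N)%N).

Let eig_mfun i : (fun w => eig (H w) i) \in mfun.
Proof. by apply: mem_set; exact: measurable_eig. Qed.

Let eigf (i : nat) : {RV P >-> R} := mfun_Sub (eig_mfun i).

(** The average of the laws of the ordered eigenvalues, a measure by construction, standing in for
    [mean_esd]. *)
Definition mean_spectral_measure : set R -> \bar R :=
  mscale ((N%:R^-1 : R)%:nng)%R (msum (fun i => distribution P (eigf i)) N).

HB.instance Definition _ := Measure.on mean_spectral_measure.

Lemma mean_spectral_measure_ge0 (f : R -> \bar R) : (forall x, 0 <= f x) ->
  measurable_fun setT f ->
  \int[mean_spectral_measure]_x f x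
    = (N%:R^-1)%R%:E * \sum_(i < N) \int[P]_w f (eig (H w) i).
Proof.
move=> f0 mf; rewrite /mean_spectral_measure ge0_integral_mscale //.
rewrite ge0_integral_measure_sum //; congr (_ * _); apply: eq_bigr => i _.
by rewrite ge0_integral_distribution.
Qed.

Lemma mean_esdE A : measurable A -> mean_esd P H A = mean_spectral_measure A.
Proof.
move=> mA; have [sH _] := mH.
have -> : mean_spectral_measure A = \int[mean_spectral_measure]_x (\1_A x)%:E.
  by rewrite integral_indic // setIT.
rewrite mean_spectral_measure_ge0; [|by move=> x; rewrite lee_fin|]; last first.
  by apply/measurable_EFinP; exact: measurable_indic.
rewrite /mean_esd.
transitivity (\int[P]_w ((N%:R^-1)%R%:E * \sum_(i < N) (\1_A (eig (H w) i))%:E)).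
  by apply: eq_integral => w _; rewrite /esd /= /mscale /= /msum.
have mi i : measurable_fun setT (fun w => (\1_A (eig (H w) i) : R)%:E).
  by apply/measurable_EFinP; apply: measurableT_comp;
    [exact: measurable_indic|exact: measurable_eig].
have i0 i w : 0 <= (\1_A (eig (H w) i) : R)%:E by rewrite lee_fin.
rewrite (@ge0_integralZl _ _ _ P setT measurableT
  (fun w => \sum_(i < N) (\1_A (eig (H w) i))%:E)); last 3 first.
- exact: emeasurable_sum.
- by move=> w _; apply: sume_ge0 => i _; exact: i0.
- by rewrite lee_fin invr_ge0.
by rewrite ge0_integral_sum.
Qed.

Lemma mean_spectral_measure_setT : mean_spectral_measure setT = 1.
Proof.
have := mean_spectral_measure_ge0 (fun=> lee01) (@measurable_cst _ _ _ _ setT (1 : \bar R)).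
rewrite integral_cst // mul1e => ->.
under eq_bigr do rewrite integral_cst_probability.
rewrite sumr_const card_ord -[X in _ * X]mule_natl mule1 -EFinM mulVf //.
by rewrite pnatr_eq0 -lt0n.
Qed.

HB.instance Definition _ := @Measure_isProbability.Build _ _ _
  mean_spectral_measure mean_spectral_measure_setT.

Let nu : probability R R := mean_spectral_measure.

Lemma avg_trace_fun_le (g : R -> R) (C : R) w : (forall x, (`|g x| <= C)%R) ->
  (`|N%:R^-1 * trace_fun g (H w)| <= C)%R.
Proof.
have [sH _] := mH => gC; rewrite trace_fun_eig // normrM ger0_norm ?invr_ge0 //.
rewrite ler_pdivrMl ?ltr0n //; apply: le_trans (ler_norm_sum _ _ _) _.
apply: (@le_trans _ _ (\sum_(i < N) C)%R); first by apply: ler_sum.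
by rewrite sumr_const card_ord mulr_natl.
Qed.

(** Adding the bound [S] reduces the claim to nonnegative functions, for which sums and integrals
    exchange freely. *)
Lemma mean_esd_integral (f : R -> R) (S : R) :
  measurable_fun setT f -> (forall x, (`|f x| <= S)%R) ->
  \int[mean_esd P H]_x (f x)%:E = \int[P]_w ((N%:R^-1 * trace_fun f (H w))%R)%:E.
Proof.
move=> mf fS; have [sH _] := mH.
have S0 : (0 <= S)%R by apply: le_trans (fS 0%R).
rewrite (@eq_set_function_integral _ _ (mean_esd P H) nu); last exact: mean_esdE.
have shift : (forall x, 0 <= f x + S)%R.
  by move=> x; rewrite -lerBlDr sub0r; have := fS x; rewrite ler_norml => /andP[].
have mfS : measurable_fun setT (fun x => f x + S)%R by exact: measurable_funD.
have e1 : \int[nu]_x (f x + S)%:E = \int[nu]_x (f x)%:E + S%:E.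
  under eq_integral do rewrite EFinD.
  rewrite integralD //.
  - by rewrite integral_cst_probability.
  - exact: (@bounded_integrable _ _ nu f S mf fS).
  - by apply: (@bounded_integrable _ _ nu (cst S) S) => // x; rewrite ger0_norm.
have mtf : measurable_fun setT (fun w => N%:R^-1 * trace_fun f (H w))%R.
  by apply: measurable_funM => //; exact: measurable_trace_fun.
have e2 : \int[nu]_x (f x + S)%:E
    = \int[P]_w ((N%:R^-1 * trace_fun f (H w))%R)%:E + S%:E.
  rewrite mean_spectral_measure_ge0; last 2 first.
  - by move=> x; rewrite lee_fin.
  - exact/measurable_EFinP.
  have mi i : measurable_fun setT (fun w => (f (eig (H w) i) + S)%:E).
    by apply/measurable_EFinP; exact: (measurableT_comp mfS (measurable_eig mH i)).
  have i0 i w : setT w -> 0 <= (f (eig (H w) i) + S)%:E by rewrite lee_fin.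
  rewrite -(@ge0_integral_sum _ _ _ P _ measurableT _
    (fun (i : 'I_N) w => (f (eig (H w) i) + S)%:E)
    (fun i => mi i) (fun i => i0 i)).
  rewrite -(@ge0_integralZl _ _ _ P setT measurableT
    (fun w => \sum_(i < N) (f (eig (H w) i) + S)%:E)); last 3 first.
  - exact: emeasurable_sum.
  - by move=> w _; apply: sume_ge0 => i _; exact: i0.
  - by rewrite lee_fin invr_ge0.
  transitivity (\int[P]_w ((N%:R^-1 * trace_fun f (H w))%R%:E + S%:E)).
    apply: eq_integral => w _; rewrite sumEFin -EFinM trace_fun_eig // -EFinD.
    congr EFin; rewrite big_split /= mulrDr sumr_const card_ord -[(S *+ N)%R]mulr_natl.
    by rewrite mulKf // pnatr_eq0 -lt0n.
  rewrite integralD //.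
  - by rewrite integral_cst_probability.
  - by apply: (@bounded_integrable _ _ P _ S mtf) => w; exact: avg_trace_fun_le.
  - by apply: (@bounded_integrable _ _ P (cst S) S) => // x; rewrite ger0_norm.
by move: e1; rewrite e2 => /(congr1 (fun x => x - S%:E)); rewrite !addeK.
Qed.

Lemma Lnorm_oo_le (f : R -> R) (S : R) : (forall x, (`|f x| <= S)%R) ->
  'N[lebesgue_measure]_+oo [EFin \o f] <= S%:E.
Proof.
move=> fS; rewrite unlock /=; case: ifP => _; last first.
  by rewrite lee_fin (le_trans _ (fS 0%R)).
by apply/ess_supP; apply: aeW => x /=; rewrite lee_fin.
Qed.

Lemma Lip_norm_le (f : R -> R) (L : R) : lipschitz_fun L f ->
  Lip_norm (fun x : R => `|x|%R) (fun x : R => `|x|%R) f <= L%:E.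
Proof.
move=> lf; apply: ge_ereal_sup => _ [x [y [xy ->]]].
by rewrite lee_fin ler_pdivrMr ?normr_gt0 ?subr_eq0.
Qed.

(** After division by [L + S] the function is admissible in the supremum. *)
Lemma dBL_test (mu : probability R R) (f : R -> R) (L S c : R) :
  dBL (mean_esd P H) mu <= c%:E -> measurable_fun setT f ->
  lipschitz_fun L f -> (forall x, (`|f x| <= S)%R) -> (0 < L)%R ->
  (`| \int[P]_w (N%:R^-1 * trace_fun f (H w)) - \int[mu]_x f x | <= (L + S) * c)%R.
Proof.
move=> hd mf lf fS L0; have [sH _] := mH.
have S0 : (0 <= S)%R by apply: le_trans (fS 0%R).
have LS : (0 < L + S)%R by rewrite ltr_wpDr.
pose g x := ((L + S)^-1 * f x)%R.
have mg : measurable_fun setT g by exact: measurable_funM.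
have gE x : (`|g x| = (L + S)^-1 * `|f x|)%R.
  by rewrite /g normrM ger0_norm // invr_ge0 ltW.
have gS x : (`|g x| <= (L + S)^-1 * S)%R.
  by rewrite gE ler_wpM2l // invr_ge0 ltW.
have lg : lipschitz_fun ((L + S)^-1 * L)%R g.
  move=> x y; rewrite /g -mulrBr normrM ger0_norm ?invr_ge0 ?(ltW LS) //.
  by rewrite -mulrA ler_wpM2l ?invr_ge0 ?(ltW LS).
have := mean_esd_integral mg gS => EI.
have : `| \int[mean_esd P H]_x (g x)%:E - \int[mu]_x (g x)%:E | <= c%:E.
  apply: le_trans hd; apply: ereal_sup_ubound; exists g; split => //.
  apply: (@le_trans _ _ (((L + S)^-1 * L)%R%:E + ((L + S)^-1 * S)%R%:E)).
    by apply: leeD; [exact: Lip_norm_le|exact: Lnorm_oo_le].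
  by rewrite -EFinD lee_fin -mulrDr mulVf // gt_eqF.
have iP (h : R -> R) C : measurable_fun setT h -> (forall x, (`|h x| <= C)%R) ->
    P.-integrable setT (EFin \o (fun w => N%:R^-1 * trace_fun h (H w))%R).
  move=> mh hC; apply: (@bounded_integrable _ _ P _ C) => [|w].
    by apply: measurable_funM => //; exact: measurable_trace_fun.
  exact: avg_trace_fun_le.
have iM (h : R -> R) C : measurable_fun setT h -> (forall x, (`|h x| <= C)%R) ->
    mu.-integrable setT (EFin \o h).
  by move=> mh hC; exact: (@bounded_integrable _ _ mu h C).
have e1 : \int[P]_w ((N%:R^-1 * trace_fun g (H w))%R)%:E
    = ((L + S)^-1 * \int[P]_w (N%:R^-1 * trace_fun f (H w)))%R%:E.
  rewrite EFinM /Rintegral fineK; last by apply: integrable_fin_num => //; exact: (iP f S).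
  rewrite -integralZl //; last exact: (iP f S).
  apply: eq_integral => w _; rewrite -EFinM; congr EFin; rewrite mulrCA; congr (_ * _)%R.
  by rewrite /trace_fun mulr_sumr.
have e2 : \int[mu]_x (g x)%:E = ((L + S)^-1 * \int[mu]_x f x)%R%:E.
  rewrite EFinM /Rintegral fineK; last by apply: integrable_fin_num => //; exact: (iM f S).
  by rewrite -integralZl //; exact: (iM f S).
rewrite EI e1 e2 -EFinB -mulrBr lee_fin normrM ger0_norm ?invr_ge0 ?(ltW LS) //.
by rewrite ler_pdivrMl.
Qed.

End MeanSpectralMeasure.

(** * The limit measures near the origin *)

Section SmallBall.
Context {R : realType}.

Definition annulus (s r : R) : set R := [set x | s <= `|x| < r].

Lemma measurable_annulus s r : measurable (annulus s r).
Proof.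
rewrite (_ : annulus s r = (fun x => `|x|) @^-1` `[s, r[).
  by rewrite -[X in measurable X]setTI; apply: normr_measurable => //; exact: measurable_itv.
by apply/seteqP; split => x /=; rewrite in_itv.
Qed.

(** Replacing [kappa] by [a <= 1] makes the exponent nonpositive even when [kappa > 1], so the power
    is largest at the inner radius [s]. *)
Lemma powR_density_bound (kappa a s x : R) : 0 < s -> s <= `|x| -> `|x| <= 1 ->
  a <= kappa -> a <= 1 -> `|x| `^ (- 1 + kappa) <= s `^ (a - 1).
Proof.
move=> s0 sx x1 ak a1; have x0 : 0 < `|x| by exact: lt_le_trans sx.
apply: (@le_trans _ _ (`|x| `^ (a - 1))).
  by apply: ger_powR; rewrite ?x0 ?x1 // addrC lerD2l.
rewrite -opprB !powRN lef_pV2 ?posrE ?powR_gt0 //.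
by apply: ge0_ler_powR; rewrite ?subr_ge0 ?nnegrE // ltW.
Qed.

Context (mu : probability R R) (kappa : R) (rho : R -> R).
Hypothesis kappa0 : 0 < kappa.
Hypothesis mu_rho : has_density_on mu `]- kappa, kappa[ rho.
Hypothesis rho_le : forall x : R, 0 < `|x| < kappa ->
  rho x < kappa^-1 * `|x| `^ (- 1 + kappa).

Let a : R := Num.min kappa 1.

Let a0 : 0 < a. Proof. by rewrite /a lt_min kappa0 ltr01. Qed.
Let a1 : a <= 1. Proof. by rewrite /a ge_min lexx orbT. Qed.
Let ak : a <= kappa. Proof. by rewrite /a ge_min lexx. Qed.

Lemma mu_set0 : mu [set 0] = 0%E.
Proof.
have [_ _ h] := mu_rho; rewrite h //; last first.
  by move=> x ->; rewrite /= in_itv /= oppr_lt0 kappa0.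
by rewrite integral_set1.
Qed.

(** The density bound at the inner radius [r / 2], times the length [2 * r] of the surrounding
    interval. *)
Lemma mu_annulus_le (r : R) : 0 < r -> r <= a ->
  (mu (annulus (r / 2) r) <= (4 / kappa * r `^ a)%:E)%E.
Proof.
move=> r0 ra; have [mrho rho0 h] := mu_rho.
have sub : annulus (r / 2) r `<=` `]- kappa, kappa[.
  move=> x /andP[_ xr]; rewrite /= in_itv /= -ltr_norml.
  by rewrite (lt_le_trans xr) // (le_trans ra).
have r20 : 0 < r / 2 by rewrite divr_gt0.
rewrite h //; last exact: measurable_annulus.
pose M : R := kappa^-1 * (r / 2) `^ (a - 1).
apply: (@le_trans _ _ (\int[lebesgue_measure]_(x in annulus (r / 2) r) (cst M%:E x))%E).
  apply: ge0_le_integral => //.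
  - exact: measurable_annulus.
  - by move=> x /sub /rho0; rewrite lee_fin.
  - apply/measurable_EFinP; apply: measurable_funS mrho => //; exact: measurable_itv.
  - move=> x /[dup] /sub; rewrite /= in_itv /= -ltr_norml => xk /andP[rx xr].
    have x0 : 0 < `|x| by exact: lt_le_trans rx.
    rewrite lee_fin ltW //; apply: (@lt_le_trans _ _ (kappa^-1 * `|x| `^ (- 1 + kappa))).
      by apply: rho_le; rewrite x0.
    rewrite ler_wpM2l ?invr_ge0 ?(ltW kappa0) //; apply: powR_density_bound => //.
    by rewrite (le_trans (ltW xr)) // (le_trans ra).
have M0 : 0 <= M by rewrite mulr_ge0 ?invr_ge0 ?powR_ge0 // ltW.
rewrite integral_cst; last exact: measurable_annulus.
have lA : (lebesgue_measure (annulus (r / 2) r) <= (2 * r)%:E)%E.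
  have := @lebesgue_measure_itv R `]- r, r[; rewrite /= lte_fin gtrN // -EFinD opprK.
  have -> : 2 * r = r + r by ring.
  move=> <-.
  apply: le_measure; rewrite ?inE; [exact: measurable_annulus|exact: measurable_itv|].
  by move=> x /andP[_ xr]; rewrite /= in_itv /= -ltr_norml.
apply: (le_trans (lee_wpmul2l _ lA)); first by rewrite lee_fin.
rewrite -EFinM lee_fin /M.
have e : (r / 2) `^ (a - 1) * (r / 2) = (r / 2) `^ a.
  rewrite -{2}(powRr1 (ltW r20)) -powRD ?subrK //.
  by apply/implyP => _; rewrite gt_eqF.
have -> : kappa^-1 * (r / 2) `^ (a - 1) * (2 * r)
   = 4 / kappa * ((r / 2) `^ (a - 1) * (r / 2)) by field; rewrite gt_eqF.
rewrite e ler_wpM2l ?divr_ge0 ?(ltW kappa0) //.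
by apply: ge0_ler_powR; rewrite ?nnegrE ?(ltW a0) ?(ltW r20) ?(ltW r0) //; lra.
Qed.

(** The constant of one annulus summed over dyadic radii, a geometric series of ratio
    [2 ^ (- a)]. *)
Definition ball_constant : R := 4 / kappa / (1 - 2^-1 `^ a).

Lemma half_powR_lt1 : 2^-1 `^ a < 1 :> R.
Proof.
rewrite [ltRHS](_ : 1 = 1 `^ a); last by rewrite powR1.
by apply: gt0_ltr_powR; rewrite ?nnegrE ?invr_ge0 // invf_lt1 ?ltr1n.
Qed.

Lemma ball_constant_ge0 : 0 <= ball_constant.
Proof.
apply: divr_ge0; first by rewrite divr_ge0 // ltW.
by rewrite subr_ge0 ltW // half_powR_lt1.
Qed.

Lemma mu_ball_le (r : R) : 0 < r -> r <= a ->
  (mu [set x : R | (`|x| < r)%R] <= (ball_constant * r `^ a)%:E)%E.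
Proof.
move=> r0 ra; pose B n := [set x : R | `|x| < r / 2 ^+ n].
have rn n : 0 < r / 2 ^+ n by rewrite divr_gt0 // exprn_gt0.
have rna n : r / 2 ^+ n <= a.
  apply: le_trans ra; rewrite ler_pdivrMr ?exprn_gt0 // ler_peMr ?(ltW r0) //.
  by rewrite exprn_ege1 // ler1n.
have mB n : measurable (B n).
  rewrite (_ : B n = annulus 0 (r / 2 ^+ n)); first exact: measurable_annulus.
  by apply/seteqP; split => x; rewrite /B /annulus /= normr_ge0.
pose C := ball_constant.
(* Telescoped form of the dyadic sum; the mass not yet accounted for is that of balls shrinking to
   the null set [{0}]. *)
have step n : (mu [set x : R | (`|x| < r)%R] <= mu (B n) + (C * r `^ a - C * (r / 2 ^+ n) `^ a)%:E)%E.
  elim: n => [|n IH].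
    by rewrite /B expr0 divr1 subrr adde0.
  apply: (le_trans IH).
  have BU : B n = B n.+1 `|` annulus (r / 2 ^+ n / 2) (r / 2 ^+ n).
    have E : r / 2 ^+ n.+1 = r / 2 ^+ n / 2 by rewrite exprS invfM mulrA mulrAC.
    apply/seteqP; split => x; rewrite /B /annulus /= E.
      by move=> xr; have [h|h] := ltP `|x| (r / 2 ^+ n / 2); [left|right; rewrite xr].
    case=> [xr|/andP[//]]; apply: (lt_trans xr).
    by rewrite ltr_pdivrMr // ltr_pMr // ltr1n.
  apply: (@le_trans _ _ (mu (B n.+1) + (4 / kappa * (r / 2 ^+ n) `^ a)%:E
      + (C * r `^ a - C * (r / 2 ^+ n) `^ a)%:E)%E).
    rewrite leeD2r // {1}BU; apply: le_trans (measureU2 _ _ _) _ => //.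
      exact: measurable_annulus.
    by rewrite leeD2l // mu_annulus_le.
  rewrite -addeA leeD2l // -EFinD lee_fin.
  have -> : (r / 2 ^+ n.+1) `^ a = 2^-1 `^ a * (r / 2 ^+ n) `^ a.
    by rewrite -powRM ?invr_ge0 ?(ltW (rn n)) //; congr (_ `^ _); rewrite exprS invfM mulrCA.
  have := half_powR_lt1; set q := 2^-1 `^ a => q1.
  rewrite /C /ball_constant -/q; set z := (r / 2 ^+ n) `^ a.
  rewrite le_eqVlt; apply/orP; left; apply/eqP; field.
  by rewrite (gt_eqF kappa0) ?andbT /= subr_eq0 eq_sym lt_eqF.
have cB : mu (B n) @[n --> \oo] --> 0%E.
  have <- : mu (\bigcap_n B n) = 0%E.
    rewrite -mu_set0; congr (mu _); apply/seteqP; split => x; last first.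
      by move=> -> n _; rewrite /B /= normr0.
    move=> Bx; apply/eqP/negPn/negP => x0.
    have xr0 : 0 < `|x| / r by rewrite divr_gt0 // normr_gt0.
    have [n /= hn] := @filter_ex _ _ _ _ (near_infty_natSinv_expn_lt (PosNum xr0)).
    have := Bx n Logic.I; rewrite /B /= ltNge => /negP; apply.
    move: hn; rewrite ltr_pdivlMr // mulrC => /ltW; apply: le_trans.
    by rewrite mul1r.
  apply: nonincreasing_cvg_mu => //.
  - by rewrite ltey_eq fin_num_measure.
  - exact: bigcapT_measurable.
  - apply/nonincreasing_seqP => n; apply/subsetPset => x; rewrite /B /= => xr.
    apply: (lt_trans xr); rewrite exprS invfM mulrCA gtr_pMl ?rn //.
    by rewrite invf_lt1 ?ltr1n.
have cc : (mu (B n) + (C * r `^ a)%:E)%E @[n --> \oo] --> (0 + (C * r `^ a)%:E)%E.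
  by apply: cvgeD => //; exact: cvg_cst.
rewrite add0e in cc; apply: (cvge_to_ge cc).
apply: nearW => n; apply: le_trans (step n) _; rewrite leeD2l // lee_fin gerBl.
by rewrite mulr_ge0 ?ball_constant_ge0 ?powR_ge0.
Qed.
End SmallBall.

(** * The logarithmic singularity *)

Section LogIntegral.
Context {R : realType} (mu : probability R R) (a C B : R).
Hypotheses (a0 : 0 < a) (a1 : a <= 1) (C0 : 0 <= C).
Hypothesis mu_ball : forall r : R, 0 < r -> r <= a ->
  (mu [set x : R | (`|x| < r)%R] <= (C * r `^ a)%:E)%E.
Hypothesis mu_zero : mu [set 0] = 0%E.
Hypothesis mu_far : mu [set x : R | (B < `|x|)%R] = 0%E.

Definition log_constant : R := ln 2 * C / (1 - 2^-1 `^ a).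

Lemma measurable_ball (r : R) : measurable [set x : R | `|x| < r].
Proof.
rewrite (_ : [set _ | _] = annulus 0 r); first exact: measurable_annulus.
by apply/seteqP; split => x; rewrite /annulus /= normr_ge0.
Qed.

(** What truncation at [e] adds to [ln |x|]. At 0, where [ln 0 = 0] by convention, it vanishes for
    [e <= 1]; that point carries no mass. *)
Definition log_deficit (e x : R) : R := Num.max 0 (ln e - ln `|x|).

Lemma measurable_log_deficit e : measurable_fun setT (log_deficit e).
Proof.
apply: measurable_maxr => //; apply: measurable_funB => //.
by apply: measurableT_comp; [exact: measurable_ln|exact: normr_measurable].
Qed.

(** A dyadic layer-cake bound: each halving of [|x|] below [e] costs at most [ln 2]. *)
Lemma log_deficit_partial_sum (e x : R) (n : nat) : 0 < e -> e / 2 ^+ n <= `|x| ->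
  log_deficit e x <= \sum_(k < n) ln 2 * \1_[set y : R | `|y| < e / 2 ^+ k] x.
Proof.
move=> e0; elim: n => [|n IH].
  rewrite expr0 divr1 big_ord0 => ex; rewrite /log_deficit ge_max lexx /=.
  by rewrite subr_le0 ler_ln ?posrE // (lt_le_trans e0).
have ln20 : 0 <= ln 2 :> R by rewrite ln_ge0 // ler1n.
move=> ex; have [h|h] := leP (e / 2 ^+ n) `|x|.
  rewrite big_ord_recr /= ler_wpDr ?IH // mulr_ge0 //.
have -> : \sum_(k < n.+1) ln 2 * \1_[set y : R | `|y| < e / 2 ^+ k] x = n.+1%:R * ln 2 :> R.
  rewrite mulr_natl -[in RHS](card_ord n.+1) -sumr_const; apply: eq_bigr => k _.
  rewrite indicE mem_set ?mulr1 //=; apply: (lt_le_trans h).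
  rewrite ler_pM2l // lef_pV2 ?posrE ?exprn_gt0 //.
  by rewrite ler_eXn2l ?ltr1n // -ltnS.
have x0 : 0 < `|x| by apply: lt_le_trans ex; rewrite divr_gt0 // exprn_gt0.
rewrite /log_deficit ge_max mulr_ge0 //= -ln_div ?posrE //.
have -> : n.+1%:R * ln 2 = ln (2 ^+ n.+1) :> R by rewrite lnXn // mulr_natl.
rewrite ler_ln ?posrE ?divr_gt0 ?exprn_gt0 //.
by rewrite ler_pdivrMr // mulrC -ler_pdivrMr ?exprn_gt0.
Qed.

(** Integrating the layers one by one with the small ball bound gives the geometric series behind
    [log_constant]. *)
Lemma integral_log_deficit_le (e : R) : 0 < e -> e <= a ->
  (\int[mu]_x (log_deficit e x)%:E <= (log_constant * e `^ a)%:E)%E.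
Proof.
move=> e0 ea.
have ln20 : 0 <= ln 2 :> R by rewrite ln_ge0 // ler1n.
pose u k x : \bar R := (ln 2 * \1_[set y : R | `|y| < e / 2 ^+ k] x)%:E.
have u0 k x : (0 <= u k x)%E by rewrite lee_fin mulr_ge0.
have mu_ k : measurable_fun setT (u k).
  apply/measurable_EFinP; apply: measurable_funM => //; apply: measurable_indic.
  exact: measurable_ball.
have q1 : 2^-1 `^ a < 1.
  rewrite [ltRHS](_ : 1 = 1 `^ a); last by rewrite powR1.
  by apply: gt0_ltr_powR; rewrite ?nnegrE ?invr_ge0 // invf_lt1 ?ltr1n.
apply: (@le_trans _ _ (\int[mu]_x (\sum_(k <oo) u k x))%E).
  apply: ge0_le_integral => //.
  - by move=> x _; rewrite lee_fin /log_deficit le_max lexx.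
  - by apply/measurable_EFinP; exact: measurable_log_deficit.
  - by apply: ge0_emeasurable_sum => // k x _ _; exact: u0.
  - move=> x _; have [->|x0] := eqVneq x 0.
      have -> : log_deficit e 0 = 0.
        rewrite /log_deficit normr0 (ln0 (lexx 0)) subr0; apply/max_idPl.
        by rewrite ln_le0 // (le_trans ea).
      by apply: nneseries_ge0 => k _ _; exact: u0.
    have x0' : 0 < `|x| / e by rewrite divr_gt0 // normr_gt0.
    have [n /= hn] := @filter_ex _ _ _ _ (near_infty_natSinv_expn_lt (PosNum x0')).
    have en : e / 2 ^+ n <= `|x|.
      by move: hn; rewrite ltr_pdivlMr // mulrC mul1r => /ltW.
    apply: (@le_trans _ _ (\sum_(0 <= k < n) u k x)%E); last first.
      by apply: nneseries_lim_ge => k _ _; exact: u0.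
    rewrite big_mkord sumEFin lee_fin; exact: log_deficit_partial_sum.
rewrite integral_nneseries //.
have Iu k : (\int[mu]_x u k x <= (ln 2 * C * e `^ a * (2^-1 `^ a) ^+ k)%:E)%E.
  rewrite /u; under eq_integral do rewrite EFinM.
  rewrite (@ge0_integralZl _ _ _ mu setT measurableT
    (fun x => (\1_[set y : R | `|y| < e / 2 ^+ k] x)%:E)); last 3 first.
  - by apply/measurable_EFinP; apply: measurable_indic; exact: measurable_ball.
  - by move=> x _; rewrite lee_fin.
  - by rewrite lee_fin.
  rewrite integral_indic ?setIT //; last exact: measurable_ball.
  have ek0 : 0 < e / 2 ^+ k by rewrite divr_gt0 // exprn_gt0.
  have eka : e / 2 ^+ k <= a.
    apply: le_trans ea; rewrite ler_pdivrMr ?exprn_gt0 // ler_peMr ?(ltW e0) //.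
    by rewrite exprn_ege1 // ler1n.
  apply: (le_trans (lee_wpmul2l _ (mu_ball ek0 eka))); first by rewrite lee_fin.
  rewrite -EFinM lee_fin -powR_mulrn ?powR_ge0 // -powRrM mulrC [a * _]mulrC powRrM.
  rewrite powR_mulrn ?invr_ge0 // exprVn powRM ?(ltW e0) ?invr_ge0 ?exprn_ge0 //.
  by rewrite le_eqVlt; apply/orP; left; apply/eqP; ring.
apply: lime_le.
  by apply: is_cvg_nneseries => k _ _; apply: integral_ge0.
apply: nearW => n; apply: (@le_trans _ _ (\sum_(0 <= k < n) (ln 2 * C * e `^ a * (2^-1 `^ a) ^+ k)%:E)%E).
  by apply: lee_sum.
rewrite sumEFin lee_fin -mulr_sumr /log_constant.
set q := 2^-1 `^ a in q1 *.
have q0 : 0 <= q by exact: powR_ge0.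
have : \sum_(0 <= k < n) q ^+ k <= (1 - q)^-1.
  rewrite -div1r ler_pdivlMr ?subr_gt0 // big_mkord mulrC.
  by rewrite -opprB mulNr -subrX1 opprB gerBl exprn_ge0.
rewrite mulrAC -mulrA [_ * e `^ a]mulrC => h.
have c0 : 0 <= ln 2 * C * e `^ a by rewrite !mulr_ge0 ?powR_ge0.
by have := ler_wpM2l c0 h; lra.
Qed.

Lemma measurable_trunc_log e b : measurable_fun setT (@trunc_log R e b).
Proof.
apply: measurableT_comp; first exact: measurable_ln.
by apply: measurable_maxr => //; apply: measurable_minr.
Qed.

Lemma norm_trunc_log_le (e b x : R) : 0 < e -> e <= b ->
  `|trunc_log e b x| <= Num.max `|ln e| `|ln b|.
Proof.
move=> e0 eb; have h1 := trunc_log_ge b e0 x; have h2 := trunc_log_le e0 eb x.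
rewrite ler_norml; apply/andP; split.
  rewrite lerNl le_max; apply/orP; left; apply: (@le_trans _ _ (- ln e)).
    by rewrite lerN2.
  by rewrite -normrN ler_norm.
by rewrite le_max; apply/orP; right; apply: le_trans h2 (ler_norm _).
Qed.

Lemma measurable_far (c : R) : measurable [set x : R | c < `|x|].
Proof.
rewrite (_ : [set x | _] = (fun x => `|x|) @^-1` `]c, +oo[).
  by rewrite -[X in measurable X]setTI; apply: normr_measurable => //; exact: measurable_itv.
by apply/seteqP; split => x /=; rewrite in_itv /= andbT.
Qed.

(** [t] is the integral of the deficit. The upper truncation is invisible because [b] exceeds the
    support bound [B], and the exceptional points, 0 and those beyond [B], form a null set. *)
Lemma integral_lne_norm (e b : R) : 0 < e -> e <= a -> e <= b -> B <= b ->
  exists2 t, 0 <= t <= log_constant * e `^ a &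
    (\int[mu]_x lne `|x|%R%:E = (\int[mu]_x trunc_log e b x - t)%R%:E)%E.
Proof.
move=> e0 ea eb Bb.
have mg := measurable_log_deficit e.
have g0 x : 0 <= log_deficit e x by rewrite /log_deficit le_max lexx.
have gint : (\int[mu]_x (log_deficit e x)%:E)%E \is a fin_num.
  rewrite ge0_fin_numE; last by apply: integral_ge0 => x _; rewrite lee_fin.
  by apply: le_lt_trans (integral_log_deficit_le e0 ea) _; rewrite ltry.
exists (fine (\int[mu]_x (log_deficit e x)%:E)%E).
  apply/andP; split; first by apply/fine_ge0/integral_ge0 => x _; rewrite lee_fin.
  by rewrite -lee_fin fineK // integral_log_deficit_le.
have ig : mu.-integrable setT (EFin \o log_deficit e).
  apply/integrableP; split; first exact/measurable_EFinP.
  under eq_integral do rewrite /= ger0_norm //.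
  by rewrite -ge0_fin_numE //; apply: integral_ge0 => x _; rewrite lee_fin.
have if_ : mu.-integrable setT (EFin \o trunc_log e b).
  apply: (@bounded_integrable _ _ _ mu _ (Num.max `|ln e| `|ln b|)).
    exact: measurable_trunc_log.
  by move=> x; exact: norm_trunc_log_le.
rewrite EFinB /Rintegral !fineK //; last exact: integrable_fin_num.
rewrite -integralB //.
apply: ae_eq_integral => //.
- rewrite (_ : (fun x => _) = (fun x : R => if x == 0 then -oo%E else (ln `|x|)%:E)).
    apply: measurable_fun_ifT => //; first exact: measurable_fun_eqr.
    apply/measurable_EFinP; apply: measurableT_comp; first exact: measurable_ln.
    exact: normr_measurable.
  apply/funext => x; case: eqVneq => [->|x0]; first by rewrite normr0 le0_lneNy.
  by rewrite lne_EFin // normr_gt0.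
- apply: emeasurable_funB; apply/measurable_EFinP => //; exact: measurable_trunc_log.
exists ([set 0] `|` [set x : R | B < `|x|]); split.
- by apply: measurableU => //; exact: measurable_far.
- apply/eqP; rewrite eq_le measure_ge0 andbT.
  apply: le_trans (measureU2 _ _ _) _ => //; first exact: measurable_far.
  by rewrite [X in (X + _)%E]mu_zero [X in (_ + X)%E]mu_far adde0.
move=> x /= /not_implyP[_ h]; apply: contrapT => /not_orP[x0 /negP xB]; apply: h.
move: x0 => /eqP x0; rewrite -leNgt in xB.
have xp : 0 < `|x| by rewrite normr_gt0.
rewrite leNgt xp /= -EFinD; congr EFin; rewrite /trunc_log /log_deficit /clamp.
have xb : `|x| <= b by exact: le_trans Bb.
rewrite (min_idPl xb); have [ex|ex] := leP e `|x|.
  rewrite (max_idPl _) ?subr0 // subr_le0 ler_ln ?posrE //.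
by rewrite (max_idPr _) ?subKr // subr_ge0 ler_ln ?posrE // ltW.
Qed.
End LogIntegral.

Lemma compact_norm_bound {R : realType} (K : set R) : compact K -> exists B : R,
  forall x, K x -> `|x| <= B.
Proof.
move=> /compact_bounded[B [_ hB]]; exists (B + 1) => x Kx.
by apply: (hB (B + 1)) => //; rewrite ltrDl.
Qed.

Lemma compact_norm_bound_measure_zero {R : realType} (mu : probability R R) (K : set R) (B : R) :
  compact K -> (forall x, K x -> `|x| <= B) -> mu (~` K) = 0%E ->
  mu [set x : R | B < `|x|] = 0%E.
Proof.
move=> cK KB mK; apply/eqP; rewrite eq_le measure_ge0 andbT -[leRHS]mK.
apply: le_measure; rewrite ?inE; first exact: measurable_far.
  by apply: measurableC; apply: closed_measurable; apply: compact_closed.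
by move=> x /= Bx /KB; rewrite leNgt Bx.
Qed.

(** * Concentration of the truncated log-determinant *)

Section NearMedian.
Context {R : realType} {d} {Omega : measurableType d} {P : probability Omega R}.
Local Open Scope ereal_scope.

Lemma measurable_le_set (Y : Omega -> R) (r : R) : measurable_fun setT Y ->
  measurable [set w | (Y w <= r)%R].
Proof.
move=> mY; rewrite (_ : [set w | _] = Y @^-1` `]-oo, r]).
  by rewrite -[X in measurable X]setTI; apply: mY => //; exact: measurable_itv.
by apply/seteqP; split => w /=; rewrite in_itv.
Qed.

Lemma measurable_ge_set (Y : Omega -> R) (r : R) : measurable_fun setT Y ->
  measurable [set w | (r <= Y w)%R].
Proof.
move=> mY; rewrite (_ : [set w | _] = Y @^-1` `[r, +oo[).
  by rewrite -[X in measurable X]setTI; apply: mY => //; exact: measurable_itv.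
by apply/seteqP; split => w /=; rewrite in_itv /= andbT.
Qed.

Lemma half_mul_le (A B : set Omega) (q : R) : measurable A -> measurable B ->
  (2^-1)%R%:E <= P A -> P A * P B <= q%:E -> P B <= (2 * q)%R%:E.
Proof.
move=> mA mB hA hAB.
have eA := fineK (fin_num_measure P _ mA); have eB := fineK (fin_num_measure P _ mB).
have B0 : (0 <= fine (P B))%R by apply: fine_ge0.
move: hA hAB; rewrite -eA -eB -EFinM !lee_fin => hA hAB.
have : (2^-1 * fine (P B) <= fine (P A) * fine (P B))%R by rewrite ler_wpM2r.
lra.
Qed.

(** The centre is the infimum of the levels that [Y] stays below with probability at least one half.
    Levels within [t] of it on either side are used in its place, which turns [3 * t] into
    [4 * t]. *)
Lemma near_median (Y : Omega -> R) (u v q t : R) : measurable_fun setT Y ->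
  (forall w, (u <= Y w <= v)%R) -> (0 < t)%R ->
  (forall r : R, P [set w | (Y w <= r)%R] * P [set w | (r + 3 * t <= Y w)%R] <= q%:E) ->
  exists m : R, P [set w | (4 * t <= `|Y w - m|)%R] <= (4 * q)%R%:E.
Proof.
move=> mY uv t0 hq.
pose E := [set r : R | (2^-1)%R%:E <= P [set w | (Y w <= r)%R]].
have Ev : E v.
  rewrite /E /= (_ : [set w | _] = setT) ?probability_setT ?lee_fin; first by rewrite invf_le1 ?ler1n.
  by apply/seteqP; split => // w _ /=; case/andP: (uv w).
have lbE : lbound E u.
  move=> r; apply: contraPle => ru; rewrite /E /= (_ : [set w | _] = set0).
    by rewrite measure0 lee_fin; apply/negP; rewrite -ltNge invr_gt0.
  apply/seteqP; split => // w /=; apply/negP; rewrite -ltNge.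
  by apply: lt_le_trans ru _; case/andP: (uv w).
have infE : has_inf E by split; [exists v|exists u].
exists (inf E); set m := inf E.
have [r1 Er1 r1m] : exists2 r, E r & (r < m + t)%R.
  by have [r Er rm] := inf_adherent t0 infE; exists r.
have up : P [set w | (m + 4 * t <= Y w)%R] <= (2 * q)%R%:E.
  apply: le_trans (half_mul_le _ _ Er1 (hq r1)); last 2 first.
  - exact: measurable_le_set.
  - exact: measurable_ge_set.
  apply: le_measure; rewrite ?inE; [exact: measurable_ge_set|exact: measurable_ge_set|].
  by move=> w /=; lra.
have dn : P [set w | (Y w <= m - 4 * t)%R] <= (2 * q)%R%:E.
  have nE : ~ E (m - t)%R.
    by move=> /(ge_inf (ex_intro _ u lbE)); rewrite -/m; lra.
  have mm : measurable [set w | (m - t <= Y w)%R] by exact: measurable_ge_set.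
  have hge : (2^-1)%R%:E <= P [set w | (m - t <= Y w)%R].
    have ml := measurable_le_set (m - t)%R mY.
    apply: (@le_trans _ _ (P (~` [set w | (Y w <= m - t)%R]))); last first.
      apply: le_measure; rewrite ?inE //; first exact: measurableC.
      by move=> w /= /negP; rewrite -ltNge => /ltW.
    rewrite probability_setC //.
    move: nE; rewrite /E /= => /negP; rewrite -ltNge.
    rewrite -(fineK (fin_num_measure P _ ml)) lte_fin -EFinB lee_fin; lra.
  have := hq (m - 4 * t)%R; rewrite muleC.
  have -> : (m - 4 * t + 3 * t = m - t)%R by ring.
  by move=> h; apply: half_mul_le h => //; exact: measurable_le_set.
apply: (@le_trans _ _ (P ([set w | (m + 4 * t <= Y w)%R] `|` [set w | (Y w <= m - 4 * t)%R]))).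
  apply: le_measure; rewrite ?inE.
  - apply: measurable_ge_set; apply: measurableT_comp; first exact: normr_measurable.
    exact: measurable_funB.
  - apply: measurableU; [exact: measurable_ge_set|exact: measurable_le_set].
  - move=> w /=; rewrite ler_normr => /orP[h|h]; [left|right]; lra.
apply: le_trans (measureU2 _ _ _) _; [exact: measurable_ge_set|exact: measurable_le_set|].
have -> : (4 * q)%R%:E = (2 * q)%R%:E + (2 * q)%R%:E by rewrite -EFinD; congr EFin; ring.
exact: leeD.
Qed.

(** As [p < 1], some value of [Y] lies within [u] of [m], so [|m| <= S + u]. The deviation is then
    below [u] off the exceptional event and at most [2 * S + u] on it. *)
Lemma mean_near_center (Y : Omega -> R) (S m u p : R) : measurable_fun setT Y ->
  (forall w, (`|Y w| <= S)%R) -> (0 <= u)%R -> (p < 1)%R ->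
  P [set w | (u <= `|Y w - m|)%R] <= p%:E ->
  (`| \int[P]_w Y w - m| <= u + (2 * S + u) * p)%R.
Proof.
move=> mY YS u0 p1 hp.
set A := [set w | (u <= `|Y w - m|)%R] in hp *.
have mYm : measurable_fun setT (fun w => `|Y w - m|)%R.
  by apply: measurableT_comp; [exact: normr_measurable|exact: measurable_funB].
have mA : measurable A by exact: measurable_ge_set.
have p0 : (0 <= p)%R by rewrite -lee_fin (le_trans _ hp).
have [w0 hw0] : exists w, ~ A w.
  apply/existsNP => allA; have : P A = 1.
    by rewrite (_ : A = setT) ?probability_setT //; apply/seteqP; split.
  by move=> PA; move: hp; rewrite PA lee_fin; lra.
have mS : (`|m| <= S + u)%R.
  move: hw0 => /negP; rewrite -ltNge => h.
  have := YS w0; have := ler_normB (Y w0) (Y w0 - m)%R; rewrite subKr; lra.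
have iY : P.-integrable setT (EFin \o Y) by exact: (@bounded_integrable _ _ _ P Y S).
have iM : P.-integrable setT (EFin \o (cst m)).
  by apply: (@bounded_integrable _ _ _ P (cst m) `|m|%R).
have iB : P.-integrable setT (EFin \o (fun w => (Y w - m)%R)).
  apply: (@bounded_integrable _ _ _ P _ (S + `|m|)%R); first exact: measurable_funB.
  by move=> w; apply: le_trans (ler_normB _ _) _; rewrite lerD2r.
have -> : ((\int[P]_w Y w)%R - m = (\int[P]_w (Y w - m))%R)%R.
  rewrite RintegralB //; congr (_ - _)%R.
  by rewrite /Rintegral integral_cst_probability.
apply: le_trans (le_normr_Rintegral _ iB) _ => //.
have iA : P.-integrable setT (EFin \o (fun w => (u + (2 * S + u) * \1_A w)%R)).
  apply: (@bounded_integrable _ _ _ P _ (u + `|2 * S + u|)%R).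
    apply: measurable_funD => //; apply: measurable_funM => //; exact: measurable_indic.
  move=> w; apply: le_trans (ler_normD _ _) _; rewrite (ger0_norm u0) lerD2l normrM.
  rewrite -[leRHS]mulr1 ler_wpM2l // indicE; by case: (_ \in _); rewrite ?normr0 ?normr1.
apply: (@le_trans _ _ (\int[P]_w (u + (2 * S + u) * \1_A w)%R)%R).
  apply: le_Rintegral => //.
    by rewrite (_ : EFin \o _ = abse \o (EFin \o (fun w => (Y w - m)%R))) //; exact: integrable_abse.
  move=> w _; rewrite indicE; have [/set_mem h|h] := boolP (w \in A).
    rewrite mulr1; have := ler_normB (Y w) m; have := YS w; lra.
  rewrite mulr0 addr0 ltW // ltNge; apply/negP => h'; move/negP: h; apply.
  exact: mem_set.
have i1 : P.-integrable setT (EFin \o (fun w => (\1_A w : R))).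
  apply: (@bounded_integrable _ _ _ P _ 1%R); first exact: measurable_indic.
  by move=> w; rewrite indicE; case: (_ \in _); rewrite ?normr0 ?normr1.
have S0 : (0 <= S)%R by apply: le_trans (YS w0).
rewrite RintegralD //; last 2 first.
- by apply: (@bounded_integrable _ _ _ P (cst u) `|u|%R).
- rewrite (_ : EFin \o _ = (fun w => (2 * S + u)%R%:E * (\1_A w)%:E)) //.
  exact: integrableZl.
rewrite RintegralZl // {1}/Rintegral integral_cst_probability /= lerD2l.
rewrite ler_wpM2l ?addr_ge0 ?mulr_ge0 //.
rewrite /Rintegral integral_indic // setIT -lee_fin fineK //; exact: fin_num_measure.
Qed.
End NearMedian.

(** * Spectral statistics of the matrix model *)

Section ModelConcentration.
Context {R : realType} {d} {Omega : measurableType d} {P : probability Omega R}.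
Context {N m : nat} (X : 'I_m -> {RV P >-> R}) (Phi : 'rV[R]_m -> 'M[R]_N) (l beta : R).
Hypotheses (N0 : (0 < N)%N) (l0 : 0 <= l) (beta0 : 0 < beta).
Hypothesis sPhi : forall x, Phi x \is symmetricmx.
Hypothesis lPhi : forall x y, Ftilde_norm (Phi x - Phi y) <= l * l2norm (x - y).
Hypothesis iX : mutually_independent X.
Hypothesis cPhi : forall A : set 'M[R]_N,
  (forall T, A T -> T \is symmetricmx) -> convex_set A -> convex_set (Phi @^-1` A).

Let H w := Phi (random_vector X w).
Let Hcut w := Phi (cut_vector (beta / l) X w).
Let avg (f : R -> R) (T : 'M[R]_N) : R := N%:R^-1 * trace_fun f T.

Lemma trace_measurable_cut c : trace_measurable (fun w => Phi (cut_vector c X w)).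
Proof.
apply: (@trace_measurable_model _ _ _ Phi _ _ (fun i w => cut c (X i w)) l) => // i.
by apply: measurableT_comp => //; exact: measurable_cut.
Qed.

Lemma trace_measurable_full : trace_measurable H.
Proof.
by apply: (@trace_measurable_model _ _ _ Phi _ _ (fun i w => X i w) l).
Qed.

Lemma quasiconvex_trace (g : R -> R) (x y : 'rV[R]_m) (a s : R) : convex_fun g ->
  0 <= a <= 1 -> avg g (Phi x) <= s -> avg g (Phi y) <= s ->
  avg g (Phi (a *: x + (1 - a) *: y)) <= s.
Proof.
move=> cg /andP[a0 a1] xs ys.
pose A : set 'M[R]_N := [set T | T \is symmetricmx /\ avg g T <= s].
have cA : convex_set A.
  move=> S T p /set_mem[sS S1] /set_mem[sT T1]; apply/mem_set.
  have p01 : 0 <= p%:num <= 1 by rewrite ge0 le1.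
  rewrite (_ : conv p S T = p%:num *: S + (1 - p%:num) *: T) //.
  split; first exact: symmetric_comb.
  have Ni : 0 <= N%:R^-1 :> R by rewrite invr_ge0.
  apply: le_trans (ler_wpM2l Ni (trace_fun_convex cg sS sT p01)) _.
  rewrite mulrDr !(mulrCA N%:R^-1) -/(avg g S) -/(avg g T).
  have /andP[p0 p1] := p01; have q0 : 0 <= 1 - p%:num by rewrite subr_ge0.
  have := ler_wpM2l p0 S1; have := ler_wpM2l q0 T1; lra.
have := cPhi (fun T (h : A T) => h.1) cA.
move=> /(_ x y (Itv01 a0 a1)) h.
have /set_mem[] : conv (Itv01 a0 a1) (x : convex_lmodType 'rV[R]_m) y \in Phi @^-1` A.
  by apply: h; apply/mem_set; split.
by [].
Qed.

(** In the product of the cut level [beta / l] and the Lipschitz constant of the average, [l]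
    cancels: [32 * (beta * L * sqrt (2 N) / N) ^ 2] is [64 * beta ^ 2 * L ^ 2 / N]. *)
Lemma cut_trace_concentration (g : R -> R) (L r t : R) :
  convex_fun g -> lipschitz_fun L g -> 0 < L -> 0 < t ->
  (P [set w | (avg g (Hcut w) <= r)%R] * P [set w | (r + 3 * t <= avg g (Hcut w))%R]
   <= (expR (- (t ^+ 2 * N%:R / (64 * beta ^+ 2 * L ^+ 2))))%:E)%E.
Proof.
move=> cg lg L0 t0; have N0' : 0 < N%:R :> R by rewrite ltr0n.
have Fl x y : `|avg g (Phi x) - avg g (Phi y)|
    <= (N%:R^-1 * (L * Num.sqrt (2 * N%:R)) * l) * l2norm (x - y).
  rewrite /avg -mulrBr normrM ger0_norm ?invr_ge0 ?(ltW N0') //.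
  rewrite -!mulrA ler_wpM2l ?invr_ge0 ?(ltW N0') // !mulrA.
  exact: (trace_fun_model_lipschitz cg lg (ltW L0) sPhi lPhi).
(* If [l = 0] the level [beta / l] is 0 by convention, but the statistic is constant and one of the
   two events is empty. *)
have [lz|lp] := eqVneq l 0.
  have const w w' : avg g (Hcut w) = avg g (Hcut w').
    apply/eqP; rewrite -subr_eq0 -normr_le0; apply: le_trans (Fl _ _) _.
    by rewrite lz mulr0 mul0r.
  have [[w1 h1]|h1] := pselect (exists w, avg g (Hcut w) <= r).
    rewrite (_ : [set w | (r + 3 * t <= avg g (Hcut w))%R] = set0).
      by rewrite measure0 mule0 lee_fin expR_ge0.
    apply/seteqP; split => // w /=; rewrite (const w w1); lra.
  rewrite (_ : [set w | (avg g (Hcut w) <= r)%R] = set0).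
    by rewrite measure0 mul0e lee_fin expR_ge0.
  by apply/seteqP; split => // w /= hw; apply: h1; exists w.
have {}lp : 0 < l by rewrite lt_def lp.
have s0 : 0 < Num.sqrt (2 * N%:R) :> R by rewrite sqrtr_gt0 mulr_gt0.
pose LF := N%:R^-1 * (L * Num.sqrt (2 * N%:R)) * l.
have LF0 : 0 < LF by rewrite !mulr_gt0 ?invr_gt0.
have c0 : 0 < beta / l by rewrite divr_gt0.
have := @quasiconvex_concentration _ _ _ P m X (fun x => avg g (Phi x)) (beta / l) LF r t
  iX c0 LF0 t0 Fl (fun x y a s h => quasiconvex_trace cg h).
move=> /le_trans; apply; rewrite lee_fin ler_expR lerN2.
have sq : Num.sqrt (2 * N%:R) ^+ 2 = 2 * N%:R :> R by rewrite sqr_sqrtr // mulr_ge0.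
have -> : 32 * (beta / l * LF) ^+ 2 = 64 * beta ^+ 2 * L ^+ 2 / N%:R.
  rewrite /LF; have -> : beta / l * (N%:R^-1 * (L * Num.sqrt (2 * N%:R)) * l)
     = beta * L * N%:R^-1 * Num.sqrt (2 * N%:R) by field; rewrite !gt_eqF.
  by rewrite exprMn sq; field; rewrite gt_eqF.
by rewrite invf_div [t ^+ 2 * (_ / _)]mulrA.
Qed.

Lemma cut_trace_near_median (g : R -> R) (L t : R) :
  convex_fun g -> lipschitz_fun L g -> 0 < L -> 0 < t ->
  exists c : R, (P [set w | (4 * t <= `|avg g (Hcut w) - c|)%R]
    <= (4 * expR (- (t ^+ 2 * N%:R / (64 * beta ^+ 2 * L ^+ 2))))%:E)%E.
Proof.
move=> cg lg L0 t0; have N0' : 0 < N%:R :> R by rewrite ltr0n.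
have mF : measurable_fun setT (fun w => avg g (Hcut w)).
  apply: measurable_funM => //.
  have [_ h] := trace_measurable_cut (beta / l); exact: (h g L cg lg (ltW L0)).
pose LF := N%:R^-1 * (L * Num.sqrt (2 * N%:R)) * l.
have LF0 : 0 <= LF by rewrite !mulr_ge0 ?invr_ge0 ?(ltW L0) ?sqrtr_ge0.
(* The cut vector is bounded, which gives the statistic the bounded range that [near_median] asks
   for. *)
pose D := LF * (m%:R * (beta / l)).
have bF w : `|avg g (Hcut w) - avg g (Phi 0)| <= D.
  rewrite /avg -mulrBr normrM ger0_norm ?invr_ge0 ?(ltW N0') //.
  have hl : l2norm (cut_vector (beta / l) X w) <= m%:R * (beta / l).
    apply: le_trans (l2norm_le_sum _) _.
    apply: (@le_trans _ _ (\sum_(i < m) beta / l)).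
      apply: ler_sum => i _; rewrite mxE; case: ltP => h; first by rewrite mulr1 ltW.
      by rewrite mulr0 normr0 divr_ge0 // ltW.
    by rewrite sumr_const card_ord mulr_natl.
  apply: le_trans (ler_wpM2l LF0 hl).
  rewrite /LF -[leRHS]mulrA -[leRHS]mulrA ler_wpM2l ?invr_ge0 ?(ltW N0') // mulrA.
  have := trace_fun_model_lipschitz cg lg (ltW L0) sPhi lPhi (cut_vector (beta / l) X w) 0.
  by rewrite subr0.
apply: (near_median mF) => //.
- by move=> w; move: (bF w); rewrite ler_distl; exact.
- by move=> r; exact: cut_trace_concentration.
Qed.
(** A deviation of [8 * t] in the difference forces one of [4 * t] in one of the two convex parts,
    both [1 / e]-Lipschitz. *)
Lemma cut_log_near_median (e b t : R) : 0 < e -> e <= b -> 0 < t ->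
  exists c : R, (P [set w | (8 * t <= `|avg (trunc_log e b) (Hcut w) - c|)%R]
    <= (8 * expR (- (t ^+ 2 * N%:R * e ^+ 2 / (64 * beta ^+ 2))))%:E)%E.
Proof.
move=> e0 eb t0; have ei0 : 0 < e^-1 by rewrite invr_gt0.
set q := expR _.
have qE : q = expR (- (t ^+ 2 * N%:R / (64 * beta ^+ 2 * e^-1 ^+ 2))).
  by congr expR; field; rewrite !gt_eqF.
have [c1] := cut_trace_near_median (hinge_convex e0) (hinge_lipschitz e0) ei0 t0.
have [c2] := cut_trace_near_median (hinge_sub_log_convex e0 eb)
  (hinge_sub_log_lipschitz e0 eb) ei0 t0.
rewrite -qE => h2 h1; exists (c1 - c2).
have mA (g : R -> R) (c : R) : measurable_fun setT g ->
    measurable [set w | (4 * t <= `|avg g (Hcut w) - c|)%R].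
  move=> mg; apply: measurable_ge_set; apply: measurableT_comp; first exact: normr_measurable.
  apply: measurable_funB => //; apply: measurable_funM => //.
  exact: (measurable_trace_fun (trace_measurable_cut (beta / l))).
have mf : measurable_fun setT (@trunc_log R e b) by exact: measurable_trunc_log.
have mh : measurable_fun setT (@hinge R e).
  apply: measurable_funM => //; apply: measurable_maxr => //; apply: measurable_funB => //.
have mhf : measurable_fun setT (fun x => hinge e x - trunc_log e b x).
  exact: measurable_funB.
apply: (@le_trans _ _ (P ([set w | (4 * t <= `|avg (hinge e) (Hcut w) - c1|)%R] `|`
   [set w | (4 * t <= `|avg (fun x => hinge e x - trunc_log e b x) (Hcut w) - c2|)%R]))).
  apply: le_measure; rewrite ?inE.
  - apply: measurable_ge_set; apply: measurableT_comp; first exact: normr_measurable.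
    apply: measurable_funB => //; apply: measurable_funM => //.
    exact: (measurable_trace_fun (trace_measurable_cut (beta / l))).
  - by apply: measurableU; exact: mA.
  - move=> w /= h.
    have [h4|h4] := lerP (4 * t) `|avg (hinge e) (Hcut w) - c1|; [by left|right].
    have E : avg (fun x => hinge e x - trunc_log e b x) (Hcut w)
       = avg (hinge e) (Hcut w) - avg (trunc_log e b) (Hcut w).
      by rewrite /avg /trace_fun sumrB mulrBr.
    rewrite E; move: (avg (hinge e) (Hcut w)) (avg (trunc_log e b) (Hcut w)) h h4 => g f h h4.
    have := ler_normB (g - c1) (g - f - c2).
    have -> : g - c1 - (g - f - c2) = f - (c1 - c2) by ring.
    lra.
apply: le_trans (measureU2 _ _ _) _; [exact: mA|exact: mA|].
have -> : 8 * q = 4 * q + 4 * q by ring.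
by rewrite EFinD leeD.
Qed.

(** [u] is the deviation around the centre of the cut model plus the error of undoing the cut.
    Moving the centre to the mean costs [u + (2 * S + u) * p], and moving it on to the integral
    against [mu] costs [(e^-1 + S) * c]. *)
Lemma log_concentration (mu : probability R R) (e b t c pb : R) :
  0 < e -> e <= b -> 0 < t ->
  let S := Num.max `|ln e| `|ln b| in
  let u := 8 * t + 2 * beta * (ln b - ln e) in
  let p := 8 * expR (- (t ^+ 2 * N%:R * e ^+ 2 / (64 * beta ^+ 2))) + pb in
  (P [set w | beta%:E < dKS (esd (H w)) (esd (Hcut w))] <= pb%:E)%E -> p < 1 ->
  (dBL (mean_esd P H) mu <= c%:E)%E ->
  (P [set w | (2 * u + (2 * S + u) * p + (e^-1 + S) * c
      <= `|avg (trunc_log e b) (H w) - \int[mu]_x trunc_log e b x|)%R] <= p%:E)%E.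
Proof.
move=> e0 eb t0 S u p hb p1 hd.
have N0' : 0 < N%:R :> R by rewrite ltr0n.
have mH := trace_measurable_full; have mHc := trace_measurable_cut (beta / l).
have mf : measurable_fun setT (@trunc_log R e b) by exact: measurable_trunc_log.
have fS x : `|trunc_log e b x| <= S by exact: norm_trunc_log_le.
have mY : measurable_fun setT (fun w => avg (trunc_log e b) (H w)).
  by apply: measurable_funM => //; exact: (measurable_trace_fun mH).
have mYc : measurable_fun setT (fun w => avg (trunc_log e b) (Hcut w)).
  by apply: measurable_funM => //; exact: (measurable_trace_fun mHc).
have [m0 hm] := cut_log_near_median e0 eb t0.
have mset (Y : Omega -> R) (r x : R) : measurable_fun setT Y ->
    measurable [set w | (r <= `|Y w - x|)%R].
  move=> mY'; apply: measurable_ge_set; apply: measurableT_comp; first exact: normr_measurable.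
  exact: measurable_funB.
have mbad : measurable [set w | (beta%:E < dKS (esd (H w)) (esd (Hcut w)))%E].
  exact: measurable_dKS_gt.
have lnle : 0 <= ln b - ln e by rewrite subr_ge0 ler_ln ?posrE // (lt_le_trans e0).
have u0 : 0 <= u by rewrite addr_ge0 ?mulr_ge0 // ltW.
have hu : (P [set w | (u <= `|avg (trunc_log e b) (H w) - m0|)%R] <= p%:E)%E.
  apply: (@le_trans _ _ (P ([set w | (8 * t <= `|avg (trunc_log e b) (Hcut w) - m0|)%R]
     `|` [set w | (beta%:E < dKS (esd (H w)) (esd (Hcut w)))%E]))); last first.
    apply: le_trans (measureU2 _ _ _) _ => //; first exact: mset.
    by rewrite /p EFinD leeD.
  apply: le_measure; [exact/mem_set/mset|apply/mem_set; exact: measurableU (mset _ _ _ mYc) mbad|].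
  move=> w /= h; have [hk|hk] := leP (dKS (esd (H w)) (esd (Hcut w))) beta%:E; [left|by right].
  have := trunc_log_KS_dist N0 (sPhi _) (sPhi _) (ltW beta0) hk e0 eb.
  rewrite -/(H w) => hk'.
  have hk2 : `|avg (trunc_log e b) (H w) - avg (trunc_log e b) (Hcut w)|
      <= 2 * beta * (ln b - ln e).
    rewrite /avg -mulrBr normrM ger0_norm ?invr_ge0 ?(ltW N0') // mulrC ler_pdivrMr //.
    by rewrite mulrAC.
  have := ler_normD (avg (trunc_log e b) (H w) - avg (trunc_log e b) (Hcut w))
     (avg (trunc_log e b) (Hcut w) - m0).
  by rewrite subrKA; move: h; rewrite /u; lra.
have YS w : `|avg (trunc_log e b) (H w)| <= S by exact: (avg_trace_fun_le mH N0).
have hE := mean_near_center mY YS u0 p1 hu.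
have ei0 : 0 < e^-1 by rewrite invr_gt0.
have hA := dBL_test mH N0 hd mf (trunc_log_lipschitz e0 eb) fS ei0.
apply: le_trans hu; apply: (le_measure P (mem_set (mset _ _ _ mY)) (mem_set (mset _ _ _ mY))).
move=> w /=; move: hE hA; rewrite /avg.
set E := Rintegral P _ _; set A := Rintegral mu _ _; move=> hE hA h.
have h1 := ler_normD (N%:R^-1 * trace_fun (trunc_log e b) (H w) - m0) (m0 - A).
have h2 := ler_normD (m0 - E) (E - A).
rewrite [`|m0 - E|]distrC subrKA in h2; rewrite subrKA in h1.
lra.
Qed.
End ModelConcentration.

(** * Asymptotic estimates *)

Section Eventually.
Context {R : realType}.

Lemma powR_ge_near (g C : R) : 0 < g -> \forall N \near \oo, C <= N%:R `^ g.
Proof.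
move=> g0; pose D := Num.max C 1; have D1 : 1 <= D by rewrite le_max lexx orbT.
have D0 : 0 < D by exact: lt_le_trans D1.
near=> N.
have h : D `^ g^-1 <= N%:R by near: N; exact: nbhs_infty_ger.
apply: (@le_trans _ _ D); first by rewrite le_max lexx.
have -> : D = (D `^ g^-1) `^ g by rewrite -powRrM mulVf ?gt_eqF // powRr1 // ltW.
by apply: ge0_ler_powR; [exact: ltW|rewrite nnegrE powR_ge0|rewrite nnegrE|].
Unshelve. all: by end_near. Qed.

Lemma powRN_le_near (g t : R) : 0 < g -> 0 < t -> \forall N \near \oo, N%:R `^ (- g) <= t.
Proof.
move=> g0 t0; near=> N.
have h : t^-1 <= N%:R `^ g by near: N; exact: powR_ge_near.
have hp : 0 < N%:R `^ g by apply: lt_le_trans h; rewrite invr_gt0.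
by rewrite powRN -[leRHS]invrK lef_pV2 ?posrE ?invr_gt0.
Unshelve. all: by end_near. Qed.

(** [ln x <= x] at the power of exponent [g / 2]; the other half of the exponent absorbs the
    constant. *)
Lemma ln_le_powR_near (g C : R) : 0 < g -> 0 <= C ->
  \forall N \near \oo, C * ln N%:R <= N%:R `^ g.
Proof.
move=> g0 C0; have g2 : 0 < g / 2 by rewrite divr_gt0.
near=> N.
have h : C / (g / 2) <= N%:R `^ (g / 2) by near: N; exact: powR_ge_near.
have N1 : (1 <= N)%N by near: N; exact: nbhs_infty_ge.
have Np : 0 < N%:R :> R by rewrite ltr0n.
have e : N%:R `^ g = N%:R `^ (g / 2) * N%:R `^ (g / 2).
  by rewrite -powRD; [congr (_ `^ _); lra|apply/implyP => _; rewrite gt_eqF].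
have hl : g / 2 * ln N%:R <= N%:R `^ (g / 2).
  rewrite -ln_powR; have := @le_ln1Dx R (N%:R `^ (g / 2) - 1).
  rewrite [1 + _]addrC subrK => /(_ _)/le_trans; apply; last by lra.
  by have := @powR_gt0 R _ (g / 2) Np; lra.
rewrite e; apply: (@le_trans _ _ (C / (g / 2) * (g / 2 * ln N%:R))).
  by rewrite mulrA divfK // gt_eqF.
apply: ler_pM => //; first by rewrite divr_ge0 // ltW.
by rewrite mulr_ge0 ?(ltW g2) // ln_ge0 // ler1n.
Unshelve. all: by end_near. Qed.

Lemma expRN_le_inv (x : R) : 0 < x -> expR (- x) <= x^-1.
Proof.
move=> x0; rewrite expRN lef_pV2 ?posrE ?expR_gt0 //.
by apply: le_trans (expR_ge1Dx _); rewrite lerDr.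
Qed.

Lemma ereal_cvg0_near (u : nat -> \bar R) (C : R) : 0 < C ->
  (forall t : R, 0 < t -> \forall N \near \oo, exists2 x, u N = x%:E & `|x| <= C * t) ->
  u @ \oo --> 0%E.
Proof.
move=> C0 h; apply/fine_cvgP; split.
  by apply: filterS (h 1 ltr01) => N [x /= -> _].
apply/cvgrPdist_le => e e0.
apply: filterS (h (e / C) (divr_gt0 e0 C0)) => N [x ux hx]; rewrite /= ux /=.
by rewrite sub0r normrN; apply: le_trans hx _; rewrite mulrC divfK // gt_eqF.
Qed.

Lemma ereal_cvg_le_near (u : nat -> \bar R) (l t : R) : l < t ->
  u @ \oo --> l%:E -> \forall N \near \oo, (u N <= t%:E)%E.
Proof.
move=> lt /fine_cvgP[uf /cvgr_le/(_ _ lt) h]; apply: filterS2 uf h => N uf.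
by rewrite -[u N]fineK ?lee_fin.
Qed.

Lemma ereal_cvg_ge_near (u : nat -> \bar R) (l t : R) : t < l ->
  u @ \oo --> l%:E -> \forall N \near \oo, (t%:E <= u N)%E.
Proof.
move=> lt /fine_cvgP[uf /cvgr_ge/(_ _ lt) h]; apply: filterS2 uf h => N uf.
by rewrite -[u N]fineK ?lee_fin.
Qed.

Local Open Scope ereal_scope.

Lemma lne_le_expR (k x : R) (E : \bar R) : (0 < k)%R -> 0 <= E ->
  (k^-1)%R%:E * lne E <= x%:E -> E <= (expR (k * x))%:E.
Proof.
move=> k0; have ki : (0 < k^-1)%R by rewrite invr_gt0.
case: E => [r r0|_|//]; last by rewrite /= gt0_muley ?lte_fin // leye_eq.
have [rp|rn] := ltP 0%R r; last first.
  by move=> _; rewrite lee_fin (le_trans rn) // expR_ge0.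
rewrite lne_EFin // -EFinM !lee_fin ler_pdivrMl // => h.
by rewrite -[leLHS]lnK ?posrE // ler_expR.
Qed.

Lemma lne_fin_between (k u v : R) (E : \bar R) : (0 < k)%R ->
  (expR (k * u))%:E <= E -> E <= (expR (k * v))%:E ->
  exists2 x, (k^-1)%R%:E * lne E = x%:E & (u <= x <= v)%R.
Proof.
move=> k0; case: E => [r||]; rewrite ?lee_fin ?leye_eq ?leeNy_eq // => ur rv.
have rp : (0 < r)%R by apply: lt_le_trans ur; exact: expR_gt0.
exists (k^-1 * ln r)%R; first by rewrite lne_EFin // EFinM.
rewrite ler_pdivlMl // ler_pdivrMl //.
by rewrite -[X in X && _]ler_expR -[X in _ && X]ler_expR lnK ?posrE // ur rv.
Qed.

Lemma limn_esup_lty (u : (\bar R)^nat) : limn_esup u < +oo ->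
  exists C : R, \forall n \near \oo, u n <= C%:E.
Proof.
move=> /ereal_inf_lt[_ [V VF <-] Vlt].
exists (fine (ereal_sup (u @` V))); apply: filterS VF => n Vn.
have un : u n <= ereal_sup (u @` V) by apply: ereal_sup_ubound; exists n.
by case: (ereal_sup _) un Vlt => //= un _; apply: le_trans un _; rewrite leNye.
Qed.
End Eventually.

(** * The expected determinant at fixed size *)

Section DeterminantBounds.
Context {R : realType} {d} {Omega : measurableType d} {P : probability Omega R}.
Context {N : nat} (H : Omega -> 'M[R]_N) (mH : trace_measurable H) (N0 : (0 < N)%N).
Let avg (f : R -> R) (T : 'M[R]_N) : R := N%:R^-1 * trace_fun f T.
Let N0' : 0 < N%:R :> R. Proof. by rewrite ltr0n. Qed.

Definition tail_factor (b l : R) : R := 1 + `|l| * (b < `|l|)%R%:R.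

Lemma measurable_norm_det : measurable_fun setT (fun w => `|\det (H w)|).
Proof.
have [sH _] := mH; apply: measurableT_comp; first exact: normr_measurable.
rewrite (_ : (fun w => _) = (fun w => \prod_(l <- eigenvalues (H w)) l)).
  exact: (measurable_prod_eigenvalues mH (@measurable_id _ _ setT)).
by apply/funext => w; rewrite det_eigenvalues.
Qed.

Lemma measurable_tail_factor b : measurable_fun setT (tail_factor b).
Proof.
apply: measurable_funD => //; apply: measurable_funM; first exact: normr_measurable.
rewrite (_ : (fun l => _) = \1_[set l : R | b < `|l|]).
  by apply: measurable_indic; exact: measurable_far.
by apply/funext => x; rewrite indicE mem_setE.
Qed.

Lemma expR_trace_fun f (T : 'M[R]_N) :
  expR (trace_fun f T) = \prod_(l <- eigenvalues T) expR (f l).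
Proof. by rewrite /trace_fun expR_sum. Qed.

Lemma norm_det (T : 'M[R]_N) : T \is symmetricmx ->
  `|\det T| = \prod_(l <- eigenvalues T) `|l|.
Proof. by move=> sT; rewrite det_eigenvalues // normr_prod. Qed.

(** Each eigenvalue is at most its clamped value times its tail factor; beyond [b] this reads
    [|l| <= b * (1 + |l|)], by [1 <= b]. *)
Lemma norm_det_le (e b : R) (T : 'M[R]_N) : 0 < e -> e <= b -> 1 <= b ->
  T \is symmetricmx ->
  `|\det T| <= expR (N%:R * avg (trunc_log e b) T)
     * \prod_(l <- eigenvalues T) tail_factor b l.
Proof.
move=> e0 eb b1 sT; rewrite norm_det // /avg mulVKf ?gt_eqF // expR_trace_fun -big_split /=.
apply: ler_prod => l _; rewrite normr_ge0 /= /trunc_log lnK ?posrE ?clamp_gt0 // /tail_factor.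
have [h|h] := ltP b `|l|.
  rewrite mulr1; have -> : clamp e b `|l| = b.
    by rewrite /clamp (min_idPr (ltW h)); apply/max_idPr.
  have : 0 <= `|l| by []. nra.
by rewrite mulr0 addr0 mulr1 /clamp (min_idPl h) le_max lexx orbT.
Qed.

(** An eigenvalue below [e] still contributes [expR (- tau)], while its clamped value is at most 1;
    it costs at most [tau] in the exponent, and at most [rho * N] eigenvalues are concerned. *)
Lemma norm_det_ge (e b tau rho : R) (T : 'M[R]_N) : 0 < e -> e <= 1 -> e <= b -> 0 <= tau ->
  T \is symmetricmx ->
  (forall l, l \in eigenvalues T -> expR (- tau) <= `|l|) ->
  avg (fun l => (`|l| < e)%R%:R) T <= rho ->
  expR (N%:R * (avg (trunc_log e b) T - rho * tau)) <= `|\det T|.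
Proof.
move=> e0 e1 eb tau0 sT hl hrho.
apply: (@le_trans _ _ (expR (trace_fun (fun l => trunc_log e b l - tau * (`|l| < e)%R%:R) T))).
  rewrite ler_expR.
  have -> : trace_fun (fun l => trunc_log e b l - tau * (`|l| < e)%R%:R) T
     = N%:R * (avg (trunc_log e b) T - tau * avg (fun l => (`|l| < e)%R%:R) T).
    rewrite /avg /trace_fun sumrB -mulr_sumr.
    by field; rewrite gt_eqF.
  by rewrite ler_pM2l // lerD2l lerN2 [rho * _]mulrC ler_wpM2l.
rewrite expR_trace_fun norm_det // big_seq [leRHS]big_seq; apply: ler_prod => l /hl hl'.
rewrite expR_ge0 /=; have lp : 0 < `|l| by apply: lt_le_trans hl'; exact: expR_gt0.
have [h|h] := ltP `|l| e.
  rewrite mulr1 expRD; apply: le_trans hl'.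
  rewrite -[leRHS]mul1r ler_wpM2r ?expR_ge0 // /trunc_log lnK ?posrE ?clamp_gt0 //.
  rewrite /clamp ge_max e1 /= ge_min; apply/orP; left.
  exact: le_trans (ltW h) e1.
rewrite mulr0 subr0 /trunc_log lnK ?posrE ?clamp_gt0 //.
by rewrite /clamp ge_max h ge_min lexx.
Qed.

(** Above the threshold, [(D / s) ^ delta] is at least 1. *)
Lemma powR_split (s delta D : R) : 0 < s -> 0 < delta -> 0 <= D ->
  D <= s + s `^ (- delta) * D `^ (1 + delta).
Proof.
move=> s0 d0 D0; have [h|h] := leP D s.
  by rewrite ler_wpDr // mulr_ge0 ?powR_ge0.
rewrite ler_wpDl ?(ltW s0) //; have Dp : 0 < D by exact: lt_trans h.
rewrite powRD; last by apply/implyP => _; rewrite gt_eqF.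
rewrite powRr1 // mulrCA -[leLHS]mulr1 ler_wpM2l //.
rewrite powRN -ler_pdivrMl ?invr_gt0 ?powR_gt0 // invrK mulr1.
by apply: ge0_ler_powR; rewrite ?nnegrE ltW.
Qed.

Local Open Scope ereal_scope.

Lemma expectationE (Y : Omega -> R) : 'E_P[Y] = \int[P]_w (Y w)%:E.
Proof. by rewrite unlock. Qed.

Lemma expectation_det_upper (e b A theta s delta p : R) :
  (0 < e)%R -> (e <= b)%R -> (1 <= b)%R -> (0 < s)%R -> (0 < delta)%R ->
  P [set w | (theta <= `|avg (trunc_log e b) (H w) - A|)%R] <= p%:E ->
  'E_P[fun w => `|\det (H w)|%R]
    <= (expR (N%:R * (A + theta)))%:E
         * 'E_P[fun w => (\prod_(l <- eigenvalues (H w)) tail_factor b l)%R]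
       + (s * p)%R%:E
       + (s `^ (- delta))%R%:E * 'E_P[fun w => (`|\det (H w)| `^ (1 + delta))%R].
Proof.
move=> e0 eb b1 s0 d0 hp; have [sH _] := mH.
set G := [set w | _] in hp.
have mY : measurable_fun setT (fun w => avg (trunc_log e b) (H w)).
  by apply: measurable_funM => //; apply: (measurable_trace_fun mH); exact: measurable_trunc_log.
have mG : measurable G.
  apply: measurable_ge_set; apply: measurableT_comp; first exact: normr_measurable.
  exact: measurable_funB.
have mZ : measurable_fun setT (fun w => (\prod_(l <- eigenvalues (H w)) tail_factor b l)%R).
  by apply: (measurable_prod_eigenvalues mH); exact: measurable_tail_factor.
have Z0 w : (0 <= \prod_(l <- eigenvalues (H w)) tail_factor b l)%R.
  by apply: prodr_ge0 => l _; rewrite addr_ge0 ?mulr_ge0.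
have mD := measurable_norm_det.
have mDd : measurable_fun setT (fun w => (`|\det (H w)| `^ (1 + delta))%R).
  exact: (measurableT_comp (@measurable_powR R (1 + delta)) mD).
rewrite !expectationE.
pose f1 w := (expR (N%:R * (A + theta)))%:E * (\prod_(l <- eigenvalues (H w)) tail_factor b l)%R%:E.
pose f2 w := s%:E * (\1_G w)%:E.
pose f3 w := (s `^ (- delta))%R%:E * (`|\det (H w)| `^ (1 + delta))%R%:E.
have m1 : measurable_fun setT f1.
  by apply: emeasurable_funM => //; apply/measurable_EFinP.
have m2 : measurable_fun setT f2.
  by apply: emeasurable_funM => //; apply/measurable_EFinP; exact: measurable_indic.
have m3 : measurable_fun setT f3.
  by apply: emeasurable_funM => //; apply/measurable_EFinP.
have p1 w : 0 <= f1 w by rewrite mule_ge0 ?lee_fin ?expR_ge0.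
have p2 w : 0 <= f2 w by rewrite mule_ge0 ?lee_fin ?(ltW s0).
have p3 w : 0 <= f3 w by rewrite mule_ge0 ?lee_fin ?powR_ge0.
apply: (@le_trans _ _ (\int[P]_w (f1 w + f2 w + f3 w))).
  apply: ge0_le_integral => //.
  - by apply/measurable_EFinP.
  - by apply: emeasurable_funD => //; exact: emeasurable_funD.
  - move=> w _; rewrite /f1 /f2 /f3 -!EFinM -!EFinD lee_fin indicE.
    have [Gw|nGw] := boolP (w \in G).
      rewrite mulr1 -addrA ler_wpDl ?mulr_ge0 ?expR_ge0 //; exact: powR_split.
    rewrite mulr0 addr0 ler_wpDr ?mulr_ge0 ?powR_ge0 //.
    apply: le_trans (norm_det_le e0 eb b1 (sH w)) _; rewrite ler_wpM2r //.
    rewrite ler_expR ler_pM2l //.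
    have : (`|avg (trunc_log e b) (H w) - A| < theta)%R.
      by rewrite ltNge; apply: contra nGw => h; exact: mem_set.
    by rewrite ltr_distl; lra.
have m12 : measurable_fun setT (fun w => f1 w + f2 w) by exact: emeasurable_funD.
have p12 w : setT w -> 0 <= f1 w + f2 w by move=> _; rewrite adde_ge0.
rewrite (@ge0_integralD _ _ _ P setT measurableT (fun w => f1 w + f2 w) f3 p12 m12) //.
rewrite ge0_integralD //.
have ZE : \int[P]_w f1 w = (expR (N%:R * (A + theta)))%:E
    * \int[P]_w (\prod_(l <- eigenvalues (H w)) tail_factor b l)%R%:E.
  rewrite /f1 ge0_integralZl //; first by apply/measurable_EFinP.
  by move=> w _; rewrite lee_fin.
have DE : \int[P]_w f3 w = (s `^ (- delta))%R%:E
    * \int[P]_w (`|\det (H w)| `^ (1 + delta))%R%:E.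
  rewrite /f3 ge0_integralZl //; first by apply/measurable_EFinP.
  by rewrite lee_fin powR_ge0.
rewrite ZE DE; apply: leeD2r. apply: leeD2l.
have -> : \int[P]_w f2 w = s%:E * P G.
  rewrite /f2 ge0_integralZl ?integral_indic ?setIT //.
  - by apply/measurable_EFinP; exact: measurable_indic.
  - by rewrite lee_fin ltW.
by rewrite EFinM lee_wpmul2l // lee_fin ltW.
Qed.
Lemma norm_gt_set_measurable (tau : R) :
  measurable [set w | forall l, l \in eigenvalues (H w) -> l \notin `[(- tau)%R, tau]].
Proof.
have [sH _] := mH.
rewrite (_ : [set w | _] = \bigcap_(i in [set: 'I_N])
    ((fun w => eig (H w) i) @^-1` (~` [set` `[(- tau)%R, tau]]))).
  apply: fin_bigcap_measurable => [|i _]; first exact: finite_finset.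
  rewrite -[X in measurable X]setTI; apply: (measurable_eig mH) => //.
  by apply: measurableC; exact: measurable_itv.
apply/seteqP; split => [w h i _ /=|w h l].
  by apply/negP/h; rewrite mem_nth // size_eigenvalues.
move=> hl; have [i + <-] := elimT (nthP 0%R) hl; rewrite size_eigenvalues // => iN.
by have := h (Ordinal iN) Logic.I => /= /negP.
Qed.

(** The determinant is bounded below where no eigenvalue is too close to 0, the statistic is near
    [A], and fewer than [rho * N] eigenvalues are below [e]; Markov's inequality bounds the failure
    of the last condition by [W / rho]. *)
Lemma expectation_det_lower (e b A theta tau rho p W : R) :
  (0 < e)%R -> (e <= 1)%R -> (e <= b)%R -> (0 <= tau)%R -> (0 < rho)%R ->
  P [set w | (theta <= `|avg (trunc_log e b) (H w) - A|)%R] <= p%:E ->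
  'E_P[fun w => avg (fun l => (`|l| < e)%R%:R) (H w)] <= W%:E ->
  (expR (N%:R * (A - theta - rho * tau)))%:E
    * (P [set w | forall l, l \in eigenvalues (H w) ->
          l \notin `[(- expR (- tau))%R, expR (- tau)]] - (p + W / rho)%R%:E)
  <= 'E_P[fun w => `|\det (H w)|%R].
Proof.
move=> e0 e1 eb tau0 r0 hp hW; have [sH _] := mH.
set B := [set w | _] in hp; set Q := [set w | forall l, _].
pose Cnt w := avg (fun l => (`|l| < e)%R%:R) (H w).
have mind : measurable_fun setT (fun l : R => (`|l| < e)%R%:R : R).
  rewrite (_ : (fun l => _) = \1_[set l : R | (`|l| < e)%R]).
    by apply: measurable_indic; exact: measurable_ball.
  by apply/funext => x; rewrite indicE mem_setE.
have mC : measurable_fun setT Cnt.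
  by apply: measurable_funM => //; exact: (measurable_trace_fun mH).
have C0 w : (0 <= Cnt w)%R.
  by rewrite mulr_ge0 ?invr_ge0 ?(ltW N0') // sumr_ge0.
have mY : measurable_fun setT (fun w => avg (trunc_log e b) (H w)).
  by apply: measurable_funM => //; apply: (measurable_trace_fun mH); exact: measurable_trunc_log.
have mB : measurable B.
  apply: measurable_ge_set; apply: measurableT_comp; first exact: normr_measurable.
  exact: measurable_funB.
pose K := [set w | (rho <= Cnt w)%R].
have mK : measurable K by exact: measurable_ge_set.
have mQ : measurable Q by exact: norm_gt_set_measurable.
have PK : P K <= (W / rho)%R%:E.
  have h : rho%:E * P K <= W%:E.
    apply: le_trans hW; rewrite expectationE.
    have -> : rho%:E * P K = \int[P]_w (rho%:E * (\1_K w)%:E).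
      rewrite ge0_integralZl ?integral_indic ?setIT //.
      - by apply/measurable_EFinP; exact: measurable_indic.
      - by rewrite lee_fin ltW.
    apply: ge0_le_integral => //.
    - by move=> w _; rewrite -EFinM lee_fin mulr_ge0 ?(ltW r0).
    - by apply: emeasurable_funM => //; apply/measurable_EFinP; exact: measurable_indic.
    - by apply/measurable_EFinP.
    - move=> w _; rewrite -EFinM lee_fin indicE.
      by have [/set_mem h|h] := boolP (w \in K); rewrite ?mulr1 ?mulr0 //; exact: C0.
  move: h; rewrite -(fineK (fin_num_measure P _ mK)) -EFinM !lee_fin => h.
  by rewrite ler_pdivlMr // mulrC.
pose G := Q `\` (B `|` K).
have mBK : measurable (B `|` K) by exact: measurableU.
have mG : measurable G by exact: measurableD.
have PG : P Q - (p + W / rho)%R%:E <= P G.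
  rewrite leeBlDr //; apply: (@le_trans _ _ (P (G `|` (B `|` K)))).
    apply: le_measure; rewrite ?inE //; first exact: measurableU.
    by move=> w Qw; have [h|h] := pselect ((B `|` K) w); [right|left].
  apply: le_trans (measureU2 _ mG mBK) _; apply: leeD2l.
  apply: le_trans (measureU2 _ mB mK) _; rewrite EFinD; exact: leeD.
have E0 : 0 <= (expR (N%:R * (A - theta - rho * tau)))%:E by rewrite lee_fin expR_ge0.
apply: (le_trans (lee_wpmul2l E0 PG)); rewrite expectationE.
have -> : (expR (N%:R * (A - theta - rho * tau)))%:E * P G
    = \int[P]_w ((expR (N%:R * (A - theta - rho * tau)))%:E * (\1_G w)%:E).
  rewrite ge0_integralZl ?integral_indic ?setIT //.
  by apply/measurable_EFinP; exact: measurable_indic.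
apply: ge0_le_integral => //.
- by apply: emeasurable_funM => //; apply/measurable_EFinP; exact: measurable_indic.
- by apply/measurable_EFinP; exact: measurable_norm_det.
move=> w _; rewrite -EFinM lee_fin indicE.
have [/set_mem[Qw /not_orP[nB nK]]|h] := boolP (w \in G); last by rewrite mulr0.
rewrite mulr1.
apply: (@le_trans _ _ (expR (N%:R * (avg (trunc_log e b) (H w) - rho * tau)))).
  rewrite ler_expR ler_pM2l //; move/negP: nB; rewrite -ltNge ltr_distl; lra.
apply: norm_det_ge => //; last by move/negP: nK; rewrite -ltNge => /ltW.
move=> l /Qw; rewrite in_itv /= -ler_norml -ltNge; exact: ltW.
Qed.
End DeterminantBounds.

(** * The expected number of small eigenvalues *)

Section SmallEigenvalueCount.
Context {R : realType} {d} {Omega : measurableType d} {P : probability Omega R}.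
Context {N : nat} (H : Omega -> 'M[R]_N) (mH : trace_measurable H) (N0 : (0 < N)%N).

(** Equal to 1 on [|x| <= e] and to 0 outside [|x| < 2 * e]: a Lipschitz function between two
    indicators, since an indicator itself is not an admissible test function. *)
Definition plateau (e x : R) : R := Num.min 1 (Num.max 0 (2 - `|x| / e)).

Lemma plateau_itv e x : 0 <= plateau e x <= 1.
Proof. by rewrite /plateau le_min ler01 le_max lexx /= ge_min lexx. Qed.

Lemma dist_maxr_le (c x y : R) : `|Num.max c x - Num.max c y| <= `|x - y|.
Proof.
have := ler_norm (x - y); have := ler_norm (y - x); rewrite [`|y - x|]distrC.
by case: (leP c x) => ?; case: (leP c y) => ?; rewrite ler_norml; lra.
Qed.

Lemma dist_minr_le (c x y : R) : `|Num.min c x - Num.min c y| <= `|x - y|.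
Proof.
have := ler_norm (x - y); have := ler_norm (y - x); rewrite [`|y - x|]distrC.
by case: (leP c x) => ?; case: (leP c y) => ?; rewrite ler_norml; lra.
Qed.

Lemma plateau_lipschitz e : 0 < e -> lipschitz_fun e^-1 (plateau e).
Proof.
move=> e0 x y; rewrite /plateau.
apply: le_trans (dist_minr_le _ _ _) _; apply: le_trans (dist_maxr_le _ _ _) _.
have -> : 2 - `|x| / e - (2 - `|y| / e) = (`|y| - `|x|) / e by ring.
rewrite normrM mulrC normfV (gtr0_norm e0) ler_wpM2l ?invr_ge0 ?(ltW e0) //.
by rewrite [`|x - y|]distrC ler_dist_dist.
Qed.

Lemma measurable_plateau e : measurable_fun setT (plateau e).
Proof.
apply: measurable_minr => //; apply: measurable_maxr => //; apply: measurable_funB => //.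
by apply: measurable_funM => //; exact: normr_measurable.
Qed.

Local Open Scope ereal_scope.

Lemma expectation_small_count (mu : probability R R) (e c V : R) : (0 < e)%R ->
  dBL (mean_esd P H) mu <= c%:E ->
  mu [set x : R | (`|x| < 2 * e)%R] <= V%:E ->
  'E_P[fun w => (N%:R^-1 * trace_fun (fun l => (`|l| < e)%R%:R) (H w))%R]
    <= (V + (e^-1 + 1) * c)%R%:E.
Proof.
move=> e0 hd hV; have [sH _] := mH.
have N0' : (0 < N%:R :> R)%R by rewrite ltr0n.
have mp := measurable_plateau e.
have p1 x : (`|plateau e x| <= 1)%R.
  by have /andP[h1 h2] := plateau_itv e x; rewrite ger0_norm.
have ei0 : (0 < e^-1)%R by rewrite invr_gt0.
have hA := dBL_test mH N0 hd mp (plateau_lipschitz e0) p1 ei0.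
have mtp : measurable_fun setT (fun w => N%:R^-1 * trace_fun (plateau e) (H w))%R.
  by apply: measurable_funM => //; exact: (measurable_trace_fun mH).
have mind : measurable_fun setT (fun l : R => (`|l| < e)%R%:R : R).
  rewrite (_ : (fun l => _) = \1_[set l : R | (`|l| < e)%R]).
    by apply: measurable_indic; exact: measurable_ball.
  by apply/funext => x; rewrite indicE mem_setE.
have hmu : (\int[mu]_x plateau e x <= V)%R.
  have ip : mu.-integrable setT (EFin \o plateau e) by exact: (@bounded_integrable _ _ _ mu _ 1%R).
  rewrite -lee_fin /Rintegral fineK; last exact: integrable_fin_num.
  apply: le_trans hV; have mB := @measurable_ball R (2 * e)%R.
  rewrite -[X in _ <= mu X]setIT -integral_indic //.
  apply: ge0_le_integral => //.
  - by move=> x _; rewrite lee_fin; case/andP: (plateau_itv e x).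
  - by apply/measurable_EFinP.
  - by apply/measurable_EFinP; exact: measurable_indic.
  - move=> x _; rewrite lee_fin indicE.
    have [h|h] := boolP (`|x| < 2 * e)%R.
      by rewrite mem_set //; case/andP: (plateau_itv e x).
    apply: (@le_trans _ _ 0%R); last exact: ler0n.
    rewrite /plateau; have -> : Num.max 0%R (2 - `|x| / e)%R = 0%R.
      by apply/max_idPl; rewrite subr_le0 ler_pdivlMr // leNgt.
    by rewrite ge_min lexx orbT.
rewrite expectationE.
apply: (@le_trans _ _ (\int[P]_w (N%:R^-1 * trace_fun (plateau e) (H w))%R%:E)).
  apply: ge0_le_integral => //.
  - by move=> w _; rewrite lee_fin mulr_ge0 ?invr_ge0 // sumr_ge0.
  - by apply/measurable_EFinP; apply: measurable_funM => //; exact: (measurable_trace_fun mH).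
  - by apply/measurable_EFinP.
  - move=> w _; rewrite lee_fin ler_wpM2l ?invr_ge0 // ler_sum // => x _.
    have [h|h] := boolP (`|x| < e)%R; last by case/andP: (plateau_itv e x).
    rewrite /plateau le_min lexx /= le_max; apply/orP; right.
    have : (`|x| / e <= 1)%R by rewrite ler_pdivrMr // mul1r ltW.
    lra.
have it : P.-integrable setT (EFin \o (fun w => N%:R^-1 * trace_fun (plateau e) (H w))%R).
  by apply: (@bounded_integrable _ _ _ P _ 1%R) => // w; exact: (avg_trace_fun_le mH N0).
have := integrable_fin_num measurableT it => hf.
rewrite -(fineK hf) lee_fin; move: hA; rewrite /Rintegral ler_distl => /andP[_ h].
by apply: le_trans h _; rewrite lerD2r.
Qed.
End SmallEigenvalueCount.

(** * Both bounds at a fixed size *)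

Section FixedSize.
Context {R : realType} {d} {Omega : measurableType d} {P : probability Omega R}.
Context {N m : nat} (X : 'I_m -> {RV P >-> R}) (Phi : 'rV[R]_m -> 'M[R]_N) (l beta : R).
Hypotheses (N0 : (0 < N)%N) (l0 : 0 <= l) (beta0 : 0 < beta).
Hypothesis sPhi : forall x, Phi x \is symmetricmx.
Hypothesis lPhi : forall x y, Ftilde_norm (Phi x - Phi y) <= l * l2norm (x - y).
Hypothesis iX : mutually_independent X.
Hypothesis cPhi : forall A : set 'M[R]_N,
  (forall T, A T -> T \is symmetricmx) -> convex_set A -> convex_set (Phi @^-1` A).

Let H w := Phi (random_vector X w).
Let Hcut w := Phi (cut_vector (beta / l) X w).

(** Concentration takes [21 * t] on both sides. The lower bound loses a further [t] to small
    eigenvalues and [t] to the probability [3/4 - 1/8 - 1/8 = 1/2] of the good event; the upper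
    bound loses [t] to large eigenvalues and [t] to the factor 11, one for the main term and ten for
    the exceptional event. *)
Lemma det_expectation_bounds (mu : probability R R) (e b t tau rho s delta pb V M : R) :
  let S := Num.max `|ln e| `|ln b| in
  let u := 8 * t + 2 * beta * (ln b - ln e) in
  let p := 8 * expR (- (t ^+ 2 * N%:R * e ^+ 2 / (64 * beta ^+ 2))) + pb in
  let A := \int[mu]_x trunc_log e b x in
  0 < e -> e <= 1 -> 1 <= b -> 0 < t -> 0 <= tau -> 0 < rho -> 0 < s -> 0 < delta ->
  (P [set w | beta%:E < dKS (esd (H w)) (esd (Hcut w))] <= pb%:E)%E ->
  (dBL (mean_esd P H) mu <= beta%:E)%E ->
  ((3 / 4)%:E <= P [set w | forall k, k \in eigenvalues (H w) ->
     k \notin `[(- expR (- tau))%R, expR (- tau)%R]])%E ->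
  ('E_P[fun w => (\prod_(k <- eigenvalues (H w)) (1 + `|k| * (b < `|k|)%R%:R))%R]
     <= (expR (N%:R * t))%:E)%E ->
  ('E_P[fun w => (`|\det (H w)| `^ (1 + delta))%R] <= M%:E)%E ->
  (mu [set x : R | (`|x| < 2 * e)%R] <= V%:E)%E ->
  2 * u + (2 * S + u) * p + (e^-1 + S) * beta <= 21 * t ->
  p <= 1 / 8 -> (V + (e^-1 + 1) * beta) / rho <= 1 / 8 -> rho * tau <= t ->
  s * p + s `^ (- delta) * M <= 10 * expR (N%:R * ln e) -> ln 11 <= N%:R * t ->
  exists2 x, ((N%:R^-1)%:E * lne 'E_P[fun w => `|\det (H w)|%R] = x%:E)%E &
    A - 23 * t <= x <= A + 23 * t.
Proof.
move=> S u p A e0 e1 b1 t0 tau0 r0 s0 d0 hKS hBL hQ hZ hM hV n1 n2 n3 n4 n5 n6.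
have eb : e <= b by exact: le_trans b1.
have N0' : 0 < N%:R :> R by rewrite ltr0n.
have mH : trace_measurable H := trace_measurable_full X l0 sPhi lPhi.
have p1 : p < 1 by lra.
have := log_concentration N0 l0 beta0 sPhi lPhi iX cPhi e0 eb t0 hKS p1 hBL.
rewrite -/S -/u -/p -/A => hc0.
have hc : (P [set w | (21 * t <= `|N%:R^-1 * trace_fun (trunc_log e b) (H w) - A|)%R] <= p%:E)%E.
  apply: le_trans hc0; apply: le_measure; rewrite ?inE.
  - apply: measurable_ge_set; apply: measurableT_comp; first exact: normr_measurable.
    apply: measurable_funB => //; apply: measurable_funM => //.
    by apply: (measurable_trace_fun mH); exact: measurable_trunc_log.
  - apply: measurable_ge_set; apply: measurableT_comp; first exact: normr_measurable.
    apply: measurable_funB => //; apply: measurable_funM => //.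
    by apply: (measurable_trace_fun mH); exact: measurable_trunc_log.
  - by move=> w /=; exact: le_trans.
(* Hence a contribution of order [e ^ N] from the exceptional event stays below the main term. *)
have Ae : ln e <= A.
  have ic : mu.-integrable setT (EFin \o trunc_log e b).
    apply: (@bounded_integrable _ _ _ mu _ S); first exact: measurable_trunc_log.
    by move=> x; exact: norm_trunc_log_le.
  have ie : mu.-integrable setT (EFin \o (cst (ln e))).
    by apply: (@bounded_integrable _ _ _ mu (cst (ln e)) `|ln e|).
  have := le_Rintegral measurableT ie ic (fun x _ => trunc_log_ge b e0 x).
  by rewrite {1}/Rintegral integral_cst_probability.
apply: lne_fin_between => //.
  have hW := expectation_small_count mH N0 e0 hBL hV.
  apply: le_trans (expectation_det_lower mH N0 e0 e1 eb tau0 r0 hc hW).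
  set Q := P _ in hQ *.
  have hh : ((1 / 2)%:E <= Q - (p + (V + (e^-1 + 1) * beta) / rho)%:E)%E.
    rewrite leeBrDr // -EFinD; apply: le_trans hQ; rewrite lee_fin; lra.
  have E0 : (0 <= (expR (N%:R * (A - 21 * t - rho * tau)))%:E)%E by rewrite lee_fin expR_ge0.
  apply: le_trans (lee_wpmul2l E0 hh); rewrite -EFinM lee_fin.
  have h2 : ln 2 <= N%:R * t :> R.
    by apply: le_trans n6; rewrite ler_ln ?posrE // ler_nat.
  apply: (@le_trans _ _ (expR (N%:R * (A - 21 * t - rho * tau) - ln 2))).
    rewrite ler_expR; have : N%:R * (rho * tau) <= N%:R * t by rewrite ler_pM2l.
    lra.
  by rewrite expRD expRN lnK ?posrE // div1r.
have hU := expectation_det_upper mH N0 e0 eb b1 s0 d0 hc.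
apply: le_trans hU _.
have E0 : (0 <= (expR (N%:R * (A + 21 * t)))%:E)%E by rewrite lee_fin expR_ge0.
have S0 : (0 <= (s `^ (- delta))%:E)%E by rewrite lee_fin powR_ge0.
apply: le_trans (leeD (leeD (lee_wpmul2l E0 hZ) (lexx _)) (lee_wpmul2l S0 hM)) _.
rewrite -!EFinM -!EFinD lee_fin -expRD -addrA.
have Ny : expR (N%:R * ln e) <= expR (N%:R * (A + 22 * t)).
  by rewrite ler_expR ler_pM2l //; lra.
apply: (@le_trans _ _ (11 * expR (N%:R * (A + 22 * t)))).
  have -> : N%:R * (A + 21 * t) + N%:R * t = N%:R * (A + 22 * t) by ring.
  lra.
rewrite -[X in X * _]lnK ?posrE // -expRD ler_expR; lra.
Qed.
End FixedSize.

(** * Choice of the parameters *)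

Section ParameterChoice.
Context {R : realType} (kappa t : R) (kappa0 : 0 < kappa) (t0 : 0 < t).
Let a : R := Num.min kappa 1.
(** Small enough for [N ^ eps] to be negligible against [N ^ (kappa * a / 4)], [N ^ kappa] and
    [N]. *)
Let eps : R := a ^+ 2 / 8.

Let a0 : 0 < a. Proof. by rewrite /a lt_min kappa0 ltr01. Qed.
Let a1 : a <= 1. Proof. by rewrite /a ge_min lexx orbT. Qed.
Let ak : a <= kappa. Proof. by rewrite /a ge_min lexx. Qed.

Let eps0 : 0 < eps. Proof. by rewrite divr_gt0 // exprn_gt0. Qed.
Let epsa : eps <= a / 8. Proof. by rewrite /eps ler_pM2r // expr2 ler_piMr // ltW. Qed.

Let ka0 : 0 < kappa * a / 4. Proof. by rewrite divr_gt0 // mulr_gt0. Qed.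

Lemma powRN_mul (x r s : R) : 0 < x -> x `^ r * x `^ s = x `^ (r + s).
Proof. by move=> x0; rewrite powRD //; apply/implyP => _; rewrite gt_eqF. Qed.

(** The squared ratio of the two scales is [n ^ kappa], so the exponent has order [n ^ (1 + kappa)]
    and beats any multiple of [n * ln n]. *)
Lemma concentration_rate_near (L : R) : 0 <= L ->
  \forall N \near \oo, let n : R := N%:R in
    8 * expR (- (t ^+ 2 * n * (n `^ (- (kappa / 2))) ^+ 2 / (64 * (n `^ (- kappa)) ^+ 2)))
      + expR (n * ln n * - L) <= 9 * expR (n * ln n * - L).
Proof.
move=> L0; near=> N; set n : R := N%:R.
have n0 : 0 < n by rewrite ltr0n; rewrite /n; near: N; exact: nbhs_infty_gt.
have h : 64 * L / t ^+ 2 * ln n <= n `^ kappa.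
  rewrite /n; near: N; apply: ln_le_powR_near => //.
  by apply: divr_ge0; [rewrite mulr_ge0|exact: sqr_ge0].
have e1 : (n `^ (- (kappa / 2))) ^+ 2 = (n `^ kappa)^-1.
  by rewrite expr2 powRN_mul // -powRN; congr (_ `^ _); field.
have e2 : n `^ (- kappa) = (n `^ kappa)^-1 by rewrite powRN.
have w0 : 0 < n `^ kappa by exact: powR_gt0.
rewrite e1 e2.
have -> : t ^+ 2 * n * (n `^ kappa)^-1 / (64 * (n `^ kappa)^-1 ^+ 2)
   = t ^+ 2 * n * n `^ kappa / 64 by field; rewrite gt_eqF.
have : expR (- (t ^+ 2 * n * n `^ kappa / 64)) <= expR (n * ln n * - L).
  rewrite ler_expR mulrN lerN2.
  have t2 : 0 < t ^+ 2 / 64 * n by rewrite mulr_gt0 // divr_gt0 // exprn_gt0.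
  have := ler_wpM2l (ltW t2) h.
  have -> : t ^+ 2 / 64 * n * (64 * L / t ^+ 2 * ln n) = n * ln n * L.
    by field; rewrite gt_eqF.
  lra.
lra.
Unshelve. all: by end_near. Qed.

(** The allowance [21 * t] consists of [18 * t] for [2 * u], [t] for the term with [p], and at most
    [2 * t] for the bounded Lipschitz error. *)
Lemma error_terms_near (L : R) : 1 <= L ->
  \forall N \near \oo, let n : R := N%:R in
    let e := n `^ (- (kappa / 2)) in let b := expR (n `^ eps) in
    let beta := n `^ (- kappa) in
    let S := Num.max `|ln e| `|ln b| in
    let u := 8 * t + 2 * beta * (ln b - ln e) in
    forall p, 0 <= p -> p <= 9 * expR (n * ln n * - L) ->
    2 * u + (2 * S + u) * p + (e^-1 + S) * beta <= 21 * t /\ p <= 1 / 8.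
Proof.
move=> L1; near=> N; set n : R := N%:R; set e := n `^ (- (kappa / 2)); set b := expR (n `^ eps); set beta := n `^ (- kappa).
set S := Num.max _ _; set u := _ + _ * (_ - _); move=> p p0 hp.
have n1 : 1 < n by rewrite ltr1n; rewrite /n; near: N; exact: nbhs_infty_gt.
have n0 : 0 < n by lra.
have ln1' : 1 <= ln n.
  rewrite -ler_expR lnK ?posrE //; rewrite /n; near: N; exact: nbhs_infty_ger.
have tauE : kappa / 2 * ln n <= n `^ eps.
  by rewrite /n; near: N; apply: ln_le_powR_near; [exact: eps0|apply: ltW; rewrite divr_gt0].
have lne : ln e = - (kappa / 2 * ln n) by rewrite /e ln_powR mulNr.
have lnb : ln b = n `^ eps by rewrite /b expRK.
have tau0 : 0 < n `^ eps by exact: powR_gt0.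
have kl0 : 0 <= kappa / 2 * ln n by rewrite mulr_ge0 ?divr_ge0 ?(ltW kappa0) //; lra.
have SE : S = n `^ eps.
  rewrite /S lne lnb normrN (ger0_norm kl0) (gtr0_norm tau0).
  exact/max_idPr.
have b1 : n `^ (- (kappa - eps)) <= t / 4.
  rewrite /n; near: N; apply: powRN_le_near; last by rewrite divr_gt0.
  by rewrite subr_gt0; move: a0 ak epsa; lra.
(* 36 here and 162 below make the two parts of [(2 * S + 9 * t) * (9 / n)] at most [t / 2] each. *)
have b2 : n `^ (- (1 - eps)) <= t / 36.
  rewrite /n; near: N; apply: powRN_le_near; last by rewrite divr_gt0.
  by rewrite subr_gt0; move: a0 a1 epsa; lra.
have b3 : n `^ (- (kappa / 2)) <= t.
  by rewrite /n; near: N; apply: powRN_le_near => //; rewrite divr_gt0.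
have b4 : 162 <= n by rewrite /n; near: N; exact: nbhs_infty_ger.
have be : n `^ eps * beta = n `^ (- (kappa - eps)).
  by rewrite /beta powRN_mul //; congr (_ `^ _); ring.
have eb : e^-1 * beta = n `^ (- (kappa / 2)).
  by rewrite /e /beta -powRN powRN_mul //; congr (_ `^ _); field.
have beta0 : 0 < beta by exact: powR_gt0.
have hu : u <= 9 * t.
  rewrite /u lne lnb.
  have : beta * (kappa / 2 * ln n) <= beta * n `^ eps by rewrite ler_pM2l.
  by move: be b1; rewrite mulrC; lra.
have u0 : 0 <= u.
  by rewrite /u lne lnb addr_ge0 ?mulr_ge0 ?(ltW t0) ?(ltW beta0) // opprK addr_ge0 // ltW.
have hp2 : p <= 9 / n.
  apply: (le_trans hp); rewrite ler_pM2l //; apply: le_trans (expRN_le_inv n0).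
  rewrite ler_expR mulrN lerN2 -mulrA -[leLHS]mulr1 ler_pM2l //.
  by rewrite -[leLHS]mulr1 ler_pM.
have p8 : p <= 1 / 8.
  by apply: (le_trans hp2); rewrite ler_pdivrMr //; lra.
have ne : n `^ eps / n = n `^ (- (1 - eps)).
  by rewrite -[X in _ / X](powRr1 (ltW n0)) -powRN powRN_mul //; congr (_ `^ _); ring.
have h3 : (2 * S + u) * p <= t.
  apply: (@le_trans _ _ ((2 * n `^ eps + 9 * t) * (9 / n))).
    apply: ler_pM => //; first by rewrite addr_ge0 // mulr_ge0 // SE ltW.
    by rewrite SE lerD2l.
  have -> : (2 * n `^ eps + 9 * t) * (9 / n) = 18 * (n `^ eps / n) + 81 * t / n.
    by field; rewrite gt_eqF.
  have : 81 * t / n <= t / 2 by rewrite ler_pdivrMr //; nra.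
  by rewrite ne; lra.
split => //.
have -> : (e^-1 + S) * beta = n `^ (- (kappa / 2)) + n `^ (- (kappa - eps)).
  by rewrite mulrDl eb SE be.
by lra.
Unshelve. all: by end_near. Qed.

(** The expected proportion of small eigenvalues is at most of order
    [e ^ a = n ^ (- (kappa * a / 2))]. Taking [rho] as the square root of this makes the Markov
    ratio vanish and leaves room for [n ^ eps]. *)
Lemma count_terms_near (C : R) : 0 <= C ->
  \forall N \near \oo, let n : R := N%:R in
    let e := n `^ (- (kappa / 2)) in
    let rho := n `^ (- (kappa * a / 4)) in
    (2 * C * e `^ a + (e^-1 + 1) * n `^ (- kappa)) / rho <= 1 / 8 /\
    rho * n `^ eps <= t.
Proof.
move=> C0; near=> N; set n : R := N%:R; set e := n `^ (- (kappa / 2)); set rho := n `^ (- (kappa * a / 4)).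
have n1 : 1 < n by rewrite ltr1n; rewrite /n; near: N; exact: nbhs_infty_gt.
have n0 : 0 < n by lra.
have mono (x y : R) : x <= y -> n `^ x <= n `^ y by move=> xy; apply: ler_powR => //; exact: ltW.
split; last first.
  have -> : rho * n `^ eps = n `^ (- (kappa * a / 4 - eps)).
    by rewrite /rho powRN_mul //; congr (_ `^ _); ring.
  rewrite /n; near: N; apply: powRN_le_near => //.
  by rewrite subr_gt0 /eps; move: a0 ak; nra.
have b1 : n `^ (- (kappa * a / 4)) <= (8 * (2 * C + 2))^-1.
  rewrite /n; near: N; apply: powRN_le_near => //; rewrite invr_gt0; lra.
have ea : e `^ a = n `^ (- (kappa * a / 2)).
  by rewrite /e -powRrM; congr (_ `^ _); field.
have e1 : e^-1 * n `^ (- kappa) <= n `^ (- (kappa * a / 2)).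
  rewrite /e -powRN powRN_mul //; apply: mono.
  by move: a1 kappa0; nra.
have e2 : n `^ (- kappa) <= n `^ (- (kappa * a / 2)).
  by apply: mono; move: a1 a0 kappa0; nra.
have rho0 : 0 < rho by exact: powR_gt0.
have rr : n `^ (- (kappa * a / 2)) = rho * rho.
  by rewrite /rho powRN_mul //; congr (_ `^ _); field.
rewrite ler_pdivrMr //.
apply: (@le_trans _ _ ((2 * C + 2) * (rho * rho))).
  by rewrite ea -rr mulrDl; lra.
rewrite mulrA ler_pM2r // mulrC.
have c2 : 0 < 2 * C + 2 by lra.
apply: le_trans (ler_wpM2r (ltW c2) b1) _.
by rewrite invfM -mulrA mulVf ?gt_eqF // mulr1 div1r.
Unshelve. all: by end_near. Qed.
End ParameterChoice.

(** The choice of [c] brings the moment term down to [n ^ (- kappa n)], and the rate [c + kappa + 1]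
    leaves [n ^ (- (kappa + 1) n)] after multiplication by [s], up to the factor 9. Both are below
    [n ^ (- kappa n / 2)]. *)
Lemma moment_tail_le {R : realType} (n kappa delta C p : R) : 1 <= n -> 0 < kappa -> 0 < delta -> 0 <= C ->
  let c := (C + kappa) / delta in
  let s := expR (n * ln n * c) in
  p <= 9 * expR (n * ln n * - (c + kappa + 1)) ->
  s * p + s `^ (- delta) * expR (n * ln n * C) <= 10 * expR (n * ln (n `^ (- (kappa / 2)))).
Proof.
move=> n1 k0 d0 C0 c s hp; set w := n * ln n in s hp *.
have w0 : 0 <= w by rewrite mulr_ge0 ?ln_ge0 //; lra.
set Q := expR (n * ln _).
have QE : Q = expR (w * - (kappa / 2)) by rewrite /Q ln_powR /w; congr expR; ring.
have sp : s * p <= 9 * Q.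
  apply: le_trans (ler_wpM2l (expR_ge0 _) hp) _.
  rewrite mulrCA ler_pM2l // -expRD QE ler_expR -mulrDr ler_wpM2l //; lra.
have sM : s `^ (- delta) * expR (w * C) <= Q.
  rewrite -expRM -expRD QE ler_expR -mulrA -mulrDr ler_wpM2l // /c mulrN divfK ?gt_eqF //; lra.
lra.
Qed.

(** * Passage to the limit *)

Theorem theorem1p1 (R : realType) (kappa : R)
    (M : nat -> nat)
    (d : nat -> measure_display) (Omega : forall N, measurableType (d N))
    (P : forall N, probability (Omega N) R)
    (X : forall N, 'I_(M N) -> {RV (P N) >-> R})
    (Phi : forall N, 'rV[R]_(M N) -> 'M[R]_N)
    (mu : nat -> probability R R) :
  let H := fun (N : nat) (w : Omega N) => Phi N (random_vector (X N) w) in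
  let LipPhi := fun N : nat => Lip_norm (@l2norm R (M N)) (@Ftilde_norm R N) (Phi N) in
  let Hcut := fun (N : nat) (w : Omega N) =>
    Phi N (cut_vector (N%:R `^ (- kappa) / fine (LipPhi N)) (X N) w) in
  0 < kappa ->
  (forall N, (0 < N)%N -> (1 <= M N)%N) ->
  (forall N x, (0 < N)%N -> Phi N x \is symmetricmx) ->
  (forall N, (0 < N)%N -> mutually_independent (X N)) ->
  (forall N, (0 < N)%N -> (LipPhi N < +oo)%E) ->
  (forall N (A : set 'M[R]_N), (0 < N)%N ->
    (forall T, A T -> T \is symmetricmx) -> convex_set A ->
    convex_set (Phi N @^-1` A)) ->
  (forall N, (0 < N)%N ->
    (dBL (mean_esd (P N) (H N)) (mu N) <= (N%:R `^ (- kappa))%:E)%E) ->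
  (exists K : set R, compact K /\
    forall N, (0 < N)%N -> mu N (~` K) = 0%E) ->
  (forall N, (0 < N)%N -> exists rho : R -> R,
    has_density_on (mu N) `]- kappa, kappa[ rho /\
    forall x : R, 0 < `|x| < kappa ->
      rho x < kappa^-1 * `|x| `^ (- 1 + kappa)) ->
  (forall eps : R, 0 < eps ->
    ((N%:R^-1)%:E * lne 'E_(P N)[fun w =>
        (\prod_(l <- eigenvalues (H N w))
          (1 + `|l| * (expR (N%:R `^ eps) < `|l|)%R%:R))%R])%E
      @[N --> \oo] --> 0%E) ->
  (forall eps : R, 0 < eps ->
    P N [set w | forall l, l \in eigenvalues (H N w) ->
           l \notin `[- expR (- (N%:R `^ eps)), expR (- (N%:R `^ eps))]]
      @[N --> \oo] --> 1%E) ->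
  (exists2 delta : R, 0 < delta &
    (limn_esup (fun N : nat => ((N%:R * ln N%:R)^-1)%:E *
       lne 'E_(P N)[fun w => (`|\det (H N w)| `^ (1 + delta))%R]) < +oo)%E) ->
  (((N%:R * ln N%:R)^-1)%:E *
      lne (P N [set w | (N%:R `^ (- kappa))%:E
                          < dKS (esd (H N w)) (esd (Hcut N w))]))%E
    @[N --> \oo] --> -oo%E ->
  ((N%:R^-1)%:E * lne 'E_(P N)[fun w => `|\det (H N w)|%R]
      - \int[mu N]_x lne `|x|%R%:E)%E
    @[N --> \oo] --> 0%E.
Proof.
move=> H LipPhi Hcut kappa0 M1 sPhi iX LipF cPhi hBL [K [cK muK]] hrho hC1 hC2 [delta d0 hC3] hS.
pose a : R := Num.min kappa 1; pose eps : R := a ^+ 2 / 8.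
have a0 : 0 < a by rewrite lt_min kappa0 ltr01.
have a1 : a <= 1 by rewrite ge_min lexx orbT.
have eps0 : 0 < eps by rewrite divr_gt0 // exprn_gt0.
have [B KB] := compact_norm_bound cK.
pose C : R := ball_constant kappa.
have C0 : 0 <= C by exact: ball_constant_ge0.
pose LC : R := log_constant a C.
have muB N : (0 < N)%N -> forall r : R, 0 < r -> r <= a ->
    (mu N [set x : R | (`|x| < r)%R] <= (C * r `^ a)%:E)%E.
  by move=> /hrho[rho [h1 h2]] r; exact: mu_ball_le h2 r.
have mu0 N : (0 < N)%N -> mu N [set 0] = 0%E.
  by move=> /hrho[rho [h1 h2]]; exact: mu_set0 h1.
have muF N : (0 < N)%N -> mu N [set x : R | B < `|x|] = 0%E.
  by move=> N0; apply: compact_norm_bound_measure_zero (muK N N0).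
have [C3 hC3'] := limn_esup_lty hC3.
(* The bound on the limit superior may be negative, while the threshold calls for a nonnegative
   rate. *)
pose C4 := Num.max C3 0.
have C40 : 0 <= C4 by rewrite le_max lexx orbT.
(* The threshold [s = N ^ (Cs * N)] makes [s ^ (- delta) * E[|det| ^ (1 + delta)]]
   negligible, while by [hS] the exceptional event has probability [N ^ (- L * N)]. *)
pose Cs := (C4 + kappa) / delta.
have Cs0 : 0 < Cs by rewrite divr_gt0 // ltr_wpDl.
pose L := Cs + kappa + 1.
have L1 : 1 <= L by rewrite lerDr addr_ge0 // ltW.
have L0 : 0 <= L by exact: le_trans L1.
(* 23 comes from the bounds at fixed size and 1 from the logarithmic deficit near the origin. *)
apply: (@ereal_cvg0_near _ _ 24) => // t t0.
have f1 := concentration_rate_near kappa0 t0 L0.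
have f2 := error_terms_near kappa0 t0 L1.
have f3 := count_terms_near kappa0 t0 C0.
have f4 : \forall N \near \oo, ((N%:R^-1)%:E * lne 'E_(P N)[fun w =>
    (\prod_(l <- eigenvalues (H N w))
      (1 + `|l| * (expR (N%:R `^ eps) < `|l|)%R%:R))%R] <= t%:E)%E.
  exact: ereal_cvg_le_near (hC1 eps eps0).
have f5 : \forall N \near \oo, ((3 / 4)%:E <= (P N [set w | forall l, l \in eigenvalues (H N w) ->
           l \notin `[- expR (- (N%:R `^ eps)), expR (- (N%:R `^ eps))]])%R)%E.
  by refine (ereal_cvg_ge_near _ (hC2 eps eps0)); lra.
have f6 : \forall N \near \oo, (((N%:R * ln N%:R)^-1)%:E *
      lne (P N [set w | (N%:R `^ (- kappa))%:E
                          < dKS (esd (H N w)) (esd (Hcut N w))]) <= (- L)%:E)%E.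
  by move/cvgeNyPle : hS; apply.
have ka20 : 0 < kappa * a / 2 by rewrite divr_gt0 // mulr_gt0.
have k20 : 0 < kappa / 2 by rewrite divr_gt0.
have a20 : 0 < a / 2 by rewrite divr_gt0.
have LC0 : 0 <= LC.
  by rewrite divr_ge0 ?subr_ge0 ?(ltW (half_powR_lt1 kappa0)) // mulr_ge0 // ln_ge0 // ler1n.
(* Keeps the deficit [LC * e ^ a] below [t]; the added 1 avoids dividing by zero. *)
have f7 : \forall N \near \oo, N%:R `^ (- (kappa * a / 2)) <= t / (LC + 1).
  by apply: powRN_le_near => //; rewrite divr_gt0 // ltr_wpDl.
have f8 : \forall N \near \oo, N%:R `^ (- (kappa / 2)) <= a / 2 by exact: powRN_le_near.
have f9 : \forall N \near \oo, B <= N%:R `^ eps by exact: powR_ge_near.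
have f10 : \forall N \near \oo, ln 11 / t <= N%:R :> R by exact: nbhs_infty_ger.
near=> N.
have N2 : (1 < N)%N by near: N; exact: nbhs_infty_gt.
have N0 : (0 < N)%N by exact: ltnW.
have n1 : 1 < N%:R :> R by rewrite ltr1n.
have n0 : 0 < N%:R :> R by rewrite ltr0n.
have nl0 : 0 < N%:R * ln N%:R :> R by rewrite mulr_gt0 // ln_gt0.
have g1 : 8 * expR (- (t ^+ 2 * N%:R * (N%:R `^ (- (kappa / 2))) ^+ 2
    / (64 * (N%:R `^ (- kappa)) ^+ 2))) + expR (N%:R * ln N%:R * - L)
    <= 9 * expR (N%:R * ln N%:R * - L) :> R by near: N; exact: f1.
have g2 p : 0 <= p -> p <= 9 * expR (N%:R * ln N%:R * - L) ->
    let e := N%:R `^ (- (kappa / 2)) in let b := expR (N%:R `^ eps) in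
    let S := Num.max `|ln e| `|ln b| in
    let u := 8 * t + 2 * N%:R `^ (- kappa) * (ln b - ln e) in
    2 * u + (2 * S + u) * p + (e^-1 + S) * N%:R `^ (- kappa) <= 21 * t /\ p <= 1 / 8.
  by move: p; near: N; exact: f2.
have [g3 g3'] : let e := N%:R `^ (- (kappa / 2)) in
    let rho := N%:R `^ (- (kappa * a / 4)) in
    (2 * C * e `^ a + (e^-1 + 1) * N%:R `^ (- kappa)) / rho <= 1 / 8 /\
    rho * N%:R `^ eps <= t by near: N; exact: f3.
have g4 : ('E_(P N)[fun w => (\prod_(l <- eigenvalues (H N w))
    (1 + `|l| * (expR (N%:R `^ eps) < `|l|)%R%:R))%R] <= (expR (N%:R * t))%:E)%E.
  apply: lne_le_expR => //; last by near: N.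
  apply: expectation_ge0 => w; apply: prodr_ge0 => k _.
  by rewrite addr_ge0 // mulr_ge0.
have g5 : ((3 / 4)%:E <= (P N [set w | forall l, l \in eigenvalues (H N w) ->
           l \notin `[- expR (- (N%:R `^ eps)), expR (- (N%:R `^ eps))]])%R)%E by near: N.
have g6 : (P N [set w | (N%:R `^ (- kappa))%:E < dKS (esd (H N w)) (esd (Hcut N w))]
    <= (expR (N%:R * ln N%:R * - L))%:E)%E.
  by apply: lne_le_expR => //; near: N.
have g6' : ('E_(P N)[fun w => (`|\det (H N w)| `^ (1 + delta))%R]
    <= (expR (N%:R * ln N%:R * C4))%:E)%E.
  apply: lne_le_expR => //; first by apply: expectation_ge0 => w; exact: powR_ge0.
  near: N; apply: filterS hC3' => N /le_trans -> //.
  by rewrite lee_fin le_max lexx.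
have g7 : N%:R `^ (- (kappa * a / 2)) <= t / (LC + 1) by near: N.
have g8 : N%:R `^ (- (kappa / 2)) <= a / 2 by near: N.
have g9 : B <= N%:R `^ eps by near: N.
have g10 : ln 11 / t <= N%:R :> R by near: N.
have [l0 lPhi] := Lip_normP (M1 N N0) (LipF N N0).
pose e : R := N%:R `^ (- (kappa / 2)); pose b : R := expR (N%:R `^ eps).
have e0 : 0 < e by rewrite powR_gt0.
(* The small ball bound is applied at radius [2 * e], where [plateau] vanishes. *)
have e2 : 2 * e <= a by rewrite mulrC -ler_pdivlMr.
have ea : e <= a by lra.
have b1 : 1 <= b by rewrite -expR0 ler_expR powR_ge0.
have eb : e <= b by lra.
have Bb : B <= b.
  apply: (@le_trans _ _ (N%:R `^ eps)); first exact: g9.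
  by apply: le_trans (expR_ge1Dx _); rewrite lerDr.
have [t' /andP[t'0 t'le] ->] := integral_lne_norm a0 a1 C0 (muB N N0) (mu0 N N0) (muF N N0) e0 ea eb Bb.
have eaE : e `^ a = N%:R `^ (- (kappa * a / 2)).
  by rewrite -powRrM; congr (_ `^ _); ring.
have t't : t' <= t.
  apply: le_trans t'le _; apply: (@le_trans _ _ (LC * (t / (LC + 1)))).
    by rewrite ler_wpM2l // eaE.
  by rewrite mulrCA ler_piMr ?(ltW t0) // ler_pdivrMr ?mul1r ?lerDl // ltr_wpDl.
have [x -> xA] : exists2 x, ((N%:R^-1)%:E * lne 'E_(P N)[fun w => `|\det (H N w)|%R] = x%:E)%E &
    \int[mu N]_y trunc_log e b y - 23 * t <= x <= \int[mu N]_y trunc_log e b y + 23 * t.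
  have p0 : 0 <= 8 * expR (- (t ^+ 2 * N%:R * e ^+ 2 / (64 * (N%:R `^ (- kappa)) ^+ 2)))
      + expR (N%:R * ln N%:R * - L).
    by rewrite addr_ge0 ?expR_ge0 // mulr_ge0 // expR_ge0.
  have [g21 g22] := g2 _ p0 g1.
  apply: (det_expectation_bounds N0 l0 (powR_gt0 (- kappa) n0) (sPhi N ^~ N0) lPhi (iX N N0)
    (fun A => cPhi N A N0) (tau := N%:R `^ eps) (rho := N%:R `^ (- (kappa * a / 4)))
    (s := expR (N%:R * ln N%:R * Cs)) (delta := delta)
    (pb := expR (N%:R * ln N%:R * - L)) (M := expR (N%:R * ln N%:R * C4))
    (V := 2 * C * e `^ a)).
  - exact: e0.
  - lra.
  - exact: b1.
  - exact: t0.
  - exact: powR_ge0.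
  - exact: powR_gt0.
  - exact: expR_gt0.
  - exact: d0.
  - exact: g6.
  - exact: hBL.
  - exact: g5.
  - exact: g4.
  - exact: g6'.
  - have e20 : 0 < 2 * e by rewrite mulr_gt0.
    apply: le_trans (muB N N0 _ e20 e2) _; rewrite lee_fin (_ : 2 * C * e `^ a = C * (2 * e `^ a)); last by ring.
    rewrite ler_wpM2l //.
    (* The factor 2 in [V] bounds [2 ^ a], as [a <= 1]. *)
    rewrite powRM ?(ltW e0) // ler_wpM2r ?powR_ge0 // -[leRHS]powRr1 //.
    by apply: ler_powR => //; rewrite ler1n.
  - exact: g21.
  - exact: g22.
  - exact: g3.
  - exact: g3'.
  - exact: (moment_tail_le (ltW n1) kappa0 d0 C40 g1).
  - by rewrite -ler_pdivrMr.
exists (x - (\int[mu N]_y trunc_log e b y - t')); first by rewrite EFinB.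
by rewrite ler_norml; case/andP: xA => *; apply/andP; split; lra.
Unshelve. all: by end_near. Qed.
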